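(* Fix $t>0$ and $q\in\mathbb{R}$. Let $V:\mathbb{R}\to\mathbb{R}$ be bounded below, with continuous derivatives up to fourth order and $V''\ge0$. For $\hbar>0$ let $\eta^\hbar_*$ be the solution of $$\begin{cases}\hbar\dfrac{\partial\eta^\hbar_*}{\partial s}(s,x)=\dfrac{\hbar^2}{2}\Delta\eta^\hbar_*(s,x)-V(x)\eta^\hbar_*(s,x),&(s,x)\in(0,\infty)\times\mathbb{R},\\[2mm]\eta^\hbar_*(0,x)=\dfrac{1}{\sqrt{2\pi\hbar}}e^{-x^2/(2\hbar)},&x\in\mathbb{R}.\end{cases}$$ Let $F$, $G$, $S$ be the functionals on $C_0([0,t])$ given by $$F(\phi)=-\left(\int_0^tV(\phi(s)+q)\,ds+\frac{|\phi(t)+q|^2}{2}\right),\qquad G(\phi)=\int_0^tV'(\phi(s)+q)\,ds+(\phi(t)+q),$$ and $S(\phi)=\frac12\int_0^t\phi'(s)^2\,ds$ if $\phi$ is absolutely continuous, $S(\phi)=\infty$ otherwise. Assume that the supremum of $F-S$ over $C_0([0,t])$ is reached uniquely at some $\phi_*\in C_0^1([0,t])$. Then, as $\hbar\to0$, $$\hbar\,\frac{\nabla\eta^\hbar_*(t,q)}{\eta^\hbar_*(t,q)}\sim-\left(G(\phi_* )+\frac{\bar K_1^*}{K_0^*}\hbar+o(\hbar)\right),$$ where, with $W=(W_s)_{0\le s\le t}$ a standard one-dimensional Wiener process started at $0$, $$K_0^*=\mathbb{E}\left[\exp\left(\tfrac12F''(\phi_* )(W,W)\right)\right],$$ $$\begin{aligned}\bar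 K_1^*=\mathbb{E}\Big[\exp\left(\tfrac12F''(\phi_* )(W,W)\right)\Big(&\tfrac12G''(\phi_* )(W,W)+\tfrac16G'(\phi_* )(W)\,F^{(3)}(\phi_* )(W^{\otimes3})\\&+\tfrac1{24}G(\phi_* )F^{(4)}(\phi_* )(W^{\otimes4})+\tfrac1{72}G(\phi_* )\left(F^{(3)}(\phi_* )(W^{\otimes3})\right)^2\Big)\Big].\end{aligned}$$
   Context: $C_0([0,t])$ is the space of continuous functions $\phi:[0,t]\to\mathbb{R}$ with $\phi(0)=0$ (uniform norm), and $C_0^1([0,t])$ is the subset of continuously differentiable ones. $\nabla$ denotes the derivative in the space variable. The solution $\eta^\hbar_*$ is the one given by the Feynman–Kac representation $\eta^\hbar_*(t,q)=\frac{1}{\sqrt{2\pi\hbar}}\mathbb{E}\left[\exp\left(\frac1\hbar F(\sqrt\hbar W)\right)\right]$. Derivatives of $F$ and $G$ are Fréchet derivatives on $C_0([0,t])$; explicitly $$F''(\phi_* )(W,W)=-\left(\int_0^tV''(\phi_*(s)+q)W_s^2\,ds+W_t^2\right),$$ $$F^{(j)}(\phi_* )(W^{\otimes j})=-\int_0^tV^{(j)}(\phi_*(s)+q)W_s^j\,ds\quad(j=3,4),$$ $$G'(\phi_* )(W)=\int_0^tV''(\phi_*(s)+q)W_s\,ds+W_t,\qquad G''(\phi_* )(W,W)=\int_0^tV'''(\phi_*(s)+q)W_s^2\,ds.$$ The symbol $\sim$ denotes asymptotic equivalence as $\hbar\to0$: $f(\hbar)\sim h(\hbar)$ means $f(\hbar)=h(\hbar)(1+o(1))$.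 Thus the conclusion says that there is a function $r(\hbar)=o(\hbar)$ such that the left-hand side equals $-\left(G(\phi_* )+\frac{\bar K_1^*}{K_0^*}\hbar+r(\hbar)\right)(1+o(1))$ as $\hbar\to0$. *)

(* Defs.v *)
From HB Require Import structures.
From mathcomp Require Import all_boot all_order ssralg ssrnum interval.
From mathcomp Require Import all_classical all_reals all_analysis.

Set Implicit Arguments.
Unset Strict Implicit.
Unset Printing Implicit Defensive.

Import Order.TTheory GRing.Theory Num.Theory.
Import numFieldNormedType.Exports.

Local Open Scope classical_set_scope.
Local Open Scope ring_scope.

(* poly is deliberately not imported: its notations f^`() and f^`(n) would
   shadow those for derivatives of functions. *)

(* A path on [0, t] is represented by a function R -> R; only its values on
   [0, t] matter, and equality of paths is {in `[0, t], f =1 g}. *)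

Definition C0 (R : realType) (t : R) : set (R -> R) :=
  [set f | {within `[0, t], continuous f} /\ f 0 = 0].

(* Difference quotients are taken inside [0, t], hence one-sided at 0 and t. *)
Definition C01 (R : realType) (t : R) : set (R -> R) :=
  [set f | C0 t f /\ exists g : R -> R,
     {within `[0, t], continuous g} /\
     forall s, s \in `[0, t] ->
       (f r - f s) / (r - s) @[r --> within `[0, t] s^'] --> g s].

Definition absolutely_continuous (R : realType) (t : R) (f : R -> R) : Prop :=
  forall e : R, 0 < e -> exists2 d : R, 0 < d &
    forall (n : nat) (a b : 'I_n -> R),
      (forall i, [/\ 0 <= a i, a i <= b i & b i <= t]) ->
      (forall i j, i != j -> b i <= a j \/ b j <= a i) ->
      \sum_(i < n) (b i - a i) < d ->
      \sum_(i < n) `|f (b i) - f (a i)| < e.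

(* [f^`()] is the almost everywhere derivative of an absolutely continuous f;
   where f is not derivable, and possibly at 0 and t, its value is irrelevant
   since these points form a null set. *)
Definition action (R : realType) (t : R) (f : R -> R) : \bar R :=
  if `[< absolutely_continuous t f >]
  then (2^-1%:E * \int[lebesgue_measure]_(s in `[0%R, t]) (f^`() s ^+ 2)%:E)%E
  else +oo%E.

Section functionals.
Variables (R : realType) (V : R -> R) (t q : R).
Implicit Types f w : R -> R.

Let mu : set R -> \bar R := @lebesgue_measure R.

Definition F f : R :=
  - ((\int[mu]_(s in `[0, t]) V (f s + q)) + `|f t + q| ^+ 2 / 2).

Definition G f : R :=
  (\int[mu]_(s in `[0, t]) V^`() (f s + q)) + (f t + q).

(* The Frechet derivatives of F and G at f, on the diagonal (w, ..., w). *)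

Definition F2 f w : R :=
  - ((\int[mu]_(s in `[0, t]) (V^`(2) (f s + q) * w s ^+ 2)) + w t ^+ 2).

Definition F3 f w : R :=
  - \int[mu]_(s in `[0, t]) (V^`(3) (f s + q) * w s ^+ 3).

Definition F4 f w : R :=
  - \int[mu]_(s in `[0, t]) (V^`(4) (f s + q) * w s ^+ 4).

Definition G1 f w : R :=
  (\int[mu]_(s in `[0, t]) (V^`(2) (f s + q) * w s)) + w t.

Definition G2 f w : R :=
  \int[mu]_(s in `[0, t]) (V^`(3) (f s + q) * w s ^+ 2).

End functionals.

Definition reaches_sup_uniquely (R : realType) (V : R -> R) (t q : R)
    (phi : R -> R) : Prop :=
  let J f := ((F V t q f)%:E - action t f)%E in
  [/\ C0 t phi,
      J phi = ereal_sup [set J f | f in C0 t] &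
      forall f, C0 t f -> J f = ereal_sup [set J g | g in C0 t] ->
        {in `[0, t], f =1 phi}].

Section wiener.
Context (R : realType) (d : measure_display) (T : measurableType d)
  (P : probability T R).

Definition independent_increments (W : R -> {RV P >-> R}) : Prop :=
  forall (n : nat) (u : nat -> R) (A : nat -> set R),
    0 <= u 0%N -> (forall i, u i <= u i.+1) -> (forall i, measurable (A i)) ->
    let E i := [set w | A i (W (u i.+1) w - W (u i) w)] in
    P (\bigcap_(i < n) E i) = (\prod_(i < n) P (E i))%E.

(* W is indexed by R, but nothing is required of W at negative times.
   The second parameter of normal_prob is the standard deviation. *)
Definition standard_wiener (W : R -> {RV P >-> R}) : Prop :=
  [/\ forall w, W 0 w = 0,
      forall w, {within `[0, +oo[, continuous (fun s => W s w)},
      independent_increments W &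
      forall u v, 0 <= u -> u < v -> forall A : set R, measurable A ->
        P [set w | A (W v w - W u w)] = normal_prob 0 (Num.sqrt (v - u)) A].


(* The integrands are integrable, so [fine] below only changes the type. *)

Definition feynman_kac (W : R -> {RV P >-> R}) (V : R -> R) (h s x : R) : R :=
  (Num.sqrt (2 * pi * h))^-1 *
  fine 'E_P[fun w => expR (h^-1 * F V s x (fun r => Num.sqrt h * W r w))].

Definition K0 (W : R -> {RV P >-> R}) (V : R -> R) (t q : R) (phi : R -> R)
    : R :=
  fine 'E_P[fun w => expR (2^-1 * F2 V t q phi (W ^~ w))].

Definition K1bar (W : R -> {RV P >-> R}) (V : R -> R) (t q : R) (phi : R -> R)
    : R :=
  fine 'E_P[fun w => expR (2^-1 * F2 V t q phi (W ^~ w)) *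
    (2^-1 * G2 V t q phi (W ^~ w)
     + 6^-1 * G1 V t q phi (W ^~ w) * F3 V t q phi (W ^~ w)
     + 24^-1 * G V t q phi * F4 V t q phi (W ^~ w)
     + 72^-1 * G V t q phi * F3 V t q phi (W ^~ w) ^+ 2)].

End wiener.

(* Classical solution of
     h d_s u = h^2/2 u'' - V u,  u(0, x) = exp(-x^2/(2h)) / sqrt(2 pi h),
   continuous up to time 0. *)
Definition heat_solution (R : realType) (V : R -> R) (h : R) (u : R -> R -> R)
    : Prop :=
  [/\ {within [set p : R * R | 0 <= p.1], continuous (fun p => u p.1 p.2)},
      forall s x, 0 < s ->
        [/\ derivable (u ^~ x) s 1, derivable (u s) x 1 &
            derivable (u s)^`() x 1],
      forall s x, 0 < s ->
        h * (u ^~ x)^`() s = h ^+ 2 / 2 * (u s)^`(2) x - V x * u s x &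
      forall x, u 0 x = (Num.sqrt (2 * pi * h))^-1 * expR (- x ^+ 2 / (2 * h))].

(* f(h) = g(h) (1 + o(1)) as h -> 0, h > 0. *)
Definition asymp_equiv (R : realType) (f g : R -> R) : Prop :=
  exists2 e : R -> R, e h @[h --> 0^'+] --> 0 &
    \forall h \near 0^'+, f h = g h * (1 + e h).

(* Main.v *)
(* Write a = phi_* + q, G = G(phi_* ). By the Euler-Lagrange equation for phi_*
   and the Cameron-Martin shift by phi_*,
     eta(t, q + dl) = N_h exp(- dl G / h) E[exp(- Q(dl + sqrt h W) / h)],
   where Q, the remainder of -F at phi_* after its first-order part, is
   nonnegative because V is convex. Expanding Q to fourth order shows that the
   difference quotients in dl of this expectation tend to kappa, the part of
   - K1bar without the factor G, even for exponentially small dl = +- exp(- D / h).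
   Reflecting the last increment of W bounds d_s eta from above, so the equation
   makes eta(t, .) semiconcave near q with a constant of order exp(C / h); for D
   large, nabla eta therefore lies between the two difference quotients up to
   negligible errors, and
     h nabla eta / eta = - G + h (kappa / K0 + o(1)).
   If G <> 0 the leading order suffices; if G = 0 then kappa = - K1bar. *)

Require Import Defs.
From HB Require Import structures.
From mathcomp Require Import all_boot all_order ssralg ssrnum interval archimedean.
From mathcomp Require Import all_classical all_reals all_analysis.
From mathcomp Require Import measurable_realfun ring lra.

Set Implicit Arguments.
Unset Strict Implicit.
Unset Printing Implicit Defensive.

Import Order.TTheory GRing.Theory Num.Theory.
Import numFieldNormedType.Exports.

Local Open Scope classical_set_scope.
Local Open Scope ring_scope.

(** * Laws of the increments of W *)

(** [V] is only bounded below and convex, and nothing limits the growth of its derivatives along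
    Wiener paths; so the expectation is not differentiated under the integral sign, and only
    exponentials of nonpositive quantities are dominated. The Taylor expansion is local: it is used
    where sqrt h sup |W| <= rad. Elsewhere the difference quotient is bounded by 1/|dl|, and the
    Gaussian tail of sup |W| absorbs this factor once rad is large compared with the rate of decay
    of dl, a rate that can be fixed beforehand because it does not involve rad.

    No stochastic integral occurs. The Euler-Lagrange equation is used integrated twice, with the
    covariance min(s, u) of W as kernel; the Cameron-Martin formula is proved for increments on a
    grid, where summation by parts turns its weight into Riemann sums of W, and then passed to the
    limit.

    The difference quotient contains a term of order h^(-1/2), linear in W against an even weight;
    its expectation vanishes by the symmetry of W. *)

Section density.
Local Open Scope ereal_scope.
Context d1 d2 (X : measurableType d1) (Y : measurableType d2) (R : realType).
Import HBNNSimple.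

(** The hypothesis identifies [nu] on sets as the image under [phi] of the measure with density [D];
    simple functions and monotone convergence carry it to nonnegative functions. *)
Lemma ge0_integral_density (mu : {measure set X -> \bar R})
    (nu : {measure set Y -> \bar R}) (phi : X -> Y) (D : X -> R) :
  measurable_fun [set: X] phi -> measurable_fun [set: X] D -> (forall x, 0 <= D x)%R ->
  (forall B, measurable B -> nu B = \int[mu]_(x in phi @^-1` B) (D x)%:E) ->
  forall g : Y -> \bar R, measurable_fun [set: Y] g -> (forall y, 0 <= g y) ->
  \int[nu]_y g y = \int[mu]_x (g (phi x) * (D x)%:E).
Proof.
move=> mphi mD D0 nuE g mg g0.
have mphiB B : measurable B -> measurable (phi @^-1` B).
  by move=> mB; rewrite -(setTI (_ @^-1` _)); exact: mphi.
pose f_ := nnsfun_approx measurableT mg.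
have f_cvg y : (f_ n y)%:E @[n --> \oo] --> g y.
  by apply: cvg_nnsfun_approx => // z _; exact: g0.
transitivity (limn (fun n => \int[nu]_y (f_ n y)%:E)).
  rewrite -monotone_convergence//.
  - by apply: eq_integral => y _; apply/esym/cvg_lim => //; exact: f_cvg.
  - by move=> n; exact/measurable_EFinP/measurable_funP.
  - by move=> n y _; rewrite lee_fin.
  - by move=> y _ m n mn; rewrite lee_fin; exact/lefP/nd_nnsfun_approx.
have mfn n : measurable_fun setT (fun x => (f_ n (phi x))%:E * (D x)%:E).
  apply: emeasurable_funM => //; apply/measurable_EFinP => //.
  by apply: measurableT_comp => //; exact/measurable_funP.
rewrite [X in limn X](_ : _ =
    (fun n => \int[mu]_x ((f_ n (phi x))%:E * (D x)%:E))).
  rewrite -monotone_convergence//; last 2 first.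
    - by move=> n x _; rewrite mule_ge0// lee_fin.
    - move=> x _ m n mn; rewrite lee_wpmul2r// lee_fin //.
      exact/lefP/nd_nnsfun_approx.
  apply: eq_integral => x _; apply/cvg_lim => //.
  by apply: cvgeZr => //; exact: f_cvg.
apply/funext => n.
transitivity (\sum_(k \in range (f_ n))
    \int[mu]_x (k%:E * ((\1_(phi @^-1` (f_ n @^-1` [set k])) x) * D x)%:E)).
  under eq_integral do rewrite fimfunE -fsumEFin//.
  rewrite ge0_integral_fsum//; last 2 first.
  - by move=> y; exact/measurable_EFinP/measurable_funM.
  - by move=> y x _; rewrite nnfun_muleindic_ge0.
  apply: eq_fsbigr => r; rewrite inE => -[y _ fnr].
  have r0 : (0 <= r)%R by rewrite -fnr.
  rewrite integralZl_indic_nnsfun// integral_indic//= setIT.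
  have mf : measurable (f_ n @^-1` [set r]) by rewrite -[X in measurable X]setTI; apply: measurable_funP.
  rewrite nuE// ge0_integralZl//; last 2 first.
    apply/measurable_EFinP/measurable_funM => //.
    by apply: measurable_indic; exact: mphiB.
    by move=> x _; rewrite lee_fin mulr_ge0.
  congr (_ * _); rewrite integral_mkcond; apply: eq_integral => x _.
  by rewrite /patch indicE; case: ifPn => _; rewrite (mul1r, mul0r).
rewrite -ge0_integral_fsum//; last 2 first.
- move=> r; apply: emeasurable_funM => //.
  apply/measurable_EFinP/measurable_funM => //.
  by apply: measurable_indic; apply: mphiB; rewrite -[X in measurable X]setTI; apply: measurable_funP.
- move=> r x _; rewrite -EFinM lee_fin mulrA mulr_ge0//.
  by have := nnfun_muleindic_ge0 (f_ n) r (phi x); rewrite lee_fin.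
apply: eq_integral => x _; rewrite [in RHS]fimfunE -fsumEFin//.
rewrite ge0_mule_fsuml//.
  by apply: eq_fsbigr => r _; rewrite -!EFinM mulrA.
by move=> r; rewrite nnfun_muleindic_ge0.
Qed.
End density.

(** * Changes of variables for independent coordinates *)

Section product_law.
Context (R : realType).

(** Sequences stand for [n]-tuples: the rectangles constrain the first [n] coordinates only, so the
    generated sigma-algebra is that of R^n while indices remain natural numbers. *)
Definition rect (n : nat) : set (set (nat -> R)) :=
  [set B | exists2 A : nat -> set R, (forall i, measurable (A i)) &
    B = [set x | forall i, (i < n)%N -> A i (x i)]].

Definition seqspace (n : nat) := g_sigma_algebraType (rect n).

Lemma measurable_coord n i : (i < n)%N ->
  measurable_fun [set: seqspace n] (fun x => x i).
Proof.
move=> ltin _ A mA; apply: sub_sigma_algebra.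
exists (fun j => if j == i then A else setT).
  by move=> j; case: ifP.
apply/seteqP; split=> x /=.
  by move=> [_ Ax] j _; case: eqP => // ->.
by move=> /(_ _ ltin); rewrite eqxx.
Qed.

Context d (T : measurableType d) (P : probability T R).
Variables (n : nat) (X : nat -> T -> R) (N : nat -> probability (measurableTypeR R) R).
Hypothesis mX : forall i, measurable_fun [set: T] (X i).

Lemma measurable_seqspace (Y : nat -> T -> R) :
  (forall i, measurable_fun [set: T] (Y i)) ->
  measurable_fun [set: T] (fun w => (fun i => Y i w) : seqspace n).
Proof.
move=> mY; apply: (measurability (rect n : set (set (seqspace n)))) => //.
move=> _ [_ [A mA ->] <-].
rewrite setTI; suff -> : (fun w => (fun i => Y i w) : seqspace n) @^-1` [set x | forall i, (i < n)%N -> A i (x i)]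
  = \bigcap_(i < n) (Y i @^-1` A i).
  2: by apply/seteqP; split.
apply: bigcap_measurableType => i _.
by rewrite -[X in measurable X]setTI; exact: mY.
Qed.

Local Open Scope ereal_scope.

Hypothesis XN : forall A : nat -> set R, (forall i, measurable (A i)) ->
  P (\bigcap_(i < n) X i @^-1` (A i)) = \prod_(i < n) N i (A i).

Variables (tr : nat -> R -> R) (D : nat -> R -> R).
Hypothesis mtr : forall i, measurable_fun [set: R] (tr i).
Hypothesis mD : forall i, measurable_fun [set: R] (D i).
Hypothesis D0 : forall i x, (0 <= D i x)%R.
Hypothesis trN : forall i A, measurable A ->
  \int[N i]_(x in tr i @^-1` A) (D i x)%:E = N i A.

Let E k (A : nat -> set R) : set T :=
  \bigcap_(i < n) X i @^-1` (if (i < k)%N then tr i @^-1` (A i) else A i).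

Let mE k A : (forall i, measurable (A i)) -> measurable (E k A).
Proof.
move=> mA; apply: bigcap_measurableType => i _.
rewrite -[X in measurable X]setTI; apply: mX => //; case: ifP => // _.
by rewrite -[X in measurable X]setTI; exact: mtr.
Qed.

Let mDX k : measurable_fun [set: T] (fun w => \prod_(i < k) D i (X i w))%R.
Proof.
by apply: measurable_prod => i _; apply: measurableT_comp.
Qed.

(** The coordinates are transformed one at a time. In the inductive step coordinate [k] is left
    free: by the induction hypothesis, its law under the weight of the earlier coordinates is the
    multiple [c] of [N k], and the change of variable acts on this factor alone. *)
Let int_E k A : (k <= n)%N -> (forall i, measurable (A i)) ->
  \int[P]_(w in E k A) (\prod_(i < k) D i (X i w))%:E = \prod_(i < n) N i (A i).
Proof.
elim: k A => [|k IH] A kn mA.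
  under eq_integral do rewrite big_ord0.
  rewrite integral_cst ?mul1e; last exact: mE.
  by rewrite -XN//; congr (P _); apply/seteqP; split.
pose A' B i := if i == k then B else A i.
have mA' B : measurable B -> forall i, measurable (A' B i).
  by move=> mB i; rewrite /A'; case: ifP.
pose c := \prod_(i < n | i != Ordinal kn) N i (A i).
have c0 : 0 <= c by apply: prode_ge0 => i _.
have cfin : c \is a fin_num.
  rewrite /c; elim/big_ind : _ => //; first by move=> ? ?; exact: fin_numM.
  by move=> i _; apply: fin_num_measure; exact: mA.

have prodA' B : \prod_(i < n) N i (A' B i) = c * N k B.
  rewrite (bigD1 (Ordinal kn))//= /A' eqxx muleC; congr (_ * _).
  by apply: eq_bigr => i /negPf ik; rewrite -val_eqE/= in ik; rewrite ik.
have EA' B : E k (A' B) = E k (A' setT) `&` X k @^-1` B.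
  apply/seteqP; split => w.
    move=> Ew; split; last first.
      by move: (Ew k kn); rewrite /= ltnn /A' eqxx.
    by move=> i /= lin; move: (Ew i lin); rewrite /A'; case: eqP => // _ _; case: ifP.
  move=> [Ew Bw] i /= lin; move: (Ew i lin); rewrite /A'.
  by case: eqP => // -> _; rewrite ltnn.
pose c' : {nonneg R} := NngNum (fine_ge0 c0).
pose D' w := ((\prod_(i < k) D i (X i w)) * \1_(E k (A' setT)) w)%R.
pose g x := (\1_(tr k @^-1` A k) x * D k x)%R.
have mtrA : measurable (tr k @^-1` A k).
  by rewrite -[X in measurable X]setTI; exact: mtr.
have D'0 w : (0 <= D' w)%R by rewrite mulr_ge0// prodr_ge0.
have mD' : measurable_fun [set: T] D'.
  by apply: measurable_funM => //; apply: measurable_indic; apply: mE; exact: mA'.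
have mg : measurable_fun [set: R] (EFin \o g).
  by apply/measurable_EFinP; apply: measurable_funM => //; exact: measurable_indic.
have g0 x : 0 <= (g x)%:E by rewrite lee_fin mulr_ge0.
have := @ge0_integral_density _ _ _ (measurableTypeR R) _ P (mscale c' (N k)) (X k) D'
  (mX k) mD' D'0 _ (EFin \o g) mg g0.
rewrite ge0_integral_mscale//= fineK//.
have -> : \int[N k]_x (g x)%:E = N k (A k).
  rewrite -trN// [RHS]integral_mkcond; apply: eq_integral => x _.
  by rewrite /g /patch indicE; case: ifPn => _; rewrite (mul1r, mul0r).
rewrite -prodA' => h.
transitivity (\prod_(i < n) N i (A' (A k) i)); last first.
  by apply: eq_bigr => i _; rewrite /A'; case: eqP => [->|].
rewrite h; last first.
  move=> B mB; rewrite /mscale/= fineK// -prodA' -IH; [|exact: ltnW|exact: mA'].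
  rewrite EA' integral_mkcond [RHS]integral_mkcond.
  apply: eq_integral => w _; rewrite /patch /D' indicE in_setI.
  by case: (w \in _) => //=; case: (w \in _); rewrite /= ?(mulr1, mulr0).
have EkA : E k.+1 A = E k (A' setT) `&` X k @^-1` (tr k @^-1` A k).
  apply/seteqP; split => w.
    move=> Ew; split; last by move: (Ew k kn); rewrite /= ltnSn.
    move=> i /= lin; move: (Ew i lin); rewrite /A' ltnS leq_eqVlt.
    by case: eqP => //= _ _; case: ifP.
  move=> [Ew Bw] i lin; move: (Ew i lin); rewrite /A' /= [(i < k.+1)%N]leq_eqVlt eqSS.
  by case: eqP => /= [->|].
rewrite EkA integral_mkcond; apply: eq_integral => w _.
rewrite /patch /D' /g /= in_setI !indicE big_ord_recr/= -EFinM.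
have -> : (w \in X k @^-1` (tr k @^-1` A k)) = (X k w \in tr k @^-1` A k).
  by apply/idP/idP; rewrite !inE.
case: (w \in _); rewrite /= ?mulr0//.
by case: (_ \in _); rewrite /= ?mul0r//; congr EFin; rewrite mulr1 mul1r mulrC.
Qed.

Let mtrX : measurable_fun [set: T] (fun w => (fun i => tr i (X i w)) : seqspace n).
Proof. by apply: measurable_seqspace => i; exact: measurableT_comp. Qed.

(* The densities [D i] compensate the maps [tr i]; Cameron-Martin shifts and sign
   flips of the increments are both instances. *)
Definition tilt B := \int[P]_(w in (fun w => (fun i => tr i (X i w)) : seqspace n) @^-1` B)
   (\prod_(i < n) D i (X i w))%:E.

Let tilt0 : tilt set0 = 0.
Proof. by rewrite /tilt preimage_set0 integral_set0. Qed.

Let tilt_ge0 B : 0 <= tilt B.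
Proof. by apply: integral_ge0 => w _; rewrite lee_fin prodr_ge0. Qed.

Let tilt_sigma_additive : semi_sigma_additive (tilt : set (seqspace n) -> \bar R).
Proof.
move=> F mF tF mUF; rewrite /tilt preimage_bigcup ge0_integral_bigcup//.
- apply: is_cvg_nneseries => k _ _; exact: tilt_ge0.
- by move=> k; rewrite -[X in measurable X]setTI; exact: mtrX.
- by apply/measurable_funTS/measurable_EFinP.
- by move=> w _; rewrite lee_fin prodr_ge0.
- by apply/trivIsetP => i j _ _ ij; rewrite -preimage_setI ((trivIsetP.1 tF) i j)// preimage_set0.
Qed.

HB.instance Definition _ := isMeasure.Build _ (seqspace n) R tilt tilt0 tilt_ge0 tilt_sigma_additive.

(** The law of [X] and [tilt] agree on rectangles by [int_E] at [k = n]; rectangles are stable under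
    intersection, so the two measures coincide. *)
Lemma ge0_integral_tilt (g : seqspace n -> \bar R) :
  measurable_fun [set: seqspace n] g -> (forall x, 0 <= g x) ->
  \int[P]_w g (fun i => X i w) =
  \int[P]_w (g (fun i => tr i (X i w)) * (\prod_(i < n) D i (X i w))%:E).
Proof.
move=> mg g0.
have mX' : measurable_fun [set: T] (fun w => (fun i => X i w) : seqspace n).
  exact: measurable_seqspace.
have D0' w : (0 <= \prod_(i < n) D i (X i w))%R by rewrite prodr_ge0.
rewrite -(@ge0_integral_density _ _ _ _ _ P tilt _ _ mtrX (mDX n) D0' (fun=> fun=> erefl) g)//.
rewrite -[LHS](ge0_integral_pushforward mX' P measurableT)//.
apply: eq_measure_integral => B mB _.
apply: (measure_unique (rect n : set (set (seqspace n))) (fun=> setT)) => //.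
- move=> _ _ [A mA ->] [B' mB' ->].
  exists (fun i => A i `&` B' i); first by move=> i; exact: measurableI.
  by apply/seteqP; split => [x [xA xB] i lin|x xAB]; [split; [exact: xA|exact: xB]
    |split => i lin; case: (xAB i lin)].
- by move=> _; exists (fun=> setT) => //; apply/seteqP; split.
- by apply/seteqP; split => // x _; exists 0%N.
- move=> _ [A mA ->]; rewrite /pushforward /= /tilt.
  transitivity (\prod_(i < n) N i (A i)).
    by rewrite -XN//; congr (P _); apply/seteqP; split.
  rewrite -(int_E (leqnn n) mA); congr (\int[P]_(w in _) _).
  by apply/seteqP; split => w h i /= lin; move: (h i lin); rewrite /= lin.
- by move=> _; apply: (le_lt_trans (probability_le1 _ _) (ltry 1)); rewrite preimage_setT.
Qed.

End product_law.

(** * The normal law under translations and reflection *)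

Section gaussian.
Context (R : realType).
Notation mu := (@lebesgue_measure R).
Local Open Scope ereal_scope.

Lemma lebesgue_measureD (c : R) (A : set R) : measurable A ->
  pushforward mu ((fun x => x + c)%R : _ -> measurableTypeR R) A = mu A.
Proof.
move=> mA.
have mc : measurable_fun [set: R] ((fun x => x + c)%R : _ -> measurableTypeR R).
  exact: measurable_funD.
pose f : {mfun R >-> measurableTypeR R} := HB.pack ((fun x => x + c)%R : _ -> measurableTypeR R)
  (isMeasurableFun.Build _ _ _ _ _ mc).
apply/esym; apply: (@lebesgue_measure_unique _ (pushforward mu f)) => //= _ [[a b]] _ <-.
rewrite /pushforward/=.
have -> : (fun x => (x + c)%R) @^-1` `]a, b] = `](a - c)%R, (b - c)%R]%classic.
  by apply/seteqP; split => x /=; rewrite !in_itv/= ltrBlDr lerBrDr.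
by rewrite !lebesgue_measure_itv/= !lte_fin ltrD2r -!EFinB opprB addrA subrK.
Qed.

Lemma ge0_integral_normal_prob (s : R) (B : set R) (f : R -> R) : measurable B ->
  measurable_fun [set: R] f -> (forall x, (0 <= f x)%R) ->
  \int[normal_prob 0 s]_(x in B) (f x)%:E =
  \int[mu]_(x in B) (f x * normal_pdf 0 s x)%:E.
Proof.
move=> mB mf f0; rewrite integral_mkcond [RHS]integral_mkcond.
rewrite (@ge0_integral_density _ _ (measurableTypeR R) (measurableTypeR R) R mu (normal_prob 0 s) id (normal_pdf 0 s))//.
- apply: eq_integral => x _; rewrite /patch; case: ifPn => _ //.
  by rewrite mul0e.
- exact: measurable_normal_pdf.
- by move=> x; exact: normal_pdf_ge0.
- apply/(measurable_restrictT _ mB); apply: measurable_funTS.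
  exact/measurable_EFinP.
- by move=> x; rewrite /patch; case: ifPn => // _; rewrite lee_fin.
Qed.

Lemma ge0_integral_isometry (f : R -> R) (g : R -> \bar R) :
  measurable_fun [set: R] f ->
  (forall A, measurable A -> pushforward mu (f : _ -> measurableTypeR R) A = mu A) ->
  measurable_fun [set: R] g -> (forall x, 0 <= g x) ->
  \int[mu]_x g (f x) = \int[mu]_x g x.
Proof.
move=> mf Hf mg g0.
rewrite -[LHS](@ge0_integral_pushforward _ _ (measurableTypeR R) (measurableTypeR R) R f mf mu setT g measurableT)//.
by apply: eq_measure_integral => A mA _; exact: Hf.
Qed.

(** The weight is the ratio of the normal densities at [x + c] and at [x]: the Cameron-Martin
    formula in dimension one. *)
Lemma normal_prob_shift (s c : R) (A : set R) : s != 0%R -> measurable A ->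
  \int[normal_prob 0 s]_(x in (fun x => x + c)%R @^-1` A)
     (expR (- (c / s ^+ 2 * x) - c ^+ 2 / (2 * s ^+ 2)))%:E = normal_prob 0 s A.
Proof.
move=> s0 mA.
have mp : measurable_fun [set: R] (fun x => x + c)%R by exact: measurable_funD.
have mA' : measurable ((fun x => x + c)%R @^-1` A).
  by rewrite -[X in measurable X]setTI; exact: mp.
rewrite ge0_integral_normal_prob//; last first.
  by apply: measurableT_comp => //; apply: measurable_funB => //;
    apply: measurableT_comp => //; exact: measurable_funM.
rewrite /normal_prob [RHS]integral_mkcond -(ge0_integral_isometry mp)//; last 3 first.
- by move=> B; exact: lebesgue_measureD.
- apply/(measurable_restrictT _ mA); apply: measurable_funTS.
  by apply/measurable_EFinP; exact: measurable_normal_pdf.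
- by move=> x; rewrite /patch; case: ifPn => // _; rewrite lee_fin normal_pdf_ge0.
rewrite integral_mkcond; apply: eq_integral => x _; rewrite /patch.
have -> : (x \in (fun x => x + c)%R @^-1` A) = (x + c \in A)%R.
  by apply/idP/idP; rewrite !inE.
case: ifP => // _; congr EFin; rewrite !normal_pdfE// mulrCA /normal_fun -expRD.
congr (_ * expR _)%R; field; exact: s0.
Qed.

Lemma normal_probN (s : R) (A : set R) : s != 0%R -> measurable A ->
  normal_prob 0 s (-%R @^-1` A) = normal_prob 0 s A.
Proof.
move=> s0 mA.
have mp : measurable_fun [set: R] (-%R : R -> R) by exact: oppr_measurable.
have mA' : measurable ((-%R : R -> R) @^-1` A).
  by rewrite -[X in measurable X]setTI; exact: mp.
rewrite /normal_prob [RHS]integral_mkcond -(ge0_integral_isometry mp)//; last 3 first.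
- by move=> B; exact: lebesgue_measureN.
- apply/(measurable_restrictT _ mA); apply: measurable_funTS.
  by apply/measurable_EFinP; exact: measurable_normal_pdf.
- by move=> x; rewrite /patch; case: ifPn => // _; rewrite lee_fin normal_pdf_ge0.
rewrite integral_mkcond; apply: eq_integral => x _; rewrite /patch.
have -> : (x \in -%R @^-1` A) = (- x \in A)%R.
  by apply/idP/idP; rewrite !inE.
case: ifP => // _; congr EFin; rewrite !normal_pdfE// /normal_fun.
by rewrite !subr0 sqrrN.
Qed.

(** For the shift by [- a * s ^+ 2] the weight is exp(a x - a^2 s^2 / 2), and its total mass is
    1. *)
Lemma integral_normal_prob_expR (s a : R) : s != 0%R ->
  \int[normal_prob 0 s]_x (expR (a * x))%:E = (expR (a ^+ 2 * s ^+ 2 / 2))%:E.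
Proof.
move=> s0; have := normal_prob_shift (- (a * s ^+ 2))%R s0 measurableT.
rewrite preimage_setT probability_setT => h.
rewrite -[RHS]mule1 -h -ge0_integralZl//; last first.
  apply/measurable_EFinP.
  by apply: measurableT_comp => //; apply: measurable_funB => //;
    apply: measurableT_comp => //; exact: measurable_funM.
apply: eq_integral => x _; rewrite -EFinM -expRD; congr (expR _)%:E.
by field; exact: s0.
Qed.

End gaussian.

Section wiener_increments.
Context (R : realType) d (T : measurableType d) (P : probability T R)
  (W : R -> {RV P >-> R}) (hW : standard_wiener W).
Variables (u : nat -> R) (u0 : 0 <= u 0%N) (ltu : forall i, u i < u i.+1).
Local Open Scope ereal_scope.

Let X i w := (W (u i.+1) w - W (u i) w)%R.
Let sd i := Num.sqrt (u i.+1 - u i)%R.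
Let N i : probability (measurableTypeR R) R := normal_prob 0 (sd i).

Let ge0_u i : (0 <= u i)%R.
Proof. by elim: i => // i IH; exact: le_trans IH (ltW (ltu i)). Qed.

Let sd_neq0 i : sd i != 0%R.
Proof. by rewrite gt_eqF// sqrtr_gt0 subr_gt0. Qed.

Let sdK i : (sd i ^+ 2 = u i.+1 - u i)%R.
Proof. by rewrite sqr_sqrtr// subr_ge0 ltW. Qed.

Lemma measurable_increment i : measurable_fun [set: T] (X i).
Proof. exact: measurable_funB. Qed.

Let XN n (A : nat -> set R) : (forall i, measurable (A i)) ->
  P (\bigcap_(i < n) X i @^-1` (A i)) = \prod_(i < n) N i (A i).
Proof.
move=> mA; case: hW => _ _ indep normal.
have := indep n u A u0 (fun i => ltW (ltu i)) mA; rewrite /= => h.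
rewrite [LHS](_ : _ = P (\bigcap_(i < n) [set w | A i (W (u i.+1) w - W (u i) w)%R]))//.
rewrite h; apply: eq_bigr => i _.
by rewrite normal.
Qed.

(** By independence the one-dimensional weights multiply: a Cameron-Martin formula for piecewise
    linear drifts. *)
Lemma wiener_shift n (c : nat -> R) (g : seqspace R n -> \bar R) :
  measurable_fun [set: seqspace R n] g -> (forall x, 0 <= g x) ->
  \int[P]_w g (fun i => X i w) =
  \int[P]_w (g (fun i => X i w + c i)%R *
    (expR (- \sum_(i < n) (c i / (u i.+1 - u i) * X i w
                           + c i ^+ 2 / (2 * (u i.+1 - u i)))))%:E).
Proof.
move=> mg g0.
rewrite (@ge0_integral_tilt _ _ _ P n X N measurable_increment (@XN n)
  (fun i x => x + c i)%R
  (fun i x => expR (- (c i / sd i ^+ 2 * x) - c i ^+ 2 / (2 * sd i ^+ 2))))//.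
- apply: eq_integral => w _; congr (_ * _%:E); rewrite -expR_sum -sumrN.
  by congr expR; apply: eq_bigr => i _; rewrite sdK opprD.
- by move=> i; exact: measurable_funD.
- move=> i; apply: measurableT_comp => //; apply: measurable_funB => //;
  by apply: measurableT_comp => //; exact: measurable_funM.
- by move=> i A mA; rewrite normal_prob_shift.
Qed.

(** The increments are independent and symmetric, so any of their signs may be reversed: all of them
    for [W] against [- W], or the last one alone for the reflection in time past [t]. *)
Lemma wiener_flip n (s : nat -> bool) (g : seqspace R n -> \bar R) :
  measurable_fun [set: seqspace R n] g -> (forall x, 0 <= g x) ->
  \int[P]_w g (fun i => X i w) =
  \int[P]_w g (fun i => if s i then - X i w else X i w)%R.
Proof.
move=> mg g0.
rewrite (@ge0_integral_tilt _ _ _ P n X N measurable_increment (@XN n)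
  (fun i x => if s i then - x else x)%R (fun i x => 1%R))//.
- by apply: eq_integral => w _; rewrite big1 ?mule1.
- by move=> i; case: (s i) => //; exact: oppr_measurable.
- move=> i A mA; rewrite integral_cst ?mul1e; last first.
    case: (s i) => //; rewrite -[X in measurable X]setTI.
    by apply: oppr_measurable.
  by case: (s i); [exact: normal_probN|rewrite preimage_id].
Qed.

Lemma wiener_increment_mgf i (a : R) :
  \int[P]_w (expR (a * X i w))%:E = (expR (a ^+ 2 * (u i.+1 - u i) / 2))%:E.
Proof.
case: hW => _ _ _ normal.
have mX := measurable_increment i.
have mE : measurable_fun [set: R] (fun x => (expR (a * x))%:E).
  by apply/measurable_EFinP; apply: measurableT_comp => //; exact: measurable_funM.
rewrite -(sdK i).
rewrite -(@integral_normal_prob_expR R (sd i) a (sd_neq0 i)).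

rewrite -[LHS](@ge0_integral_pushforward _ _ T (measurableTypeR R) R (X i) mX P setT _ measurableT mE)//.
apply: eq_measure_integral => A mA _; rewrite /pushforward.
by rewrite -[RHS](normal (u i) (u i.+1) _ _ A mA).
Qed.

End wiener_increments.

(** * Path integrals and Riemann sums *)

Section path_calculus.
Context (R : realType) (t : R) (ht : 0 < t).
Notation mu := (@lebesgue_measure R).
Implicit Types f g : R -> R.

Notation cpath f := {within `[0, t], continuous f}.

Lemma cpathD f g : cpath f -> cpath g -> cpath (fun s => f s + g s).
Proof. by move=> cf cg x; apply: cvgD; [exact: cf|exact: cg]. Qed.

Lemma cpathM f g : cpath f -> cpath g -> cpath (fun s => f s * g s).
Proof. by move=> cf cg x; apply: cvgM; [exact: cf|exact: cg]. Qed.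

Lemma cpathN f : cpath f -> cpath (fun s => - f s).
Proof. by move=> cf x; apply: cvgN; exact: cf. Qed.

Lemma cpath_cst (c : R) : cpath (fun=> c).
Proof. by move=> x; exact: cvg_cst. Qed.

Lemma cpathX f n : cpath f -> cpath (fun s => f s ^+ n).
Proof.
move=> cf; elim: n => [|n IH]; first exact: cpath_cst.
rewrite (_ : (fun s => f s ^+ n.+1) = (fun s => f s * f s ^+ n)); first exact: cpathM.
by apply/funext => s; rewrite exprS.
Qed.

Lemma cpath_comp g f : continuous g -> cpath f -> cpath (fun s => g (f s)).
Proof. by move=> cg cf x; apply: (continuous_comp (cf x)); exact: cg. Qed.

Lemma cpath_continuous g : continuous g -> cpath g.
Proof. exact: continuous_subspaceT. Qed.

Lemma cpath_integrable f : cpath f -> mu.-integrable `[0, t] (EFin \o f).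
Proof. by move=> cf; apply: continuous_compact_integrable => //; exact: segment_compact. Qed.

Lemma cpath_bounded f : cpath f ->
  exists2 M : R, 0 < M & forall s, 0 <= s <= t -> `|f s| <= M.
Proof.
move=> cf; have [c _ hc] : exists2 c, c \in `[0, t] & forall s, s \in `[0, t] -> `|f s| <= `|f c|.
  apply: (@EVT_max R (fun s => `|f s|) _ _ (ltW ht)).
  by apply: (@cpath_comp Num.norm) => // x; exact: norm_continuous.
exists (`|f c| + 1); first by rewrite ltr_wpDl.
by move=> s st; rewrite (le_trans (hc s _)) ?in_itv// lerDl.
Qed.

(** Heine-Cantor: otherwise there are violating pairs at distance less than 1/(n+1), and continuity
    fails at a cluster point of their first components. *)
Lemma cpath_unif f : cpath f -> forall e, 0 < e -> exists2 dl, 0 < dl &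
  forall s r, 0 <= s <= t -> 0 <= r <= t -> `|s - r| < dl -> `|f s - f r| < e.
Proof.
move=> cf e e0; apply: contrapT => h.
have {h} h n : {sr : R * R | [/\ 0 <= sr.1 <= t, 0 <= sr.2 <= t,
    `|sr.1 - sr.2| < n.+1%:R^-1 & e <= `|f sr.1 - f sr.2|]}.
  apply: cid; apply: contrapT => h2; apply: h; exists (n.+1%:R^-1) => //.
  move=> s r st rt srn; rewrite ltNge; apply/negP => le.
  by apply: h2; exists (s, r).
pose s n := (sval (h n)).1; pose r n := (sval (h n)).2.
have [c [ct cl]] : exists c, `[0, t]%classic c /\ cluster (s @ \oo) c.
  have [|c [ct cl]] := @segment_compact R 0 t (s @ \oo) _; last by exists c.
  by exists 0%N => // n _; rewrite /s /=; case: (svalP (h n)); rewrite in_itv.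
have e2 : 0 < e / 2 by rewrite divr_gt0.
have := cf => /subspace_continuousP /(_ c ct) /cvgrPdist_lt /(_ _ e2).
rewrite /within /= => -[dl /= dl0 Hdl].
have Hf u : 0 <= u <= t -> `|c - u| < dl -> `|f c - f u| < e / 2.
  by move=> ut cu; apply: (Hdl u) => //; rewrite /= in_itv.
have [n /= [nlarge scl]] : exists n, n.+1%:R^-1 < dl / 2 /\ `|c - s n| < dl / 2.
  have [m _ Hm] : \forall n \near \oo, n.+1%:R^-1 < dl / 2 :> R.
    by apply: (near_infty_natSinv_lt (PosNum (divr_gt0 dl0 (ltr0n _ 2)))).
  have := cl [set s n | n in [set n | (m <= n)%N]] (ball c (dl / 2)) _ _.
  case.
  - by exists m => // n mn; exists n.
  - by apply: nbhsx_ballx; rewrite divr_gt0.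
  - by move=> _ [[n mn <-] cb]; exists n; split; [exact: Hm|].
case: (svalP (h n)); rewrite -/(s n) -/(r n) => st rt srn.
apply/negP; rewrite -ltNge.
have -> : f (s n) - f (r n) = (f c - f (r n)) - (f c - f (s n)) by ring.
rewrite (le_lt_trans (ler_normB _ _))// (splitr e) ltrD// Hf//.
  have -> : c - r n = (c - s n) + (s n - r n) by ring.
  by rewrite (le_lt_trans (ler_normD _ _))// (splitr dl) ltrD// (lt_trans srn).
by rewrite (lt_le_trans scl)// ler_pdivrMr// ler_peMr ?ltW// ltr1n.
Qed.

Lemma cpath_intD f g : cpath f -> cpath g ->
  \int[mu]_(s in `[0, t]) (f s + g s) =
  \int[mu]_(s in `[0, t]) f s + \int[mu]_(s in `[0, t]) g s.
Proof. by move=> cf cg; rewrite RintegralD//; exact: cpath_integrable. Qed.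

Lemma cpath_intB f g : cpath f -> cpath g ->
  \int[mu]_(s in `[0, t]) (f s - g s) =
  \int[mu]_(s in `[0, t]) f s - \int[mu]_(s in `[0, t]) g s.
Proof. by move=> cf cg; rewrite RintegralB//; exact: cpath_integrable. Qed.

Lemma cpath_intZ (c : R) f : cpath f ->
  \int[mu]_(s in `[0, t]) (c * f s) = c * \int[mu]_(s in `[0, t]) f s.
Proof. by move=> cf; rewrite RintegralZl//; exact: cpath_integrable. Qed.

Lemma int_cst (c : R) : \int[mu]_(s in `[0, t]) c = c * t.
Proof.
by rewrite Rintegral_cst//= lebesgue_measure_itv/= lte_fin ht oppr0 adde0.
Qed.

Lemma cpath_int_le f g : cpath f -> cpath g ->
  (forall s, 0 <= s <= t -> f s <= g s) ->
  \int[mu]_(s in `[0, t]) f s <= \int[mu]_(s in `[0, t]) g s.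
Proof.
move=> cf cg fg; apply: le_Rintegral => //; try exact: cpath_integrable.
Qed.

Lemma cpath_int_bound f (C : R) : cpath f ->
  (forall s, 0 <= s <= t -> `|f s| <= C) ->
  `|\int[mu]_(s in `[0, t]) f s| <= C * t.
Proof.
move=> cf fC; rewrite ler_norml -mulNr -!int_cst.
by rewrite !cpath_int_le//; try exact: cpath_cst;
  move=> s /fC; rewrite ler_norml => /andP[].
Qed.

Lemma cpath_int_eq f g : (forall s, 0 <= s <= t -> f s = g s) ->
  \int[mu]_(s in `[0, t]) f s = \int[mu]_(s in `[0, t]) g s.
Proof.
by move=> fg; apply: eq_Rintegral => s; rewrite inE/= in_itv; exact: fg.
Qed.

(** There are [n.+1] steps, so that no division by zero occurs. [rsum] samples the right end points:
    the indices run from 1 to [n.+1], the last one being the time [t]. *)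
Definition grid (n k : nat) : R := t / n.+1%:R * k%:R.

Definition rsum n (g : nat -> R) : R := t / n.+1%:R * \sum_(k < n.+1) g k.+1.

Lemma grid0 n : grid n 0 = 0. Proof. by rewrite /grid mulr0. Qed.

Lemma gridS n k : grid n k.+1 = grid n k + t / n.+1%:R.
Proof. by rewrite /grid [k.+1%:R]mulrS mulrDr mulr1 addrC. Qed.

Lemma grid_max n : grid n n.+1 = t.
Proof. by rewrite /grid divfK// pnatr_eq0. Qed.

Lemma step_gt0 n : 0 < t / n.+1%:R. Proof. by rewrite divr_gt0. Qed.

Lemma grid_itv n k : (k <= n.+1)%N -> 0 <= grid n k <= t.
Proof.
move=> kn; rewrite mulr_ge0 ?(ltW (step_gt0 n))//=.
by rewrite -[leRHS](grid_max n) ler_pM2l ?step_gt0// ler_nat.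
Qed.

(** Induction over the cells: on each of them [f] is within [e] of its value at the right end
    point. *)
Lemma rsum_err f n e : cpath f ->
  (forall s r, 0 <= s <= t -> 0 <= r <= t -> `|s - r| <= t / n.+1%:R -> `|f s - f r| <= e) ->
  `|rsum n (fun k => f (grid n k)) - \int[mu]_(s in `[0, t]) f s| <= e * t.
Proof.
move=> cf fe.
suff H k : (k <= n.+1)%N ->
    `|t / n.+1%:R * \sum_(j < k) f (grid n j.+1) - \int[mu]_(s in `[0, grid n k]) f s|
      <= e * grid n k.
  by have := H _ (leqnn _); rewrite grid_max.
elim: k => [_|k IH kn].
  by rewrite big_ord0 mulr0 sub0r normrN grid0 set_itv1 Rintegral_set1 normr0 mulr0.
have /andP[k0 kt] := grid_itv (ltnW kn).
have /andP[k10 k1t] := grid_itv kn.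
have kk1 : grid n k <= grid n k.+1 by rewrite gridS lerDl ltW ?step_gt0.
have int1 : mu.-integrable `[0, grid n k.+1] (EFin \o f).
  apply: integrableS (cpath_integrable cf) => //.
  by apply: subset_itvl; rewrite bnd_simp.
have int2 : mu.-integrable `]grid n k, grid n k.+1] (EFin \o f).
  apply: integrableS int1 => //.
  by apply: subset_itvr; rewrite bnd_simp.
have := Rintegral_itvB int1 (x := grid n k).
rewrite !bnd_simp => /(_ k0 kk1) => split_int.
have {split_int} -> : \int[mu]_(s in `[0, grid n k.+1]) f s =
  \int[mu]_(s in `[0, grid n k]) f s + \int[mu]_(s in `]grid n k, grid n k.+1]) f s.
  by rewrite -split_int addrC subrK.
have intc (c : R) : \int[mu]_(s in `]grid n k, grid n k.+1]) c = c * (t / n.+1%:R).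
  rewrite Rintegral_cst//= lebesgue_measure_itv/= lte_fin gridS ltrDl step_gt0.
  by rewrite -EFinB/= addrC addKr.
rewrite big_ord_recr/= mulrDr opprD addrACA.
have -> : e * grid n k.+1 = e * grid n k + e * (t / n.+1%:R) by rewrite gridS mulrDr.
rewrite (le_trans (ler_normD _ _))// lerD ?IH ?(ltnW kn)//.
have intK (c : R) : mu.-integrable `]grid n k, grid n k.+1] (EFin \o (fun=> c)).
  apply: integrableS (cpath_integrable (@cpath_cst c)) => //.
  by apply: subset_itv; rewrite bnd_simp.
have -> : t / n.+1%:R * f (grid n k.+1) =
    \int[mu]_(s in `]grid n k, grid n k.+1]) f (grid n k.+1).
  by rewrite intc mulrC.
rewrite -RintegralB//.
have intB : mu.-integrable `]grid n k, grid n k.+1]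
    (EFin \o (fun s => f (grid n k.+1) - f s)).
  rewrite (_ : EFin \o _ = ((EFin \o (fun=> f (grid n k.+1))) \- (EFin \o f))%E)//.
  by apply: integrableB.
rewrite (le_trans (le_normr_Rintegral _ _))//.
rewrite -intc; apply: le_Rintegral => //.
- exact: integrable_norm intB.
- move=> s /=; rewrite in_itv/= => /andP[ks sk]; apply: fe.
  + by rewrite k10.
  + by rewrite (le_trans k0 (ltW ks)) (le_trans sk).
  + by rewrite ger0_norm ?subr_ge0// gridS lerBlDl lerD2r ltW.
Qed.

End path_calculus.

Section riemann.
Context (R : realType) (t : R) (ht : 0 < t).
Notation mu := (@lebesgue_measure R).
Implicit Types f : R -> R.

Notation cpath f := {within `[0, t], continuous f}.

Lemma near_step (e : R) : 0 < e -> \forall n \near \oo, t / n.+1%:R < e.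
Proof.
move=> e0; have et : 0 < e / t by rewrite divr_gt0.
near=> n; rewrite mulrC -ltr_pdivlMr//.
by near: n; exact: (near_infty_natSinv_lt (PosNum et)).
Unshelve. all: end_near. Qed.

(** The form is dictated by the discrete drift of the Cameron-Martin argument, which is given at
    grid points only and differs there from its limit path. *)
Definition grid_cvg (g : nat -> nat -> R) f := forall e, 0 < e ->
  \forall n \near \oo, forall k, (k <= n.+1)%N -> `|g n k - f (grid t n k)| < e.

Lemma grid_cvg_refl f : grid_cvg (fun n k => f (grid t n k)) f.
Proof. by move=> e e0; apply: nearW => n k _; rewrite subrr normr0. Qed.

Lemma grid_cvgD g1 g2 f1 f2 : grid_cvg g1 f1 -> grid_cvg g2 f2 ->
  grid_cvg (fun n k => g1 n k + g2 n k) (fun s => f1 s + f2 s).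
Proof.
move=> gf1 gf2 e e0; have e2 : 0 < e / 2 by rewrite divr_gt0.
near=> n => k kn.
rewrite opprD addrACA (le_lt_trans (ler_normD _ _))// (splitr e) ltrD//.
  by move: k kn; near: n; exact: gf1.
by move: k kn; near: n; exact: gf2.
Unshelve. all: end_near. Qed.

Lemma grid_cvg_comp V g f : continuous V -> cpath f -> grid_cvg g f ->
  grid_cvg (fun n k => V (g n k)) (fun s => V (f s)).
Proof.
move=> cV cf gf e e0; have [M M0 fM] := cpath_bounded ht cf.
have M2 : 0 < 2 * (M + 1) by rewrite mulr_gt0// addr_gt0.
(* [cpath_unif] is about segments starting at 0: the range [-(M + 1), M + 1] of both arguments is
   translated to [0, 2(M + 1)]. *)
have cV' : continuous (fun s => V (s - (M + 1))).
  by move=> x; apply: continuous_comp; [apply: cvgB => //; exact: cvg_cst|exact: cV].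
have [dl dl0 Hdl] := @cpath_unif R (2 * (M + 1)) _ (cpath_continuous (t := 2 * (M + 1)) cV') _ e0.
have dl1 : 0 < Num.min dl 1 by rewrite lt_min dl0 ltr01.
near=> n => k kn.
have gfk : `|g n k - f (grid t n k)| < Num.min dl 1.
  by move: k kn; near: n; exact: gf.
move: gfk; rewrite lt_min => /andP[gfdl gf1].
have := fM _ (grid_itv ht kn); rewrite ler_norml => /andP[f1 f2].
move: (gf1); rewrite ltr_norml => /andP[g1 g2].
have := Hdl (g n k + (M + 1)) (f (grid t n k) + (M + 1)).
by rewrite !addrK; apply; [apply/andP; split; lra|apply/andP; split; lra|
  rewrite opprD addrACA subrr addr0].
Unshelve. all: end_near. Qed.

Lemma rsum_cvg g f : cpath f -> grid_cvg g f ->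
  rsum t n (g n) @[n --> \oo] --> \int[mu]_(s in `[0, t]) f s.
Proof.
move=> cf gf; apply/cvgrPdist_lt => e e0.
have e2 : 0 < e / 2 / (t + 1) by rewrite !divr_gt0// addr_gt0.
have et : e / 2 / (t + 1) * t < e / 2.
  rewrite mulrAC ltr_pdivrMr ?addr_gt0// ltr_pM2l ?divr_gt0//; lra.
have [dl dl0 Hdl] := cpath_unif cf e2.
near=> n.
have nfr : `|rsum t n (fun k => f (grid t n k)) - \int[mu]_(s in `[0, t]) f s|
    <= e / 2 / (t + 1) * t.
  apply: (rsum_err ht) => // s r st rt srn; apply/ltW/Hdl => //.
  by apply: le_lt_trans srn _; near: n; exact: near_step.
have gfn : `|rsum t n (g n) - rsum t n (fun k => f (grid t n k))|
    <= e / 2 / (t + 1) * t.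
  rewrite /rsum -mulrBr normrM gtr0_norm ?step_gt0// -sumrB.
  rewrite (@le_trans _ _ (t / n.+1%:R * (e / 2 / (t + 1) *+ n.+1)))//.
    rewrite ler_pM2l ?step_gt0// (le_trans (ler_norm_sum _ _ _))//.
    have -> : e / 2 / (t + 1) *+ n.+1 = \sum_(k < n.+1) e / 2 / (t + 1).
      by rewrite sumr_const card_ord.
    rewrite ler_sum// => k _; apply: ltW.
    have Hn : forall k, (k <= n.+1)%N -> `|g n k - f (grid t n k)| < e / 2 / (t + 1).
      by near: n; exact: gf.
    exact: Hn.
  have n0 : n.+1%:R != 0 :> R by rewrite pnatr_eq0.
  by rewrite -mulr_natr le_eqVlt; apply/orP; left; apply/eqP; field; rewrite nat1r n0 gt_eqF// addr_gt0.
have -> : \int[mu]_(s in `[0, t]) f s - rsum t n (g n) =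
  - (rsum t n (g n) - rsum t n (fun k => f (grid t n k))) -
  (rsum t n (fun k => f (grid t n k)) - \int[mu]_(s in `[0, t]) f s) by ring.
rewrite (le_lt_trans (ler_normB _ _))// normrN (splitr e).
by rewrite (le_lt_trans (lerD gfn nfr))// ltrD.
Unshelve. all: end_near. Qed.

End riemann.

(** * Mean value estimates *)

Section taylor.
Context (R : realType).
Implicit Types f g : R -> R.

(** The first two bounds place [c] between 0 and [z] without a distinction on the sign of [z];
    products such as [c * z] can then be used directly. *)
Lemma derivable_mvt f (df : forall x, derivable f x 1) a z :
  exists c, [/\ 0 <= c * z <= z ^+ 2, `|c| <= `|z| & f (a + z) - f a = f^`() (a + c) * z].
Proof.
have fP x : is_derive x (1 : R) f (f^`() x).
  by rewrite derive1E; exact/derivableP.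
have cf u v : {within `[u, v], continuous f}.
  by apply: continuous_subspaceT => x; exact/differentiable_continuous/derivable1_diffP.
have [z0|z0|->] := ltgtP z 0.
- have az : a + z < a by rewrite gtrDl.
  have [c] := MVT az (fun x _ => fP x) (cf _ _).
  rewrite in_itv/= => /andP[c1 c2] h; exists (c - a); split.
  - by apply/andP; split; nra.
  - by rewrite !ler0_norm; lra.
  - by rewrite [a + (c - a)]addrC subrK -opprB h; ring.
- have az : a < a + z by rewrite ltrDl.
  have [c] := MVT az (fun x _ => fP x) (cf _ _).
  rewrite in_itv/= => /andP[c1 c2] h; exists (c - a); split.
  - by apply/andP; split; nra.
  - by rewrite !ger0_norm; lra.
  - by rewrite [a + (c - a)]addrC subrK h; ring.
- by exists 0; split; rewrite ?mulr0 ?expr0n/= ?lexx// addr0 subrr.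
Qed.

(** One mean value step raises the order by one and keeps [C]. The factor 1/(n+1) of an integration
    is given up, which is harmless since only orders matter later. *)
Lemma mvt_bound g (dg : R -> R) (C r : R) n :
  (forall x, is_derive x (1 : R) g (dg x)) -> g 0 = 0 ->
  (forall z, `|z| <= r -> `|dg z| <= C * `|z| ^+ n) ->
  forall y, `|y| <= r -> `|g y| <= C * `|y| ^+ n.+1.
Proof.
move=> dgP g0 H y yr.
have cg a b : {within `[a, b], continuous g}.
  apply: continuous_subspaceT => x.
  by apply: differentiable_continuous; apply/derivable1_diffP; apply: ex_derive.
have key z : `|z| <= `|y| -> g y = dg z * y -> `|g y| <= C * `|y| ^+ n.+1.
  move=> zy ->; rewrite normrM exprSr mulrA ler_wpM2r//.
  have zr := le_trans zy yr; apply: le_trans (H z zr) _.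
  have [C0|C0] := leP 0 C; first by rewrite ler_wpM2l// lerXn2r// ?nnegrE.
  have : 0 <= C * `|z| ^+ n := le_trans (normr_ge0 _) (H z zr).
  rewrite nmulr_rge0// => zn0.
  have [z0|z0] := eqVneq z 0; last first.
    by move: zn0; rewrite leNgt exprn_gt0// normr_gt0.
  have : 0 <= C * `|y| ^+ n := le_trans (normr_ge0 _) (H y yr).
  move=> h; apply: le_trans _ h.
  by rewrite nmulr_rle0.
have [y0|y0|->] := ltgtP y 0.
- have [z zy] := @MVT _ g dg y 0 y0 (fun x _ => dgP x) (cg _ _).
  move: zy; rewrite in_itv/= => /andP[yz z0]; rewrite g0 !sub0r mulrN => /oppr_inj.
  by apply: key; rewrite !ltr0_norm// lerN2 ltW.
- have [z zy] := @MVT _ g dg 0 y y0 (fun x _ => dgP x) (cg _ _).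
  move: zy; rewrite in_itv/= => /andP[z0 zy]; rewrite g0 !subr0.
  by apply: key; rewrite !gtr0_norm// ltW.
by rewrite g0 normr0 expr0n mulr0.
Qed.

End taylor.

(** * Taylor expansions of the potential *)

Section taylor_expansions.
Context (R : realType).

Lemma is_derive_monomial (c : R) n (x : R) :
  is_derive x (1 : R) (fun y => c * y ^+ n.+1) (c * n.+1%:R * x ^+ n).
Proof.
have h := @is_deriveZ _ _ _ (fun y : R => y ^+ n.+1) c x 1 (n.+1%:R * x ^+ n).
have hX : is_derive x (1 : R) (fun y : R => y ^+ n.+1) (n.+1%:R * x ^+ n).
  elim: n {h} => [|n IH]; first by rewrite expr0 mulr1; exact: is_derive_id.
  have h' := is_deriveM (is_derive_id x (1 : R)) IH.
  rewrite (_ : (fun y : R => y ^+ n.+2) = (id : R -> R) * (fun y : R => y ^+ n.+1)).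
    apply: is_derive_eq; rewrite /GRing.scale/= mulr1 mulrCA -exprS.
    by rewrite -[in LHS](mul1r (x ^+ n.+1)) mulrA mulr1 -mulrDl natr1.
  by apply/funext => y; rewrite exprS.
by apply: is_derive_eq; rewrite -mulrA.
Qed.

(** A sequence of functions, each the derivative of the previous one, covers both the derivatives of
    [V] and the explicit derivatives of a Gaussian. *)
Variables (f : nat -> R -> R) (m : nat) (C r : R).
Hypothesis df : forall k, (k < m)%N -> forall x, is_derive x (1 : R) (f k) (f k.+1 x).

Let df_shift k a x : (k < m)%N ->
  is_derive x (1 : R) (fun y => f k (a + y) - f k a) (f k.+1 (a + x)).
Proof. by move=> km; have h := df km (a + x); apply: is_derive_eq; ring. Qed.

Lemma taylor_rem1 k a : (k < m)%N ->
  (forall y, `|y| <= r -> `|f k.+1 (a + y)| <= C) ->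
  forall y, `|y| <= r -> `|f k (a + y) - f k a| <= C * `|y|.
Proof.
move=> km fC y yr; rewrite -[`|y|]expr1.
apply: (@mvt_bound _ (fun y => f k (a + y) - f k a) (fun y => f k.+1 (a + y)) C r 0) => //.
- by move=> x; exact: df_shift.
- by rewrite addr0 subrr.
- by move=> z zr; rewrite expr0 mulr1; exact: fC.
Qed.

Lemma taylor_rem2 k a : (k.+1 < m)%N ->
  (forall y, `|y| <= r -> `|f k.+2 (a + y)| <= C) ->
  forall y, `|y| <= r ->
    `|f k (a + y) - f k a - f k.+1 a * y| <= C * `|y| ^+ 2.
Proof.
move=> km fC; apply: (@mvt_bound _ (fun y => f k (a + y) - f k a - f k.+1 a * y)
  (fun y => f k.+1 (a + y) - f k.+1 a) C r 1).
- move=> x; have := is_deriveB (df_shift a x (ltnW km)) (is_derive_monomial (f k.+1 a) 0 x).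
  by rewrite expr0 !mulr1; exact.
- by rewrite addr0 subrr mulr0 subr0.
- by move=> z zr; rewrite expr1; exact: taylor_rem1.
Qed.

Lemma taylor_rem3 k a : (k.+2 < m)%N ->
  (forall y, `|y| <= r -> `|f k.+3 (a + y)| <= C) ->
  forall y, `|y| <= r ->
    `|f k (a + y) - f k a - f k.+1 a * y - f k.+2 a / 2 * y ^+ 2| <= C * `|y| ^+ 3.
Proof.
move=> km fC; apply: (@mvt_bound _
  (fun y => f k (a + y) - f k a - f k.+1 a * y - f k.+2 a / 2 * y ^+ 2)
  (fun y => f k.+1 (a + y) - f k.+1 a - f k.+2 a * y) C r 2).
- move=> x; have := is_deriveB (is_deriveB (df_shift a x (ltnW (ltnW km)))
    (is_derive_monomial (f k.+1 a) 0 x)) (is_derive_monomial (f k.+2 a / 2) 1 x).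
  by rewrite expr0 !mulr1 divfK ?pnatr_eq0// expr1; exact.
- by rewrite addr0 subrr mulr0 subr0 expr0n/= mulr0 subr0.
- by move=> z zr; exact: taylor_rem2.
Qed.

Lemma taylor_rem4 k a : (k.+3 < m)%N ->
  (forall y, `|y| <= r -> `|f k.+4 (a + y)| <= C) ->
  forall y, `|y| <= r ->
    `|f k (a + y) - f k a - f k.+1 a * y - f k.+2 a / 2 * y ^+ 2
      - f k.+3 a / 6 * y ^+ 3| <= C * `|y| ^+ 4.
Proof.
move=> km fC; apply: (@mvt_bound _
  (fun y => f k (a + y) - f k a - f k.+1 a * y - f k.+2 a / 2 * y ^+ 2
     - f k.+3 a / 6 * y ^+ 3)
  (fun y => f k.+1 (a + y) - f k.+1 a - f k.+2 a * y - f k.+3 a / 2 * y ^+ 2) C r 3).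
- move=> x; have := is_deriveB (is_deriveB (is_deriveB (df_shift a x (ltnW (ltnW (ltnW km))))
    (is_derive_monomial (f k.+1 a) 0 x)) (is_derive_monomial (f k.+2 a / 2) 1 x))
    (is_derive_monomial (f k.+3 a / 6) 2 x).
  rewrite expr0 !mulr1 divfK ?pnatr_eq0// expr1.
  by have -> : f k.+3 a / 6 * 3 = f k.+3 a / 2 by field.
- by rewrite addr0 subrr mulr0 subr0 !expr0n/= !mulr0 !subr0.
- by move=> z zr; exact: taylor_rem3.
Qed.

End taylor_expansions.

Section potential.
Context (R : realType) (V : R -> R).
Hypothesis hVderivable : forall k : nat, (k < 4)%N -> forall x, derivable V^`(k) x 1.
Hypothesis hVcontinuous : continuous V^`(4).

Lemma potential_is_derive k : (k < 4)%N ->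
  forall x, is_derive x (1 : R) V^`(k) (V^`(k.+1) x).
Proof.
move=> k4 x; rewrite derive1nS derive1E; apply: derivableP; exact: hVderivable.
Qed.

Lemma potential_continuous k : (k <= 4)%N -> continuous V^`(k).
Proof.
rewrite leq_eqVlt => /predU1P[->//|k4] x.
by apply: differentiable_continuous; apply/derivable1_diffP; exact: hVderivable.
Qed.

Lemma potential_bounded (M : R) : 0 < M -> exists2 C : R, 0 < C &
  forall k, (k <= 4)%N -> forall x, `|x| <= M -> `|V^`(k) x| <= C.
Proof.
move=> M0; have M2 : 0 < M + M by rewrite addr_gt0.
have H k : (k <= 4)%N -> exists2 C : R, 0 < C & forall x, `|x| <= M -> `|V^`(k) x| <= C.
  move=> k4; have cV : continuous (fun s => V^`(k) (s - M)).
    by move=> x; apply: (@continuous_comp _ _ _ (fun s => s - M) V^`(k)); [apply: cvgB => //; exact: cvg_cst|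
      exact: potential_continuous].
  have [C C0 HC] := cpath_bounded M2 (cpath_continuous (t := M + M) cV).
  exists C => // x xM; have := HC (x + M); rewrite addrK; apply.
  by move: xM; rewrite ler_norml => /andP[x1 x2]; apply/andP; split; lra.
have [C0 C00 H0] := H 0%N isT; have [C1 C10 H1] := H 1%N isT.
have [C2 C20 H2] := H 2%N isT; have [C3 C30 H3] := H 3%N isT.
have [C4 C40 H4] := H 4%N isT.
exists (C0 + C1 + C2 + C3 + C4); first by rewrite !addr_gt0.
by move=> [|[|[|[|[|]]]]]// _ x xM; [have := H0 x xM|have := H1 x xM|
  have := H2 x xM|have := H3 x xM|have := H4 x xM]; lra.
Qed.

(** Two mean value steps: the increment is V'(a + c) y with [c] between 0 and [y], and V'(a + c) -
    V'(a) is a nonnegative multiple of [c], while [c * y] is nonnegative. *)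
Lemma convex_tangent (hVconvex : forall x, 0 <= V^`(2) x) a y :
  V a + V^`(1) a * y <= V (a + y).
Proof.
have [c [/andP[c0 cy] _ hc]] := derivable_mvt (@hVderivable 0 isT) a y.
have [c' [_ _ hc']] := derivable_mvt (@hVderivable 1 isT) a c.
have : 0 <= (V^`(1) (a + c) - V^`(1) a) * y.
  by rewrite hc' -mulrA mulr_ge0// hVconvex.
by have : V (a + y) - V a = V^`(1) (a + c) * y := hc; lra.
Qed.

End potential.

(** * Limits of expectations and of discrete sums *)

Section probability_limits.
Context (R : realType) d (T : measurableType d) (P : probability T R).
Implicit Types f g : T -> R.

Lemma dominated_cvg_prob (f_ : nat -> T -> R) f g :
  (forall n, measurable_fun [set: T] (f_ n)) -> P.-integrable setT (EFin \o g) ->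
  (forall n w, `|f_ n w| <= g w) ->
  (forall w, f_ n w @[n --> \oo] --> f w) ->
  [/\ measurable_fun [set: T] f, P.-integrable setT (EFin \o f) &
    (\int[P]_w (f_ n w)%:E)%E @[n --> \oo] --> (\int[P]_w (f w)%:E)%E].
Proof.
move=> mf ig fg ff.
have mlim : measurable_fun [set: T] f.
  by apply: (@measurable_fun_cvg _ _ _ setT f_) => // w _; exact: ff.
have [] := @dominated_convergence _ T R P setT measurableT (fun n => EFin \o f_ n)
  (EFin \o f) (EFin \o g).
- by move=> n; exact/measurable_EFinP.
- exact/measurable_EFinP.
- by apply: aeW => w _; apply: cvg_EFin; [exact: nearW|exact: ff].
- exact: ig.
- by apply: aeW => w n _; rewrite /= lee_fin.
- by move=> i1 _ c; split.
Qed.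

Lemma bounded_cvg_prob (f_ : nat -> T -> R) f (C : R) :
  (forall n, measurable_fun [set: T] (f_ n)) ->
  (forall n w, `|f_ n w| <= C) ->
  (forall w, f_ n w @[n --> \oo] --> f w) ->
  [/\ measurable_fun [set: T] f, P.-integrable setT (EFin \o f) &
    (\int[P]_w (f_ n w)%:E)%E @[n --> \oo] --> (\int[P]_w (f w)%:E)%E].
Proof.
move=> mf fC; apply: (@dominated_cvg_prob f_ f (fun=> C)) => //.
exact: finite_measure_integrable_cst.
Qed.

End probability_limits.

Section rsum_theory.
Context (R : realType) (t : R) (ht : 0 < t).
Notation cpath f := {within `[0, t], continuous f}.

Lemma rsumD n (f g : nat -> R) : rsum t n (fun k => f k + g k) = rsum t n f + rsum t n g.
Proof. by rewrite /rsum big_split/= mulrDr. Qed.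

Lemma rsumZ n (c : R) (f : nat -> R) : rsum t n (fun k => c * f k) = c * rsum t n f.
Proof. by rewrite /rsum -mulr_sumr mulrCA. Qed.

Lemma rsum_le n (f g : nat -> R) : (forall k, (k <= n.+1)%N -> f k <= g k) ->
  rsum t n f <= rsum t n g.
Proof.
by move=> fg; rewrite ler_pM2l ?step_gt0// ler_sum// => k _; exact: fg.
Qed.

Lemma rsum_cst n (c : R) : rsum t n (fun=> c) = c * t.
Proof.
by rewrite /rsum sumr_const card_ord -[c *+ _]mulr_natr mulrCA divfK ?pnatr_eq0.
Qed.

Lemma grid_cvg_end g f : grid_cvg t g f -> g n n.+1 @[n --> \oo] --> f t.
Proof.
move=> gf; apply/cvgrPdist_lt => e e0; have := gf _ e0; apply: filterS => n Hn.
by have := Hn _ (leqnn _); rewrite grid_max distrC.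
Qed.

Lemma grid_cvgMl (f0 : R -> R) g f : cpath f0 -> grid_cvg t g f ->
  grid_cvg t (fun n k => f0 (grid t n k) * g n k) (fun s => f0 s * f s).
Proof.
move=> cf0 gf e e0; have [M M0 f0M] := cpath_bounded ht cf0.
have eM : 0 < e / M by rewrite divr_gt0.
have := gf _ eM; apply: filterS => n Hn k kn.
rewrite -mulrBr normrM; apply: (@le_lt_trans _ _ (M * `|g n k - f (grid t n k)|)).
  by rewrite ler_wpM2r// f0M// grid_itv.
by rewrite mulrC -ltr_pdivlMr// Hn.
Qed.

Lemma cvg_seq_ub (a : nat -> R) (l : R) : a n @[n --> \oo] --> l -> exists C, forall n, a n <= C.
Proof.
move=> al; have [M [_ HM]] := cvg_seq_bounded (cvgP _ al).
exists (M + 1) => n; apply: le_trans (ler_norm _) _.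
by apply: HM => //; rewrite ltrDl.
Qed.

End rsum_theory.

Lemma min_dist_le (R : realType) (x y z : R) : `|Num.min x z - Num.min y z| <= `|x - y|.
Proof.
rewrite ler_norml; have := ler_norm (x - y); have := lerNnormlW (lexx `|x - y|).
by move=> h1 h2; rewrite /Num.min; apply/andP; split;
  case: ifPn; rewrite -?leNgt => ?; case: ifPn; rewrite -?leNgt => ?; lra.
Qed.

(** * The Cameron-Martin formula *)

Section discrete_drift.
Context (R : realType) (t : R) (ht : 0 < t) (b : R) (v phi : R -> R).
Notation cpath f := {within `[0, t], continuous f}.
Notation mu := (@lebesgue_measure R).
Hypothesis cv : cpath v.
Hypothesis phiE : forall u, 0 <= u <= t ->
  phi u = - (b * u) - \int[mu]_(s in `[0, t]) (v s * Num.min s u).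

(* Slopes of the piecewise linear drift solving the discretized Euler-Lagrange
   equation, so that the linear terms match the Riemann sums exactly. *)
Definition slope n i : R :=
  - b - t / n.+1%:R * \sum_(j < n.+1 | (i <= j)%N) v (grid t n j.+1).

Definition drift n k : R := \sum_(i < k) (t / n.+1%:R * slope n i).

(** Summation by parts. Read with the increments of [W] as [y], it replaces the would-be stochastic
    integral of the slope by a linear functional of [W] itself. *)
Lemma slope_sum n (y : nat -> R) :
  \sum_(i < n.+1) slope n i * y i = - (b * \sum_(i < n.+1) y i)
    - rsum t n (fun k => v (grid t n k) * \sum_(i < k) y i).
Proof.
rewrite /slope /rsum.
under eq_bigr do rewrite mulrBl mulNr -[t / _ * _ * _]mulrA mulr_suml.
rewrite sumrB sumrN -mulr_sumr -mulr_sumr; congr (_ - _ * _).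
under eq_bigr do rewrite big_mkcond/=.
rewrite exchange_big/=; apply: eq_bigr => j _.
rewrite mulr_sumr -big_mkcond/=.
rewrite (big_ord_widen_cond n.+1 xpredT (fun i => v (grid t n j.+1) * y i))//.
Qed.

(** The sum measures the part of the grid below both points; this is how the kernel min(s, u)
    arises. *)
Lemma sum_lt n k j : (k <= n.+1)%N -> (j <= n.+1)%N ->
  \sum_(i < j) (if (i < k)%N then t / n.+1%:R else 0) = Num.min (grid t n j) (grid t n k).
Proof.
move=> kn jn; rewrite -big_mkcond/= sumr_const.
have -> : #|[pred i : 'I_j | (i < k)%N]| = minn j k.
  have -> : #|[pred i : 'I_j | (i < k)%N]| = (\sum_(i < j | (i < k)%N) 1)%N.
    by rewrite sum1_card.
  have [kj|jk] := leqP k j.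
    by rewrite -(big_ord_widen j (fun=> 1%N) kj) sum1_card card_ord.
  under eq_bigl => i do rewrite (ltn_trans (ltn_ord i) jk).
  by rewrite sum1_card card_ord.
rewrite -[_ *+ _]mulr_natr /grid; have [kj|jk] := leqP k j.
  by rewrite min_r// ler_pM2l ?step_gt0// ler_nat.
by rewrite min_l// ler_pM2l ?step_gt0// ler_nat ltnW.
Qed.

(** [slope_sum] applied to the increments of the ramp s -> min(s, u), with [u] the grid point of
    index [k]. *)
Lemma driftE n k : (k <= n.+1)%N -> drift n k = - (b * grid t n k)
  - rsum t n (fun j => v (grid t n j) * Num.min (grid t n j) (grid t n k)).
Proof.
move=> kn; rewrite /drift.
rewrite (big_ord_widen n.+1 (fun i => t / n.+1%:R * slope n i) kn) big_mkcond/=.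
transitivity (\sum_(i < n.+1) slope n i * (if (i < k)%N then t / n.+1%:R else 0)).
  by apply: eq_bigr => i _; case: ifP => _; rewrite ?mulr0// mulrC.
rewrite (slope_sum n (fun i => if (i < k)%N then t / n.+1%:R else 0)) sum_lt//
    grid_max min_r//; last by case/andP: (grid_itv ht kn).
congr (_ - _); rewrite /rsum; congr (_ * _); apply: eq_bigr => j _.
by rewrite sum_lt.
Qed.

Lemma cpath_min (u : R) : cpath (fun s => Num.min s u).
Proof.
apply: cpath_continuous => x; apply: continuous_min; first exact: cvg_id.
exact: cvg_cst.
Qed.

(** The convergence is uniform in [k] because min(s, u) is 1-Lipschitz in [s] and bounded by [t],
    whatever [u]: one modulus of continuity of [v] serves all grid points. *)
Lemma drift_cvg : grid_cvg t drift phi.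
Proof.
move=> e e0.
have e2 : 0 < e / (t + 1) by rewrite divr_gt0// addr_gt0.
have [M M0 vM] := cpath_bounded ht cv.
have e3 : 0 < e / (t + 1) / 2 / (t + 1) by rewrite !divr_gt0// addr_gt0.
have e4 : 0 < e / (t + 1) / 2 / M by rewrite !divr_gt0// addr_gt0.
have [dl dl0 Hdl] := cpath_unif cv e3.
near=> n => k kn.
have st1 : t / n.+1%:R < dl by near: n; exact: near_step.
have st2 : t / n.+1%:R < e / (t + 1) / 2 / M by near: n; exact: near_step.
have ukt := grid_itv ht kn.
rewrite driftE// phiE//.
set rs := rsum _ _ _; set I := \int[mu]_(s in _) _.
have -> : - (b * grid t n k) - rs - (- (b * grid t n k) - I) = - (rs - I) by ring.
rewrite normrN {}/rs {}/I.
have := @rsum_err R t ht (fun s => v s * Num.min s (grid t n k)) n (e / (t + 1)).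
move=> /(_ (cpathM cv (@cpath_min (grid t n k)))) H.
apply: (@le_lt_trans _ _ (e / (t + 1) * t)); last first.
  by rewrite mulrAC ltr_pdivrMr ?addr_gt0// ltr_pM2l//; lra.
apply: H => s r st rt sr.
have -> : v s * Num.min s (grid t n k) - v r * Num.min r (grid t n k) =
  (v s - v r) * Num.min s (grid t n k) + v r * (Num.min s (grid t n k) - Num.min r (grid t n k)).
  by ring.
rewrite (le_trans (ler_normD _ _))// !normrM.
have m1 : `|Num.min s (grid t n k)| <= t + 1.
  have : 0 <= Num.min s (grid t n k) <= t.
    move: st ukt => /andP[? ?] /andP[? ?].
    by rewrite le_min ge_min; apply/andP; split; [apply/andP|apply/orP; left].
  by move=> /andP[? ?]; rewrite ger0_norm//; lra.
have m2 : `|Num.min s (grid t n k) - Num.min r (grid t n k)| <= `|s - r| by exact: min_dist_le.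
rewrite [leRHS]splitr lerD//.
  rewrite -[leRHS](@divfK _ (t + 1)) ?gt_eqF ?addr_gt0//.
  by rewrite ler_pM// ltW// Hdl// (le_lt_trans sr).
rewrite -[leRHS](@divfK _ M) ?gt_eqF// mulrC ler_pM//.
  by rewrite (le_trans m2)// (le_trans sr)// ltW.
exact: vM.
Unshelve. all: end_near. Qed.

End discrete_drift.

Section cameron_martin.
Context (R : realType) d (T : measurableType d) (P : probability T R)
  (W : R -> {RV P >-> R}) (hW : standard_wiener W) (t : R) (ht : 0 < t).
Notation cpath f := {within `[0, t], continuous f}.
Notation mu := (@lebesgue_measure R).

Lemma wiener_cpath w : cpath (fun s => W s w).
Proof.
case: hW => _ cW _ _; apply: continuous_subspaceW (cW w).
by move=> s /=; rewrite !in_itv/= andbT => /andP[].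
Qed.

Lemma wiener0 w : W 0 w = 0. Proof. by case: hW. Qed.

Lemma increments_sum (u : nat -> R) w k : u 0%N = 0 ->
  \sum_(i < k) (W (u i.+1) w - W (u i) w) = W (u k) w.
Proof.
move=> u0; elim: k => [|k IH]; first by rewrite big_ord0 u0 wiener0.
by rewrite big_ord_recr/= IH addrC subrK.
Qed.

Lemma measurable_psum N k : (k <= N)%N ->
  measurable_fun [set: seqspace R N] (fun x => \sum_(i < k) x i).
Proof.
move=> kN; apply: measurable_sum => i; apply: measurable_coord.
exact: leq_trans kN.
Qed.

Lemma measurable_rsum N n (V : R -> R) (h : nat -> seqspace R N -> R) :
  continuous V -> (forall k, (k < n.+1)%N -> measurable_fun [set: seqspace R N] (h k.+1)) ->
  measurable_fun [set: seqspace R N] (fun x => rsum t n (fun k => V (h k x))).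
Proof.
move=> cV mh; apply: measurable_funM => //; apply: measurable_sum => k.
by apply: measurableT_comp; [exact: continuous_measurable_fun|exact: mh].
Qed.

Variables (V : R -> R) (a v phi : R -> R) (b : R).
Hypothesis cV : continuous V.
Hypothesis V_lb : exists m, forall x, m <= V x.
Hypothesis ca : cpath a.
Hypothesis cv : cpath v.
Hypothesis cphi : cpath phi.
Hypothesis tangent : forall s y, 0 <= s <= t -> V (a s) + v s * y <= V (a s + y).
Hypothesis phiE : forall u, 0 <= u <= t ->
  phi u = - (b * u) - \int[mu]_(s in `[0, t]) (v s * Num.min s u).
Variables (h x0 : R) (h0 : 0 < h).
Let r := Num.sqrt h.

Let r0 : 0 < r. Proof. by rewrite sqrtr_gt0. Qed.
Let rr : r * r = h. Proof. by rewrite -expr2 sqr_sqrtr// ltW. Qed.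

Let gfun n (x : seqspace R n.+1) : R :=
  expR (- h^-1 * (rsum t n (fun k => V (r * \sum_(i < k) x i + x0))
    + (r * \sum_(i < n.+1) x i + x0) ^+ 2 / 2)).

Let mg n : measurable_fun [set: seqspace R n.+1] (gfun (n:=n)).
Proof.
apply: measurableT_comp => //; apply: measurable_funM => //.
apply: measurable_funD.
  apply: (@measurable_rsum n.+1 n V (fun k (x : seqspace R n.+1) => r * \sum_(i < k) x i + x0)) => // k kn.
  apply: measurable_funD => //; apply: measurable_funM => //; exact: measurable_psum.
apply: measurable_funM => //; apply: measurable_funX; apply: measurable_funD => //.
by apply: measurable_funM => //; exact: measurable_psum.
Qed.

Let X n i w := W (grid t n i.+1) w - W (grid t n i) w.

Let lhs n w := expR (- h^-1 * (rsum t n (fun k => V (r * W (grid t n k) w + x0))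
    + (r * W t w + x0) ^+ 2 / 2)).

(** The shifted integrand after summation by parts: the last two lines are the Cameron-Martin
    weight, its linear part in [W] and its normalization. *)
Let rhs n w := expR (- h^-1 * (rsum t n (fun k => V (r * W (grid t n k) w + drift t b v n k + x0))
    + (r * W t w + drift t b v n n.+1 + x0) ^+ 2 / 2)
   + r^-1 * (b * W t w + rsum t n (fun k => v (grid t n k) * W (grid t n k) w))
   + (2 * h)^-1 * (b * drift t b v n n.+1 + rsum t n (fun k => v (grid t n k) * drift t b v n k))).

Let sumX n w k : \sum_(i < k) X n i w = W (grid t n k) w.
Proof. by rewrite (@increments_sum (grid t n))// grid0. Qed.

Let lhsE n w : lhs n w = gfun (n:=n) (fun i => X n i w).
Proof.
have e k : \sum_(i < k) (fun i => X n i w) i = W (grid t n k) w := sumX n w k.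
rewrite /lhs.
rewrite /gfun.
have -> : (fun k => V (r * \sum_(i < k) (fun i => X n i w) i + x0)) =
  (fun k => V (r * W (grid t n k) w + x0)).
  by apply/funext => k; rewrite e.
rewrite e.
by rewrite grid_max.
Qed.

Let int_lhs_rhs n : (\int[P]_w (lhs n w)%:E = \int[P]_w (rhs n w)%:E)%E.
Proof.
(* Shifting [r * W] by the drift means shifting [W] by the drift divided by [r]; these are the
   increments of that shift. *)
pose c i := t / n.+1%:R * slope t b v n i / r.
have grid_lt i : grid t n i < grid t n i.+1 by rewrite gridS ltrDl step_gt0.
have g00 : 0 <= grid t n 0 by rewrite grid0.
under eq_integral do rewrite lhsE.
have mg' : measurable_fun [set: seqspace R n.+1] (EFin \o gfun (n:=n)).
  exact/measurable_EFinP.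
have -> := wiener_shift hW g00 grid_lt c mg' (fun x => expR_ge0 _).
apply: eq_integral => w _; rewrite -EFinM; congr EFin.
have sumc k : \sum_(i < k) c i = drift t b v n k / r.
  by rewrite /drift mulr_suml.
have sumXc k : r * \sum_(i < k) (X n i w + c i) = r * W (grid t n k) w + drift t b v n k.
  by rewrite big_split/= sumX sumc mulrDr [r * (_ / _)]mulrC divfK// gt_eqF.
rewrite /gfun -expRD sumXc grid_max /rhs; congr expR.
have -> : (fun k => V (r * \sum_(i < k) (X n i w + c i) + x0)) =
  (fun k => V (r * W (grid t n k) w + drift t b v n k + x0)).
  by apply/funext => k; rewrite sumXc.
rewrite -[RHS]addrA; congr (_ + _).
have step i : grid t n i.+1 - grid t n i = t / n.+1%:R by rewrite gridS addrC addKr.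
have s0 := step_gt0 ht n.
have r0' : r != 0 by rewrite gt_eqF.
have h0' : h != 0 by rewrite gt_eqF.
have s0' : t / n.+1%:R != 0 by rewrite gt_eqF.
transitivity (- (r^-1 * (\sum_(i < n.+1) slope t b v n i * X n i w)
  + (2 * h)^-1 * (\sum_(i < n.+1) slope t b v n i * (t / n.+1%:R * slope t b v n i)))).
congr (- _); rewrite !mulr_sumr -big_split/=; apply: eq_bigr => i _.
  rewrite /X step /c -rr; set s := t / n.+1%:R; field.
  by rewrite r0' s0'.
rewrite (@slope_sum R t b v n (fun i => X n i w)).
rewrite (@slope_sum R t b v n (fun i => t / n.+1%:R * slope t b v n i)) sumX grid_max.
rewrite -/(drift t b v n n.+1).
have -> : (fun k => v (grid t n k) * \sum_(i < k) X n i w) =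
  (fun k => v (grid t n k) * W (grid t n k) w).
  by apply/funext => k; rewrite sumX.
rewrite -/(drift t b v n).
ring.
Qed.

Let scaled_cpath (c : R) w : cpath (fun s => c * W s w).
Proof. by apply: cpathM; [exact: cpath_cst|exact: wiener_cpath]. Qed.

Let lhs_cvg w : lhs n w @[n --> \oo] -->
  expR (- h^-1 * (\int[mu]_(s in `[0, t]) V (r * W s w + x0) + (r * W t w + x0) ^+ 2 / 2)).
Proof.
apply: continuous_cvg; first exact: continuous_expR.
apply: cvgMr; apply: cvgD; last exact: cvg_cst.
have cf : cpath (fun s => r * W s w + x0).
  by apply: cpathD; [exact: scaled_cpath|exact: cpath_cst].
apply: (rsum_cvg ht (cpath_comp cV cf)).
exact: (grid_cvg_comp ht cV cf (@grid_cvg_refl _ _ (fun s => r * W s w + x0))).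
Qed.

Let lhs_bound : exists C, forall n w, `|lhs n w| <= C.
Proof.
have [m mV] := V_lb; exists (expR (- h^-1 * (m * t))) => n w.
rewrite ger0_norm ?expR_ge0// ler_expR !mulNr lerN2 ler_pM2l ?invr_gt0//.
rewrite -[leLHS]addr0 lerD ?divr_ge0 ?sqr_ge0//.
by rewrite -(rsum_cst t n) rsum_le.
Qed.

Let lhs_measurable n : measurable_fun [set: T] (lhs n).
Proof.
rewrite (_ : lhs n = gfun (n:=n) \o (fun w => (fun i => X n i w) : seqspace R n.+1)).
  apply: measurableT_comp; first exact: mg.
  by apply: measurable_seqspace => i; exact: measurable_funB.
by apply/funext => w; exact: lhsE.
Qed.

Let cdrift := drift_cvg ht cv phiE.

Let cvg_sqr (u : nat -> R) (l : R) : u n @[n --> \oo] --> l ->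
  u n ^+ 2 @[n --> \oo] --> l ^+ 2.
Proof. by move=> ul; rewrite expr2; under eq_cvg do rewrite expr2; exact: cvgM. Qed.

Let rhs_cvg w : rhs n w @[n --> \oo] -->
  expR (- h^-1 * (\int[mu]_(s in `[0, t]) V (r * W s w + phi s + x0)
    + (r * W t w + phi t + x0) ^+ 2 / 2)
   + r^-1 * (b * W t w + \int[mu]_(s in `[0, t]) (v s * W s w))
   + (2 * h)^-1 * (b * phi t + \int[mu]_(s in `[0, t]) (v s * phi s))).
Proof.
have cf : cpath (fun s => r * W s w + phi s + x0).
  apply: cpathD; last exact: cpath_cst.
  by apply: cpathD => //; exact: scaled_cpath.
have gf : grid_cvg t (fun n k => r * W (grid t n k) w + drift t b v n k + x0)
    (fun s => r * W s w + phi s + x0).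
  apply: grid_cvgD; last exact: (@grid_cvg_refl _ t (fun=> x0)).
  apply: grid_cvgD; last exact: cdrift.
  exact: (@grid_cvg_refl _ t (fun s => r * W s w)).
apply: continuous_cvg; first exact: continuous_expR.
apply: cvgD; first apply: cvgD.
- apply: cvgMr; apply: cvgD; last first.
    apply: cvgMl; apply: cvg_sqr.
    by apply: cvgD; [apply: cvgD; [exact: cvg_cst|exact: (grid_cvg_end cdrift)]|exact: cvg_cst].
  apply: (rsum_cvg ht (cpath_comp cV cf)).
  exact: (grid_cvg_comp ht cV cf gf).
- apply: cvgMr; apply: cvgD; first exact: cvg_cst.
  apply: (@rsum_cvg _ t ht (fun n k => v (grid t n k) * W (grid t n k) w)
    (fun s => v s * W s w)); first exact: (cpathM cv (@wiener_cpath w)).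
  exact: (@grid_cvg_refl _ t (fun s => v s * W s w)).
- apply: cvgMr; apply: cvgD.
    by apply: cvgMr; exact: (grid_cvg_end cdrift).
  exact: (rsum_cvg ht (cpathM cv cphi) (grid_cvgMl ht cv cdrift)).
Qed.

(** The weight grows exponentially with [W]. The tangent inequalities, for [V] at [a] and for x^2/2
    at [b], contribute exactly the opposite linear terms, since the drift was discretized with the
    same Riemann sums. The deterministic exponent [B n] remains; it converges, hence is bounded. *)
Let rhs_bound : exists C, forall n w, `|rhs n w| <= C.
Proof.
pose B n := - h^-1 * (rsum t n (fun k => V (a (grid t n k))
    + v (grid t n k) * (drift t b v n k + (x0 - a (grid t n k))))
    + (b ^+ 2 / 2 + b * (drift t b v n n.+1 + x0 - b)))
   + (2 * h)^-1 * (b * drift t b v n n.+1 + rsum t n (fun k => v (grid t n k) * drift t b v n k)).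
have [l Bl] : exists l : R, B n @[n --> \oo] --> l.
  rewrite /B; eexists; apply: cvgD.
    apply: cvgMr; apply: cvgD.
      apply: (@rsum_cvg _ t ht _ (fun s => V (a s) + v s * (phi s + (x0 - a s)))).
        apply: cpathD; first exact: cpath_comp.
        apply: cpathM => //; apply: cpathD => //; apply: cpathD; first exact: cpath_cst.
        exact: cpathN.
      apply: grid_cvgD; first exact: (@grid_cvg_refl _ t (fun s => V (a s))).
      apply: grid_cvgMl => //; apply: grid_cvgD; first exact: cdrift.
      exact: (@grid_cvg_refl _ t (fun s => x0 - a s)).
    apply: cvgD; first exact: cvg_cst.
    apply: cvgMr; apply: cvgB; last exact: cvg_cst.
    by apply: cvgD; [exact: (grid_cvg_end cdrift)|exact: cvg_cst].
  apply: cvgMr; apply: cvgD.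
    by apply: cvgMr; exact: (grid_cvg_end cdrift).
  exact: (rsum_cvg ht (cpathM cv cphi) (grid_cvgMl ht cv cdrift)).
have [C HC] := cvg_seq_ub Bl.
exists (expR C) => n w; rewrite ger0_norm ?expR_ge0// ler_expR (le_trans _ (HC n))//.
rewrite /B lerD2r.
set D := drift t b v n; set A := rsum _ _ _; set I := rsum t n (fun k => v _ * W _ w).
have HA : A >= rsum t n (fun k => V (a (grid t n k)) + v (grid t n k) * (D k + (x0 - a (grid t n k))))
    + r * I.
  rewrite -rsumZ -rsumD; apply: (rsum_le ht) => k kn.
  have := @tangent (grid t n k) (r * W (grid t n k) w + D k + x0 - a (grid t n k)) (grid_itv ht kn).
  rewrite [a _ + (_ - _)]addrC subrK; apply: le_trans.
  by rewrite le_eqVlt; apply/orP; left; apply/eqP; ring.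
have HB : (r * W t w + D n.+1 + x0) ^+ 2 / 2 >= b ^+ 2 / 2 + b * (D n.+1 + x0 - b) + b * (r * W t w).
  have := sqr_ge0 (r * W t w + D n.+1 + x0 - b); nra.
have rh : r^-1 = h^-1 * r by rewrite -rr invfM mulfVK ?gt_eqF// mulrC divff.
set E := rsum t n (fun k => V (a _) + _) in HA *.
have hV : 0 < h^-1 by rewrite invr_gt0.
have : 0 <= h^-1 * ((A + (r * W t w + D n.+1 + x0) ^+ 2 / 2) - (E + r * I +
    (b ^+ 2 / 2 + b * (D n.+1 + x0 - b) + b * (r * W t w)))).
  apply: mulr_ge0; first exact: ltW.
  by rewrite subr_ge0 lerD.
rewrite rh; nra.
Qed.

Let rhs_measurable n : measurable_fun [set: T] (rhs n).
Proof.
have mV : measurable_fun [set: R] V by exact: continuous_measurable_fun.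
apply: measurableT_comp => //; apply: measurable_funD; last exact: measurable_cst.
apply: measurable_funD.
  apply: measurable_funM => //; apply: measurable_funD.
    apply: measurable_funM => //; apply: measurable_sum => k.
    apply: measurableT_comp => //; apply: measurable_funD => //.
    by apply: measurable_funD => //; exact: measurable_funM.
  apply: measurable_funM => //; apply: measurable_funX; apply: measurable_funD => //.
  by apply: measurable_funD => //; exact: measurable_funM.
apply: measurable_funM => //; apply: measurable_funD; first exact: measurable_funM.
apply: measurable_funM => //; apply: measurable_sum => k.
exact: measurable_funM.
Qed.

(** The discrete identity [int_lhs_rhs] holds for every [n], and both sides converge path by path
    under uniform bounds. *)
Lemma cameron_martin :
  [/\ measurable_fun [set: T] (fun w => expR (- h^-1 *
        (\int[mu]_(s in `[0, t]) V (r * W s w + x0) + (r * W t w + x0) ^+ 2 / 2))),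
      P.-integrable setT (fun w => (expR (- h^-1 *
        (\int[mu]_(s in `[0, t]) V (r * W s w + x0) + (r * W t w + x0) ^+ 2 / 2)))%:E) &
    (\int[P]_w (expR (- h^-1 *
        (\int[mu]_(s in `[0, t]) V (r * W s w + x0) + (r * W t w + x0) ^+ 2 / 2)))%:E =
    \int[P]_w (expR (- h^-1 * (\int[mu]_(s in `[0, t]) V (r * W s w + phi s + x0)
        + (r * W t w + phi t + x0) ^+ 2 / 2)
      + r^-1 * (b * W t w + \int[mu]_(s in `[0, t]) (v s * W s w))
      + (2 * h)^-1 * (b * phi t + \int[mu]_(s in `[0, t]) (v s * phi s))))%:E)%E].
Proof.
have [C lC] := lhs_bound; have [C' rC'] := rhs_bound.
have [m1 i1 c1] := bounded_cvg_prob P lhs_measurable lC lhs_cvg.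
have [m2 i2 c2] := bounded_cvg_prob P rhs_measurable rC' rhs_cvg.
have lr : (fun n => \int[P]_w (lhs n w)%:E)%E = (fun n => \int[P]_w (rhs n w)%:E)%E.
  by apply/funext => n; exact: int_lhs_rhs.
rewrite lr in c1.
by split; [exact: m1|exact: i1|exact: cvg_unique c1 c2].
Qed.

End cameron_martin.

(** * Reflections of W *)

Section flips.
Context (R : realType) d (T : measurableType d) (P : probability T R)
  (W : R -> {RV P >-> R}) (hW : standard_wiener W) (t : R) (ht : 0 < t).
Notation cpath f := {within `[0, t], continuous f}.
Notation mu := (@lebesgue_measure R).

Let wcpath w : cpath (fun s => W s w). Proof. exact: wiener_cpath. Qed.

Section last_increment.
Variables (V f : R -> R) (C r c x0 tau : R).
Hypothesis cV : continuous V.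
Hypothesis V_lb : exists m, forall x, m <= V x.
Hypothesis cf : continuous f.
Hypothesis f0 : forall x, 0 <= f x.
Hypothesis fC : forall x, f x <= C.
Hypothesis c0 : 0 <= c.
Hypothesis tau0 : 0 < tau.

(** The grid of [0, t] followed by a single increment of length [tau]. Indices above [n.+2] only
    keep the sequence strictly increasing, as [wiener_flip] asks. *)
Let u n k : R := if (k <= n.+1)%N then grid t n k else t + tau * (k - n.+1)%:R.

Let u_grid n k : (k <= n.+1)%N -> u n k = grid t n k.
Proof. by rewrite /u => ->. Qed.

Let u_last n : u n n.+2 = t + tau.
Proof. by rewrite /u ltnn subSnn mulr1. Qed.

Let u00 n : u n 0 = 0. Proof. by rewrite u_grid// grid0. Qed.

Let ltu n k : u n k < u n k.+1.
Proof.
have [kn|nk] := ltnP k n.+1.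
  by rewrite !u_grid// ?(ltnW kn)// gridS ltrDl step_gt0.
rewrite {2}/u ltnNge nk/=.
move: nk; rewrite leq_eqVlt => /predU1P[<-|nk].
  by rewrite u_grid// grid_max ltrDl mulr_gt0// subSnn.
by rewrite /u leqNgt nk/= ltrD2l ltr_pM2l// ltr_nat ltn_sub2r// ltnW.
Qed.

Let gfun n (e : R) (x : seqspace R n.+2) : R :=
  expR (- c * rsum t n (fun k => V (r * \sum_(i < k) x i + x0)))
  * f (r * \sum_(i < n.+1) x i + x0 + e * (r * x n.+1)).

Let mg n e : measurable_fun [set: seqspace R n.+2] (gfun (n:=n) e).
Proof.
apply: measurable_funM.
  apply: measurableT_comp => //; apply: measurable_funM => //.
  apply: (@measurable_rsum R t n.+2 n V (fun k (x : seqspace R n.+2) => r * \sum_(i < k) x i + x0)) => // k kn.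
  apply: measurable_funD => //; apply: measurable_funM => //.
  by apply: measurable_psum; exact: leqW.
apply: measurableT_comp; first exact: continuous_measurable_fun.
apply: measurable_funD.
  apply: measurable_funD => //; apply: measurable_funM => //.
  exact: measurable_psum.
by do 2 apply: measurable_funM => //; exact: measurable_coord.
Qed.

Let X n i w := W (u n i.+1) w - W (u n i) w.

Let fn e n w := expR (- c * rsum t n (fun k => V (r * W (grid t n k) w + x0)))
  * f (r * W t w + x0 + e * (r * (W (t + tau) w - W t w))).

Let fnE e n w : fn e n w = gfun (n:=n) e (fun i => X n i w).
Proof.
have sumE k : (k <= n.+1)%N -> \sum_(i < k) (fun i => X n i w) i = W (grid t n k) w.
  by move=> kn; rewrite [LHS](increments_sum hW w k (u00 n)) u_grid.
rewrite /fn /gfun sumE// grid_max /X u_last u_grid// grid_max.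
congr (expR (_ * _) * _); rewrite /rsum; congr (_ * _).
by apply: eq_bigr => k _; rewrite sumE.
Qed.

Let int_fn n : (\int[P]_w (fn 1 n w)%:E = \int[P]_w (fn (-1) n w)%:E)%E.
Proof.
have mg' : measurable_fun [set: seqspace R n.+2] (EFin \o gfun (n:=n) 1).
  exact/measurable_EFinP.
have g0 x : (0 <= (EFin \o gfun (n:=n) 1) x)%E.
  by rewrite lee_fin mulr_ge0 ?expR_ge0.
have u00' : 0 <= u n 0 by rewrite u00.
under eq_integral do rewrite fnE.
rewrite (wiener_flip hW u00' (ltu n) (fun i => i == n.+1) mg' g0).
apply: eq_integral => w _; rewrite fnE /= /gfun eqxx; congr EFin.
have sumE k : (k <= n.+1)%N -> \sum_(i < k) (if (i == n.+1 :> nat)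
      then - (W (u n i.+1) w - W (u n i) w) else W (u n i.+1) w - W (u n i) w) = \sum_(i < k) (fun i => X n i w) i.
  move=> kn; apply: eq_bigr => i _; case: eqP => // h.
  by have := leq_trans (ltn_ord i) kn; rewrite h ltnn.
rewrite sumE//; congr (expR (_ * _) * f (_ + _)); last by rewrite mul1r mulN1r mulrN.
by rewrite /rsum; congr (_ * _); apply: eq_bigr => k _; rewrite sumE.
Qed.

(** [V] is integrated up to time [t], so reversing the increment over [t, t + tau] affects only the
    argument of [f]. The identity holds for each Riemann sum and passes to the limit by bounded
    convergence. *)
Lemma wiener_flip_last :
  [/\ P.-integrable setT (fun w => (expR (- c * \int[mu]_(s in `[0, t]) V (r * W s w + x0))
        * f (r * W t w + x0 + r * (W (t + tau) w - W t w)))%:E),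
      P.-integrable setT (fun w => (expR (- c * \int[mu]_(s in `[0, t]) V (r * W s w + x0))
        * f (r * W t w + x0 - r * (W (t + tau) w - W t w)))%:E) &
  (\int[P]_w (expR (- c * \int[mu]_(s in `[0, t]) V (r * W s w + x0))
        * f (r * W t w + x0 + r * (W (t + tau) w - W t w)))%:E =
   \int[P]_w (expR (- c * \int[mu]_(s in `[0, t]) V (r * W s w + x0))
        * f (r * W t w + x0 - r * (W (t + tau) w - W t w)))%:E)%E].
Proof.
have [m mV] := V_lb.
have fn_bound e n w : `|fn e n w| <= expR (- c * (m * t)) * C.
  rewrite ger0_norm ?mulr_ge0 ?expR_ge0// ler_pM ?expR_ge0// ler_expR.
  by rewrite !mulNr lerN2 ler_wpM2l// -(rsum_cst t n) rsum_le.
have mfn e n : measurable_fun [set: T] (fn e n).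
  rewrite (_ : fn e n = gfun (n:=n) e \o (fun w => (fun i => X n i w) : seqspace R n.+2)).
    apply: measurableT_comp; first exact: mg.
    by apply: measurable_seqspace => i; exact: measurable_funB.
  by apply/funext => w; exact: fnE.
have fn_cvg e w : fn e n w @[n --> \oo] -->
    expR (- c * \int[mu]_(s in `[0, t]) V (r * W s w + x0))
        * f (r * W t w + x0 + e * (r * (W (t + tau) w - W t w))).
  apply: cvgMl; apply: continuous_cvg; first exact: continuous_expR.
  apply: cvgMr.
  have cp : cpath (fun s => r * W s w + x0).
    by apply: cpathD; [apply: cpathM => //; exact: cpath_cst|exact: cpath_cst].
  apply: (rsum_cvg ht (cpath_comp cV cp)).
  exact: (grid_cvg_comp ht cV cp (@grid_cvg_refl _ _ (fun s => r * W s w + x0))).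
have [_ i1 c1] := bounded_cvg_prob P (mfn 1) (fn_bound 1) (fn_cvg 1).
have [_ i2 c2] := bounded_cvg_prob P (mfn (-1)) (fn_bound (-1)) (fn_cvg (-1)).
have E12 : (fun n => \int[P]_w (fn 1 n w)%:E)%E = (fun n => \int[P]_w (fn (-1) n w)%:E)%E.
  by apply/funext => n; exact: int_fn.
rewrite E12 in c1.
have := cvg_unique _ c1 c2; move=> /(_ (@ereal_hausdorff R)).
move: i1 i2.
have -> : (fun w => expR (- c * \int[mu]_(s in `[0, t]) V (r * W s w + x0))
        * f (r * W t w + x0 + 1 * (r * (W (t + tau) w - W t w)))) =
  (fun w => expR (- c * \int[mu]_(s in `[0, t]) V (r * W s w + x0))
        * f (r * W t w + x0 + r * (W (t + tau) w - W t w))).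
  by apply/funext => w; rewrite mul1r.
have -> : (fun w => expR (- c * \int[mu]_(s in `[0, t]) V (r * W s w + x0))
        * f (r * W t w + x0 + -1 * (r * (W (t + tau) w - W t w)))) =
  (fun w => expR (- c * \int[mu]_(s in `[0, t]) V (r * W s w + x0))
        * f (r * W t w + x0 - r * (W (t + tau) w - W t w))).
  by apply/funext => w; rewrite mulN1r.
move=> i1 i2 e12; split; [exact: i1|exact: i2|].
under eq_integral do rewrite -[r * (_ - _)]mul1r.
rewrite e12.
by apply: eq_integral => w _; rewrite mulN1r.
Qed.

End last_increment.
End flips.

Section odd_functional.
Context (R : realType) d (T : measurableType d) (P : probability T R)
  (W : R -> {RV P >-> R}) (hW : standard_wiener W) (t : R) (ht : 0 < t).
Notation cpath f := {within `[0, t], continuous f}.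
Notation mu := (@lebesgue_measure R).
Variables (v : R -> R) (cv : cpath v) (v0 : forall s, 0 <= s <= t -> 0 <= v s).

Let wcpath w : cpath (fun s => W s w). Proof. exact: wiener_cpath. Qed.

Let A n (y : nat -> R) := rsum t n (fun k => v (grid t n k) * y k) + y n.+1.
Let B n (y : nat -> R) := rsum t n (fun k => v (grid t n k) * y k ^+ 2) + y n.+1 ^+ 2.
Let H n y := A n y * expR (- (B n y / 2)).

(** The inequality 2|y| <= 1 + y^2, weighted by [v], bounds |A| by a constant plus [B / 2]; then x
    exp(-x) <= 1 at x = [B / 2]. *)
Let H_bound : exists C, forall n y, `|H n y| <= C.
Proof.
have [M M0 vM] := cpath_bounded ht cv.
exists ((M * t + 1) / 2 + 1) => n y.
have B0 : 0 <= B n y.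
  rewrite addr_ge0 ?sqr_ge0//; apply: mulr_ge0; first exact/ltW/step_gt0.
  apply: sumr_ge0 => k _.
  by rewrite mulr_ge0 ?sqr_ge0// v0// grid_itv.
have AB : `|A n y| <= (M * t + 1) / 2 + B n y / 2.
  have aux (e : R) : e ^+ 2 = 1 -> e * A n y <= (M * t + 1) / 2 + B n y / 2.
    move=> e1; rewrite /A /B mulrDr -rsumZ.
    have -> : (M * t + 1) / 2 + (rsum t n (fun k => v (grid t n k) * y k ^+ 2) + y n.+1 ^+ 2) / 2
      = rsum t n (fun k => M / 2 + 2^-1 * (v (grid t n k) * y k ^+ 2)) + (1 + y n.+1 ^+ 2) / 2.
      by rewrite rsumD rsum_cst rsumZ; ring.
    apply: lerD; last by have := sqr_ge0 (e - y n.+1); nra.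
    apply: (rsum_le ht) => k kn.
    have vk0 := v0 (grid_itv ht kn); have := vM _ (grid_itv ht kn).
    rewrite ger0_norm// => vkM.
    have := mulr_ge0 vk0 (sqr_ge0 (e - y k)); nra.
  rewrite ler_norml; apply/andP; split.
    by have := aux (-1); rewrite sqrrN expr1n mulN1r => /(_ erefl); lra.
  by have := aux 1; rewrite expr1n mul1r; exact.
rewrite normrM [`|expR _|]ger0_norm ?expR_ge0//.
apply: (le_trans (ler_wpM2r (expR_ge0 _) AB)).
rewrite mulrDl lerD//.
  rewrite ler_piMr ?divr_ge0 ?addr_ge0 ?mulr_ge0 ?(ltW ht) ?(ltW M0)//.
  by rewrite -[leRHS]expR0 ler_expR oppr_le0 divr_ge0.
rewrite expRN ler_pdivrMr ?expR_gt0// mul1r.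
by apply: le_trans (expR_ge1Dx _); rewrite lerDr.
Qed.

(** The integrand is odd in [W]. With [v] the second derivative of [V] along the optimal path, this
    is the coefficient of h^(-1/2) in the difference quotient. *)
Lemma wiener_odd :
  P.-integrable setT (fun w => ((\int[mu]_(s in `[0, t]) (v s * W s w) + W t w)
    * expR (- ((\int[mu]_(s in `[0, t]) (v s * W s w ^+ 2) + W t w ^+ 2) / 2)))%:E) /\
  (\int[P]_w ((\int[mu]_(s in `[0, t]) (v s * W s w) + W t w)
    * expR (- ((\int[mu]_(s in `[0, t]) (v s * W s w ^+ 2) + W t w ^+ 2) / 2)))%:E = 0)%E.
Proof.
have [C HC] := H_bound.
have mA n N (y : nat -> seqspace R N -> R) : (forall k, (k <= n.+1)%N -> measurable_fun [set: seqspace R N] (y k)) ->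
    measurable_fun [set: seqspace R N] (fun x => H n (y ^~ x)).
  move=> my; apply: measurable_funM.
    apply: measurable_funD; last exact: my.
    apply: measurable_funM => //; apply: measurable_sum => k; apply: measurable_funM => //.
    exact: my.
  apply: measurableT_comp => //; apply: measurableT_comp => //; apply: measurable_funM => //.
  apply: measurable_funD; last by apply: measurable_funX; exact: my.
  apply: measurable_funM => //; apply: measurable_sum => k; apply: measurable_funM => //.
  by apply: measurable_funX; exact: my.
pose X n i w := W (grid t n i.+1) w - W (grid t n i) w.
(* [wiener_flip] is about nonnegative functions: the bound [C] is added here and cancels in the
   comparison of the two integrals. *)
pose g n (x : seqspace R n.+1) := C + H n (fun k => \sum_(i < k) x i).
have mg n : measurable_fun [set: seqspace R n.+1] (EFin \o g n).
  apply/measurable_EFinP; apply: measurable_funD => //.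
  by apply: (mA n n.+1 (fun k x => \sum_(i < k) x i)) => k kn; exact: measurable_psum.
have g0 n x : (0 <= (EFin \o g n) x)%E.
  by rewrite lee_fin /g; have := HC n (fun k => \sum_(i < k) x i); rewrite ler_norml; lra.
have sumE n w k : \sum_(i < k) (fun i => X n i w) i = W (grid t n k) w.
  by rewrite [LHS](increments_sum hW w k (grid0 t n)).
pose f n w := H n (fun k => W (grid t n k) w).
have fE n w : f n w = g n (fun i => X n i w) - C.
  rewrite /g /f addrC addKr; congr (H n _); apply/funext => k; by rewrite sumE.
have HN n y : H n (fun k => - y k) = - H n y.
  rewrite /H; have -> : A n (fun k => - y k) = - A n y.
    rewrite /A opprD -[X in _ = X + _]mulN1r -rsumZ; congr (_ + _).
    by rewrite /rsum; congr (_ * _); apply: eq_bigr => k _; ring.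
  have -> : B n (fun k => - y k) = B n y.
    rewrite /B sqrrN; congr (_ + _); rewrite /rsum; congr (_ * _).
    by apply: eq_bigr => k _; rewrite sqrrN.
  by rewrite mulNr.
have mf n : measurable_fun [set: T] (f n).
  rewrite (_ : f n = (fun w => g n (fun i => X n i w) - C)); last by apply/funext.
  apply: measurable_funB => //.
  apply: (@measurableT_comp _ _ _ _ _ _ (g n) _ (fun w => (fun i => X n i w) : seqspace R n.+1)).
    exact/measurable_EFinP.
  by apply: measurable_seqspace => i; exact: measurable_funB.
have f_bound n w : `|f n w| <= C by exact: HC.
have intC : P.-integrable setT (EFin \o (fun=> C)) by exact: finite_measure_integrable_cst.
have int_f n : P.-integrable setT (EFin \o f n).
  apply: (le_integrable measurableT _ _ intC) => //.
    exact/measurable_EFinP.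
  by move=> w _ /=; rewrite lee_fin (le_trans (f_bound n w))// ler_norm.
have int0 n : (\int[P]_w (f n w)%:E = 0)%E.
  have ltg i : grid t n i < grid t n i.+1 by rewrite gridS ltrDl step_gt0.
  have g00 : 0 <= grid t n 0 by rewrite grid0.
  have := wiener_flip hW g00 ltg (fun=> true) (mg n) (g0 n).
  have -> : (\int[P]_w (EFin \o g n) (fun i => (W (grid t n i.+1) w - W (grid t n i) w)%R)
     = \int[P]_w (C + f n w)%:E)%E.
    by apply: eq_integral => w _; rewrite fE addrC subrK.
  have -> : (\int[P]_w (EFin \o g n) (fun i => (- (W (grid t n i.+1) w - W (grid t n i) w))%R)
     = \int[P]_w (C - f n w)%:E)%E.
    apply: eq_integral => w _ /=; congr EFin; rewrite /g /f -HN; congr (_ + H n _).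
    by apply/funext => k; rewrite sumrN [in LHS](increments_sum hW w k (grid0 t n)).
  under eq_integral do rewrite EFinD.
  under [in RHS]eq_integral do rewrite EFinB.
  rewrite (@integralD _ _ _ P setT measurableT (EFin \o (fun=> C)) (EFin \o f n) intC (int_f n)).
  rewrite (@integralB _ _ _ P setT measurableT (EFin \o (fun=> C)) (EFin \o f n) intC (int_f n)).
  have fin1 := integrable_fin_num measurableT (int_f n).
  have finC := integrable_fin_num measurableT intC.
  move: fin1 finC => /fineK <- /fineK <-; rewrite -EFinD -EFinB => -[] h.
  by congr EFin; lra.
have f_cvg w : f n w @[n --> \oo] --> (\int[mu]_(s in `[0, t]) (v s * W s w) + W t w)
    * expR (- ((\int[mu]_(s in `[0, t]) (v s * W s w ^+ 2) + W t w ^+ 2) / 2)).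
  have e n : W (grid t n n.+1) w = W t w by rewrite grid_max.
  apply: cvgM.
    rewrite /A; apply: cvgD; last by under eq_cvg do rewrite e; exact: cvg_cst.
    apply: (@rsum_cvg _ t ht (fun n k => v (grid t n k) * W (grid t n k) w) (fun s => v s * W s w)).
      exact: cpathM cv (@wcpath w).
    exact: (@grid_cvg_refl _ t (fun s => v s * W s w)).
  apply: continuous_cvg; first exact: continuous_expR.
  apply: cvgN; apply: cvgMl.
  rewrite /B; apply: cvgD; last by under eq_cvg do rewrite e; exact: cvg_cst.
  apply: (@rsum_cvg _ t ht (fun n k => v (grid t n k) * W (grid t n k) w ^+ 2) (fun s => v s * W s w ^+ 2)).
    exact: (cpathM cv (cpathX (n := 2) (@wcpath w))).
  exact: (@grid_cvg_refl _ t (fun s => v s * W s w ^+ 2)).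
have [_ i1 c1] := bounded_cvg_prob P mf f_bound f_cvg.
split; first exact: i1.
have E0 : (fun n => \int[P]_w (f n w)%:E)%E = (fun=> 0%E) by apply/funext.
rewrite E0 in c1.
by apply/esym; exact: (cvg_unique (@ereal_hausdorff R) (cvg_cst _) c1).
Qed.

End odd_functional.

(** * Exponential moments of the supremum of |W| *)

Section wiener_sup.
Context (R : realType) d (T : measurableType d) (P : probability T R)
  (W : R -> {RV P >-> R}) (hW : standard_wiener W) (t : R) (ht : 0 < t).
Notation cpath f := {within `[0, t], continuous f}.

Let wcpath w : cpath (fun s => W s w). Proof. exact: wiener_cpath. Qed.

Let dy n k : R := t / (2 ^ n)%:R * k%:R.
Let dW n k w := W (dy n k.+1) w - W (dy n k) w.

Let pow_gt0 n : 0 < (2 ^ n)%:R :> R. Proof. by rewrite ltr0n expn_gt0. Qed.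

Let dystep n : 0 < t / (2 ^ n)%:R. Proof. by rewrite divr_gt0. Qed.

Let dyS n k : dy n k.+1 - dy n k = t / (2 ^ n)%:R.
Proof. by rewrite /dy -mulrBr -natrB// subSnn mulr1. Qed.

Let dy_itv n k : (k <= 2 ^ n)%N -> 0 <= dy n k <= t.
Proof.
move=> kn; have step0 := ltW (dystep n).
rewrite /dy mulr_ge0//= -[leRHS](@divfK _ (2 ^ n)%:R) ?gt_eqF//.
by rewrite ler_wpM2l// ler_nat.
Qed.

(* Chaining: |W| is at most the sum over the levels n of the largest increment of
   level n, and convexity of exp with the weights [la n] turns the exponential of
   that sum into a sum of exponentials. *)
Let la n : R := 4^-1 * (3 / 4) ^+ n.

Let la_gt0 n : 0 < la n.
Proof. by rewrite mulr_gt0// exprn_gt0. Qed.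

Let la_sum n : \sum_(j < n) la j <= 1.
Proof.
suff -> : \sum_(j < n) la j = 1 - (3 / 4) ^+ n by rewrite gerBl exprn_ge0.
elim: n => [|n IH]; first by rewrite big_ord0 expr0 subrr.
by rewrite big_ord_recr/= IH /la exprS; field.
Qed.

Let la_sum' n : \sum_(j < n) la j * j%:R <= 3.
Proof.
suff -> : \sum_(j < n) la j * j%:R = 3 - 4^-1 * (3 / 4) ^+ n * (4 * n%:R + 12).
  by rewrite gerBl mulr_ge0// ?mulr_ge0 ?exprn_ge0 ?addr_ge0 ?mulr_ge0.
elim: n => [|n IH]; first by rewrite big_ord0 expr0; field.
by rewrite big_ord_recr/= IH /la exprS -natr1; field.
Qed.

(** The ratio 3/4 exceeds 2^(-1/2): the weights decrease more slowly than the standard deviations of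
    the increments, and the increments divided by [la n] have variances bounded over all levels. *)
Let la_sq n : (2 ^ n)%:R^-1 / la n ^+ 2 <= 16.
Proof.
have -> : (2 ^ n)%:R^-1 / la n ^+ 2 = 16 * (8 / 9) ^+ n :> R.
  rewrite /la exprMn natrX !expr_div_n.
  have -> : 9 ^+ n = (3 ^+ n) ^+ 2 :> R by rewrite -exprM mulnC exprM; congr (_ ^+ _); ring.
  have -> : 8 ^+ n = (2 ^+ n) ^+ 3 :> R by rewrite -exprM mulnC exprM; congr (_ ^+ _); ring.
  have -> : 4 ^+ n = (2 ^+ n) ^+ 2 :> R by rewrite -exprM mulnC exprM; congr (_ ^+ _); ring.
  have : 3 ^+ n != 0 :> R by rewrite expf_neq0.
  have : 2 ^+ n != 0 :> R by rewrite expf_neq0.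
  by move=> h1 h2; field; rewrite h1 h2.
by rewrite ler_piMr// exprn_ile1//; lra.
Qed.

Section exponential.
Variables (th : R) (th0 : 0 < th).

(** The factor 4^(-n) outweighs the 2^n increments of level [n] and leaves a geometric series in
    expectation. As [Z] dominates each of its terms, its logarithm controls all increments at once,
    up to n ln 4. *)
Let Z m w : R := \sum_(n < m.+1) (4^-1) ^+ n *
  \sum_(k < 2 ^ n) expR (th * `|dW n k w| / la n).

Let Z_ge n m k w : (n <= m)%N -> (k < 2 ^ n)%N ->
  (4^-1) ^+ n * expR (th * `|dW n k w| / la n) <= Z m w.
Proof.
move=> nm kn; rewrite /Z -ltnS in nm *.
rewrite (bigD1 (Ordinal nm))//= (bigD1 (Ordinal kn))//= mulrDr -addrA lerDl.
rewrite addr_ge0// ?mulr_ge0 ?exprn_ge0 ?sumr_ge0//.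
by move=> i _; rewrite mulr_ge0 ?exprn_ge0 ?sumr_ge0.
Qed.

Let Z_ge1 m w : 1 <= Z m w.
Proof.
apply: le_trans (@Z_ge 0 m 0 w isT isT); rewrite expr0 mul1r.
rewrite -[leLHS]expR0 ler_expR; apply: divr_ge0; last exact/ltW/la_gt0.
by apply: mulr_ge0 => //; exact: ltW.
Qed.

Let dW_le n m k w : (n <= m)%N -> (k < 2 ^ n)%N ->
  th * `|dW n k w| <= la n * (ln (Z m w) + n%:R * ln 4).
Proof.
move=> nm kn; rewrite -ler_pdivrMl// mulrC.
have Zp : 0 < Z m w := lt_le_trans ltr01 (Z_ge1 m w).
rewrite -ler_expR expRD lnK ?posrE// expRM_natl lnK ?posrE//.
rewrite -ler_pdivrMr ?exprn_gt0// mulrC -exprVn.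
rewrite [expR _ * _]mulrC [(la n)^-1 * _]mulrC; exact: Z_ge.
Qed.

(** Descent through the levels: a dyadic point of even index belongs to the previous level, and one
    of odd index is a single increment to the right of such a point. *)
Let W_le n m k w : (n <= m)%N -> (k <= 2 ^ n)%N ->
  th * `|W (dy n k) w| <= \sum_(j < n.+1) la j * (ln (Z m w) + j%:R * ln 4).
Proof.
have lnZ : 0 <= ln (Z m w) by apply: ln_ge0; exact: Z_ge1.
have ln4 : 0 <= ln 4 :> R by apply: ln_ge0; lra.
have term_ge0 j : 0 <= la j * (ln (Z m w) + j%:R * ln 4).
  apply: mulr_ge0; first exact/ltW/la_gt0.
  by rewrite addr_ge0// mulr_ge0.
have W00 n' : W (dy n' 0) w = 0 by rewrite /dy mulr0; exact: wiener0.
elim: n k => [|n IH] k nm kn.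
  rewrite big_ord1/=.
  move: kn; rewrite expn0 leq_eqVlt => /predU1P[->|].
    by have := @dW_le 0 m 0 w isT isT; rewrite /dW W00 subr0.
  by rewrite ltnS leqn0 => /eqP ->; rewrite W00 normr0 mulr0.
have dy_double j : dy n.+1 j.*2 = dy n j.
  rewrite /dy expnS natrM -muln2 natrM; field.
  by rewrite ?gt_eqF.
have even_case j : (j <= 2 ^ n)%N ->
    th * `|W (dy n.+1 j.*2) w| <= \sum_(j < n.+1) la j * (ln (Z m w) + j%:R * ln 4).
  by move=> jn; rewrite dy_double; apply: IH => //; exact: ltnW.
rewrite big_ord_recr/=.
have [ko|ke] := boolP (odd k); last first.
  have k2 : k = (k./2).*2 by rewrite -[LHS]odd_double_half (negbTE ke).
  rewrite -[leLHS]addr0 lerD// k2 even_case//.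
  by rewrite -leq_double -k2 -mul2n -expnS.
have k2 : k = (k./2).*2.+1 by rewrite -[LHS]odd_double_half ko.
have kk : ((k./2).*2 < 2 ^ n.+1)%N by rewrite -k2.
have k2n : (k./2 <= 2 ^ n)%N.
  by rewrite -leq_double -[((2 ^ n).*2)%N]mul2n -expnS ltnW.
have -> : W (dy n.+1 k) w = W (dy n.+1 (k./2).*2) w + dW n.+1 (k./2).*2 w.
  by rewrite /dW -k2 addrC subrK.
apply: (@le_trans _ _ (th * `|W (dy n.+1 (k./2).*2) w| + th * `|dW n.+1 (k./2).*2 w|)).
  by rewrite -mulrDr ler_pM2l// ler_normD.
by rewrite lerD ?even_case// dW_le.
Qed.

(** The weights sum to at most 1 and the weighted levels to at most 3, so the exponent is at most ln
    Z + 3 ln 4; hence 64 = 4^3. *)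
Let expW_le m k w : (k <= 2 ^ m)%N -> expR (th * `|W (dy m k) w|) <= 64 * Z m w.
Proof.
move=> km.
have Zp : 0 < Z m w := lt_le_trans ltr01 (Z_ge1 m w).
have lnZ : 0 <= ln (Z m w) by apply: ln_ge0; exact: Z_ge1.
have ln4 : 0 <= ln 4 :> R by apply: ln_ge0; lra.
have h : th * `|W (dy m k) w| <= ln (Z m w) + 3%:R * ln 4.
  apply: le_trans (W_le w (leqnn m) km) _.
  under eq_bigr do rewrite mulrDr mulrA.
  rewrite big_split/= -!mulr_suml lerD//.
    by rewrite ler_piMl// la_sum.
  by rewrite ler_wpM2r// la_sum'.
rewrite -ler_expR in h; apply: le_trans h _.
rewrite expRD lnK ?posrE// expRM_natl lnK ?posrE// mulrC.
by rewrite ler_pM2r//; lra.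
Qed.

(** The factor 2 comes from exp |x| <= exp x + exp(-x), and 8 is half of the bound 16 of [la_sq]. *)
Let int_exp n k : (\int[P]_w (expR (th * `|dW n k w| / la n))%:E <=
  (2 * expR (8 * th ^+ 2 * t))%:E)%E.
Proof.
(* Any increasing sequence will do whose first increment goes from [dy n k] to [dy n k.+1]. *)
pose u i : R := if (i == 0)%N then dy n k else dy n k + t / (2 ^ n)%:R * i%:R.
have u0 : 0 <= u 0%N by rewrite /u/= mulr_ge0 //; exact/ltW/dystep.
have ltu i : u i < u i.+1.
  case: i => [|i]; rewrite /u/= ?ltrDl ?mulr1// ltrD2l ltr_pM2l//.
  by rewrite ltr_nat.
have u1 : u 1%N = dy n k.+1.
  by rewrite /u/= mulr1 -(dyS n k) addrC subrK.
have mgf (e : R) : (\int[P]_w (expR (e * th / la n * dW n k w))%:E =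
    (expR ((e * th / la n) ^+ 2 * (t / (2 ^ n)%:R) / 2))%:E)%E.
  have := wiener_increment_mgf hW u0 ltu 0 (e * th / la n).
  by rewrite u1 {2}/u/= dyS.
have mdW (c : R) : measurable_fun [set: T] (fun w => expR (c * dW n k w)).
  by apply: measurableT_comp => //; apply: measurable_funM => //; exact: measurable_funB.
apply: (@le_trans _ _ (\int[P]_w ((expR (1 * th / la n * dW n k w))%:E +
    (expR (-1 * th / la n * dW n k w))%:E)))%E.
  apply: ge0_le_integral => //.
  - apply/measurable_EFinP; apply: measurableT_comp => //.
    apply: measurable_funM => //; apply: measurable_funM => //.
    by apply: measurableT_comp => //; exact: measurable_funB.
  - by apply: emeasurable_funD; exact/measurable_EFinP.
  - move=> w _; rewrite -EFinD lee_fin.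
    have [x0|x0] := leP 0 (dW n k w).
      by rewrite mul1r ger0_norm// mulrAC lerDl expR_ge0.
    rewrite ltr0_norm// (_ : th * - dW n k w / la n = -1 * th / la n * dW n k w); last by ring.
    by rewrite lerDr expR_ge0.
rewrite ge0_integralD//; last 2 first.
- exact/measurable_EFinP.
- exact/measurable_EFinP.
rewrite !mgf -EFinD lee_fin mulN1r mul1r mulNr sqrrN.
rewrite -mulr2n -[leLHS]mulr_natl ler_pM2l// ler_expR.
have -> : (th / la n) ^+ 2 * (t / (2 ^ n)%:R) / 2 =
  ((2 ^ n)%:R^-1 / la n ^+ 2) * (th ^+ 2 * t / 2).
  by field; rewrite !gt_eqF.
apply: le_trans (ler_wpM2r _ (la_sq n)) _; last by lra.
by rewrite divr_ge0// mulr_ge0 ?sqr_ge0// ltW.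
Qed.

Let mdW n k : measurable_fun [set: T] (fun w => expR (th * `|dW n k w| / la n)).
Proof.
apply: measurableT_comp => //.
apply: measurable_funM => //; apply: measurable_funM => //.
by apply: measurableT_comp => //; exact: measurable_funB.
Qed.

Let mZ m : measurable_fun [set: T] (Z m).
Proof.
by apply: measurable_sum => n; apply: measurable_funM => //; apply: measurable_sum.
Qed.

Let int_Z m : (\int[P]_w (Z m w)%:E <= (4 * expR (8 * th ^+ 2 * t))%:E)%E.
Proof.
have -> : (\int[P]_w (Z m w)%:E = \sum_(n < m.+1) \sum_(k < 2 ^ n)
    ((4^-1) ^+ n)%:E * \int[P]_w (expR (th * `|dW n k w| / la n))%:E)%E.
  transitivity (\int[P]_w (\sum_(n < m.+1) \sum_(k < 2 ^ n) ((4^-1) ^+ n * expR (th * `|dW n k w| / la n))%:E))%E.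
    apply: eq_integral => w _; rewrite /Z -sumEFin; apply: eq_bigr => n _.
    by rewrite mulr_sumr sumEFin.
  rewrite ge0_integral_sum//; last 2 first.
  - move=> n; apply: emeasurable_sum => k.
    by apply/measurable_EFinP; exact: measurable_funM.
  - move=> n w _; apply: sume_ge0 => k _.
    by rewrite lee_fin mulr_ge0 ?exprn_ge0 ?expR_ge0.
  apply: eq_bigr => n _; rewrite ge0_integral_sum//; last first.
    by move=> k; apply/measurable_EFinP; exact: measurable_funM.
  apply: eq_bigr => k _; under eq_integral do rewrite EFinM.
  rewrite ge0_integralZl//.
    exact/measurable_EFinP.
apply: (@le_trans _ _ (\sum_(n < m.+1) \sum_(k < 2 ^ n)
    ((4^-1) ^+ n * (2 * expR (8 * th ^+ 2 * t)))%:E)%E).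
  apply: lee_sum => n _; apply: lee_sum => k _; rewrite EFinM.
  by rewrite lee_wpmul2l ?lee_fin ?exprn_ge0.
under eq_bigr do rewrite sumEFin.
rewrite sumEFin lee_fin.
have e_n n : \sum_(k < 2 ^ n) (4^-1) ^+ n * (2 * expR (8 * th ^+ 2 * t)) =
    (2 * 4^-1) ^+ n * (2 * expR (8 * th ^+ 2 * t)).
  by rewrite sumr_const card_ord -[LHS]mulr_natl natrX mulrA -exprMn.
under eq_bigr do rewrite e_n.
rewrite -mulr_suml.
have -> : 4 * expR (8 * th ^+ 2 * t) = 2 * (2 * expR (8 * th ^+ 2 * t)) by ring.
rewrite ler_pM2r ?mulr_gt0 ?expR_gt0//.
have -> : 2 * 4^-1 = 2^-1 :> R by field.
suff -> : \sum_(i < m.+1) (2^-1) ^+ i = 2 - (2^-1) ^+ m :> R.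
  by rewrite gerBl exprn_ge0.
elim: m => [|m IH]; first by rewrite big_ord_recr big_ord0/= expr0; ring.
by rewrite big_ord_recr/= IH exprS; field.
Qed.

Lemma exp_dyadic_max m : exists Zm : T -> R,
  [/\ measurable_fun [set: T] Zm,
      forall k w, (k <= 2 ^ m)%N ->
        expR (th * `|W (t / (2 ^ m)%:R * k%:R) w|) <= Zm w &
      (\int[P]_w (Zm w)%:E <= (256 * expR (8 * th ^+ 2 * t))%:E)%E].
Proof.
exists (fun w => 64 * Z m w); split.
- exact: measurable_funM.
- by move=> k w km; exact: expW_le.
under eq_integral do rewrite EFinM.
rewrite ge0_integralZl//; last 2 first.
- exact/measurable_EFinP.
- by move=> w _; rewrite lee_fin (le_trans ler01)// Z_ge1.
have -> : 256 * expR (8 * th ^+ 2 * t) = 64 * (4 * expR (8 * th ^+ 2 * t)) by ring.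
by rewrite EFinM lee_wpmul2l// ?lee_fin// int_Z.
Qed.

End exponential.

(** [Y] is the maximum of |W|, measurable as the limit of the dyadic maxima; Fatou's lemma transfers
    their exponential moments. The bound of the form exp(8 th^2 t), valid for every [th], is what
    yields a Gaussian tail. *)
Lemma wiener_sup : exists Y : T -> R,
  [/\ measurable_fun [set: T] Y,
      forall w s, 0 <= s <= t -> `|W s w| <= Y w &
      forall th, 0 < th ->
        (\int[P]_w (expR (th * Y w))%:E <= (256 * expR (8 * th ^+ 2 * t))%:E)%E].
Proof.
have maxP w : {c | 0 <= c <= t & forall s, 0 <= s <= t -> `|W s w| <= `|W c w|}.
  apply: cid2; have cabs : cpath (fun s => `|W s w|).
    by apply: (@cpath_comp _ _ Num.norm) => // x; exact: norm_continuous.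
  have [c ct hc] := EVT_max (ltW ht) cabs.
  exists c; first by move: ct; rewrite in_itv.
  by move=> s st; apply: hc; rewrite in_itv.
pose Y w := `|W (s2val (maxP w)) w|.
pose Ym m w := \big[Num.max/0]_(k < (2 ^ m).+1) `|W (dy m k) w|.
have YmE m w k : (k <= 2 ^ m)%N -> `|W (dy m k) w| <= Ym m w.
  by move=> km; rewrite /Ym (bigmax_sup (Ordinal (km : (k < (2 ^ m).+1)%N))).
have Ym_exists m w : exists2 k, (k <= 2 ^ m)%N & Ym m w = `|W (dy m k) w|.
  rewrite /Ym; have [|k _ ->] := @eq_bigmax _ _ 'I_(2 ^ m).+1 0 ord0 xpredT
    (fun k : 'I_(2 ^ m).+1 => `|W (dy m k) w|) isT; first by [].
  by exists k => //; rewrite -ltnS.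
have YmY m w : Ym m w <= Y w.
  have [k km ->] := Ym_exists m w.
  by rewrite /Y; apply: (s2valP' (maxP w)); exact: dy_itv.
have Ym_cvg w : Ym m w @[m --> \oo] --> Y w.
  apply/cvgrPdist_lt => e e0.
  have [dl dl0 Hdl] := cpath_unif (@wcpath w) e0.
  near=> m.
  rewrite ger0_norm ?subr_ge0// ltrBlDr.
  have ct := s2valP (maxP w); set c := s2val (maxP w) in ct *.
  have c0 : 0 <= c / (t / (2 ^ m)%:R) by apply: divr_ge0; [case/andP: ct|exact/ltW/dystep].
  have /andP[k1 k2] := truncn_itv c0.
  (* The dyadic point just before the maximizer [c]. *)
  set k := Num.truncn _ in k1 k2.
  have km : (k <= 2 ^ m)%N.
    rewrite -(ler_nat R) (le_trans k1)// invfM invrK mulrA ler_piMl//.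
    by rewrite ler_pdivrMr ?mul1r//; case/andP: ct.
  apply: (@lt_le_trans _ _ (e + `|W (dy m k) w|)); last by rewrite lerD2l YmE.
  rewrite -ltrBlDr; apply: le_lt_trans (lerB_dist _ _) _.
  apply: Hdl => //; first exact: dy_itv.
  rewrite -/c (_ : c - dy m k = t / (2 ^ m)%:R * (c / (t / (2 ^ m)%:R)) - dy m k); last first.
    by congr (_ - _); rewrite mulrC divfK// gt_eqF.
  rewrite /dy -mulrBr normrM gtr0_norm// ger0_norm ?subr_ge0//.
  apply: (@le_lt_trans _ _ (t / (2 ^ m)%:R)).
    rewrite ler_piMr ?(ltW (dystep m))// lerBlDl; move: k2; rewrite -natr1 => /ltW; lra.
  near: m; have e1 : 0 < dl / t by rewrite divr_gt0.
  have := @near_infty_natSinv_expn_lt R (PosNum e1); apply: filterS => m /= hm.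
  rewrite mulrC -ltr_pdivlMr// natrX; move: hm; by rewrite div1r.
have mbigmax N (f : nat -> T -> R) : (forall k, measurable_fun [set: T] (f k)) ->
    measurable_fun [set: T] (fun w => \big[Num.max/0]_(k < N) f k w).
  elim: N f => [|N IH] f mf.
    by under eq_fun do rewrite big_ord0; exact: measurable_cst.
  under eq_fun do rewrite big_ord_recl/=.
  by apply: measurable_maxr => //; exact: (IH (fun k => f (bump 0 k))).
have mYm m : measurable_fun [set: T] (Ym m).
  by apply: (mbigmax _ (fun k w => `|W (dy m k) w|)) => k; exact: measurableT_comp.
exists Y; split.
- by apply: (@measurable_fun_cvg _ _ _ setT Ym) => // w _; exact: Ym_cvg.
- by move=> w s st; exact: (s2valP' (maxP w)).
move=> th th0.
have Ye w : (expR (th * Y w))%:E = limn_einf (fun m => (expR (th * Ym m w))%:E).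
  have c : (expR (th * Ym m w))%:E @[m --> \oo] --> (expR (th * Y w))%:E.
    apply: cvg_EFin; first exact: nearW.
    apply: continuous_cvg; first exact: continuous_expR.
    by apply: cvgMr; exact: Ym_cvg.
  rewrite is_cvg_limn_einfE; first by rewrite (cvg_lim _ c).
  by apply/cvg_ex; eexists; exact: c.
under eq_integral do rewrite Ye.
apply: le_trans.
  apply: fatou => //.
  by move=> m; apply/measurable_EFinP; apply: measurableT_comp => //; exact: measurable_funM.
rewrite limn_einf_lim; apply: lime_le; first exact: is_cvg_einfs.
apply: nearW => m; apply: (@le_trans _ _ (\int[P]_w (expR (th * Ym m w))%:E)%E).
  by apply: ereal_inf_lbound; exists m => //=.
have [Zm [mZm hZ iZ]] := exp_dyadic_max th0 m.
apply: le_trans iZ; apply: ge0_le_integral => //.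
- by apply/measurable_EFinP; apply: measurableT_comp => //; exact: measurable_funM.
- exact/measurable_EFinP.
- by move=> w _; rewrite lee_fin; have [k km ->] := Ym_exists m w; exact: hZ.
Unshelve. all: end_near. Qed.

End wiener_sup.

(** * The Euler-Lagrange equation *)

Section euler_lagrange.
Context (R : realType) (t : R) (ht : 0 < t).
Notation cpath f := {within `[0, t], continuous f}.
Notation mu := (@lebesgue_measure R).
Implicit Types f g phi : R -> R.

Lemma C01_is_derive phi g :
  (forall s, s \in `[0, t] ->
     (phi r - phi s) / (r - s) @[r --> within `[0, t] s^'] --> g s) ->
  forall s, 0 < s < t -> is_derive s (1 : R) phi (g s).
Proof.
move=> H s /andP[s0 st].
have sI : s \in `[0, t] by rewrite in_itv/= !ltW.
suff h : h^-1 *: ((phi \o shift s) (h *: 1) - phi s) @[h --> 0^'] --> g s.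
  by apply: DeriveDef; [apply/cvg_ex; exists (g s)|exact/cvg_lim].
apply/cvgrPdist_lt => e e0.
have := H s sI => /cvgrPdist_lt /(_ e e0); rewrite near_withinE => -[dl /= dl0 Hdl].
have m0 : 0 < Num.min dl (Num.min s (t - s)) by rewrite !lt_min dl0 s0 subr_gt0.
exists (Num.min dl (Num.min s (t - s))) => //= h.
rewrite /ball_ /= sub0r normrN !lt_min => /and3P[hdl hs hts] h0.
have := Hdl (h + s); rewrite /= opprD addrCA subrr addr0 normrN => /(_ hdl).
rewrite -subr_eq0 addrK => /(_ h0); rewrite in_itv/=.
move: hs hts; rewrite !ltr_norml => /andP[h1 h2] /andP[h3 h4].
have -> : (0 <= h + s) && (h + s <= t) by apply/andP; split; lra.
by move=> /(_ isT); rewrite /GRing.scale/= mulr1 mulrC.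
Qed.

Lemma lipschitz_abs_continuous f (K : R) :
  (forall x y, 0 <= x -> x <= y -> y <= t -> `|f y - f x| <= K * (y - x)) ->
  absolutely_continuous t f.
Proof.
move=> Kf e e0; have K0 : 0 <= K.
  have := Kf 0 t (lexx _) (ltW ht) (lexx _); rewrite subr0 => /(le_trans (normr_ge0 _)).
  by rewrite pmulr_lge0.
exists (e / (K + 1)); first by rewrite divr_gt0// ltr_wpDl.
move=> n a b ab _ sum_lt.
apply: (@le_lt_trans _ _ (K * \sum_(i < n) (b i - a i))).
  by rewrite mulr_sumr ler_sum// => i _; have [? ? ?] := ab i; exact: Kf.
apply: (@le_lt_trans _ _ ((K + 1) * \sum_(i < n) (b i - a i))).
  rewrite ler_wpM2r ?lerDl// sumr_ge0// => i _.
  by have [_ ? _] := ab i; rewrite subr_ge0.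
by rewrite mulrC -ltr_pdivlMr// ltr_wpDl.
Qed.

(** First-order condition at an extremum. For [X > 0] the test value [- X / (K + X + 1)] is
    admissible and small enough for the linear term to win. *)
Lemma linear_ge_quadratic (X K : R) : 0 <= K ->
  (forall e, `|e| <= 1 -> - (K * e ^+ 2) <= e * X) -> X = 0.
Proof.
move=> K0; wlog X0 : X / 0 <= X.
  move=> wl h; have [X0|X0] := leP 0 X; first exact: wl.
  apply/eqP; rewrite -oppr_eq0; apply/eqP; apply: wl.
    by rewrite oppr_ge0 ltW.
  by move=> e e1; have := h (- e); rewrite normrN sqrrN mulNr mulrN; exact.
move=> h; apply/eqP; rewrite eq_le X0 andbT leNgt; apply/negP => Xp.
have KX : 0 < K + X + 1 by lra.
pose de := X / (K + X + 1).
have de0 : 0 < de by rewrite divr_gt0.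
have de1 : de <= 1 by rewrite ler_pdivrMr//; lra.
have deE : de * (K + X + 1) = X by rewrite divfK// gt_eqF.
have := h (- de); rewrite normrN gtr0_norm// sqrrN => /(_ de1).
have : K * de < X by nra.
nra.
Qed.

Variables (phi g : R -> R).
Hypothesis cphi : cpath phi.
Hypothesis phi0 : phi 0 = 0.
Hypothesis cg : cpath g.
Hypothesis dphi : forall s, 0 < s < t -> is_derive s (1 : R) phi (g s).

(** The derivative of the direction min(s, u) is the indicator of [0, u], so the action pairs with
    it to give [phi u]. The stationarity condition thus appears already integrated twice, with no
    second derivative of [phi]. *)
Let ramp (u e : R) s := phi s + e * Num.min s u.

Lemma phi_lipschitz : exists2 K : R, 0 < K &
  forall x y, 0 <= x -> x <= y -> y <= t -> `|phi y - phi x| <= K * (y - x).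
Proof.
have [M M0 gM] := cpath_bounded ht cg.
exists M => // x y x0; rewrite le_eqVlt => /predU1P[<- _|xy yt].
  by rewrite !subrr normr0 mulr0.
have cxy : {within `[x, y], continuous phi}.
  apply: continuous_subspaceW cphi => s /=; rewrite !in_itv/= => /andP[xs sy].
  by rewrite (le_trans x0 xs) (le_trans sy yt).
have dxy s : s \in `]x, y[ -> is_derive s (1 : R) phi (g s).
  rewrite in_itv/= => /andP[xs sy]; apply: dphi.
  by rewrite (le_lt_trans x0 xs) (lt_le_trans sy yt).
have [c cxy' ->] := MVT xy dxy cxy.
have yx : 0 < y - x by rewrite subr_gt0.
rewrite normrM (gtr0_norm yx) ler_pM2r//.
move: cxy'; rewrite in_itv/= => /andP[xs sy]; apply: gM.
by rewrite (ltW (le_lt_trans x0 xs)) (ltW (lt_le_trans sy yt)).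
Qed.

Lemma ramp_is_derive u e s : 0 < s < t -> s != u ->
  is_derive s (1 : R) (ramp u e) (g s + e * (if s < u then 1 else 0)).
Proof.
move=> st su; have dm : is_derive s (1 : R) (fun r => Num.min r u) (if s < u then 1 else 0).
  have [su'|us] := ltP s u.
    apply: (@near_eq_is_derive _ _ _ id) => //.
    by near=> r; rewrite /= min_l//; near: r; exact: lt_le_nbhsl.
  apply: (@near_eq_is_derive _ _ _ (cst u)) => //.
  near=> r; rewrite /= min_r//; apply: ltW; near: r; apply: lt_nbhsr.
  by rewrite lt_neqAle eq_sym su.
have h1 := dphi st.
have h2 := is_deriveZ e dm.
exact: (is_deriveD h1 h2).
Unshelve. all: end_near. Qed.

Lemma integral_phi' u : 0 < u <= t -> \int[mu]_(s in `[0, u]) g s = phi u.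
Proof.
move=> /andP[u0 ut].
have sub : `[0, u]%classic `<=` `[0, t]%classic.
  by move=> s /=; rewrite !in_itv/= => /andP[-> su]; exact: le_trans ut.
have cgu : {within `[0, u], continuous g} by exact: continuous_subspaceW cg.
have cphiu : {within `[0, u], continuous phi} by exact: continuous_subspaceW cphi.
rewrite /Rintegral (@continuous_FTC2 _ g phi)//.
- by rewrite phi0 sube0.
- have [_ l r] := (continuous_within_itvP phi u0).1 cphiu.
  split => // s; rewrite in_itv/= => /andP[s0 su].
  have s0t : 0 < s < t by rewrite s0 (lt_le_trans su ut).
  by have [] := dphi s0t.
- move=> s; rewrite in_itv/= => /andP[s0 su].
  have s0t : 0 < s < t by rewrite s0 (lt_le_trans su ut).
  by rewrite derive1E; have [_ ->] := dphi s0t.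
Qed.

(* The kink at [u] and the end points form a null set. *)
Lemma action_ramp u e : 0 < u <= t ->
  action t (ramp u e) = (2^-1 * (\int[mu]_(s in `[0, t]) (g s ^+ 2)
    + (2 * e * phi u + e ^+ 2 * u)))%:E.
Proof.
move=> /andP[u0 ut].
have sub : `[0, u]%classic `<=` `[0, t]%classic.
  by move=> s /=; rewrite !in_itv/= => /andP[-> su]; exact: le_trans ut.
have cgu : {within `[0, u], continuous g} by exact: continuous_subspaceW cg.
have [K K0 Kphi] := phi_lipschitz.
rewrite /action asboolT; last first.
  apply: (@lipschitz_abs_continuous _ (K + `|e|)) => x y x0 xy yt.
  rewrite /ramp (_ : _ - _ = (phi y - phi x) + e * (Num.min y u - Num.min x u)); last by ring.
  rewrite (le_trans (ler_normD _ _))// mulrDl lerD ?Kphi// normrM ler_wpM2l//.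
  rewrite ger0_norm; rewrite /Num.min; do 2 (case: ifPn; rewrite -?leNgt => ?); lra.
pose k s := 2 * e * g s + e ^+ 2.
(* The expansion of (g + e)^2 on [0, u[ and of g^2 beyond, that is, the square of the derivative of
   the ramp away from [N]. *)
pose H s := g s ^+ 2 + (k \_ `[0, u[) s.
have ck : {within `[0, u], continuous k}.
  apply: cpathD; last exact: cpath_cst.
  by apply: cpathM => //; exact: cpath_cst.
have ig2 : mu.-integrable `[0, t] (EFin \o (fun s => g s ^+ 2)).
  by apply: cpath_integrable; exact: cpathX.
have ik : mu.-integrable `[0, u[ (EFin \o k).
  apply: integrableS (cpath_integrable ck) => //.
  by apply: subset_itvl; rewrite bnd_simp.
have subu : `[0, u[%classic `<=` `[0, t]%classic.
  by move=> s /=; rewrite !in_itv/= => /andP[-> su]; exact: le_trans (ltW su) ut.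
have ikt : mu.-integrable `[0, t] (EFin \o (k \_ `[0, u[)).
  rewrite -restrict_EFin; apply/integrable_restrict => //.
  by rewrite setIidr.
have intH : \int[mu]_(s in `[0, t]) H s =
    \int[mu]_(s in `[0, t]) (g s ^+ 2) + (2 * e * phi u + e ^+ 2 * u).
  rewrite RintegralD//; congr (_ + _).
  rewrite -Rintegral_mkcondr setIidr// Rintegral_itv_bndo_bndc//.
  rewrite cpath_intD//; last 2 first.
  - by apply: cpathM => //; exact: cpath_cst.
  - exact: cpath_cst.
  by rewrite cpath_intZ// int_cst// integral_phi'// u0.
rewrite EFinM -intH; congr (_ * _)%E.
have iH : mu.-integrable `[0, t] (EFin \o H).
  rewrite (_ : EFin \o H = ((EFin \o (fun s => (g s ^+ 2)%R)) \+ (EFin \o (k \_ `[0%R, u[)))%E)//.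
  exact: integrableD.
rewrite /Rintegral fineK; last exact: integrable_fin_num.
pose N := [set 0] `|` [set u] `|` [set t].
have mN : measurable N by apply: measurableU => //; exact: measurableU.
have eqH : {in `[0, t]%classic `\` N, (fun s => ((ramp u e)^`() s ^+ 2)%:E) =1 (fun s => (H s)%:E)}.
  move=> s; rewrite inE /N /= in_itv/= => -[/andP[s0 st] sN].
  have [s0' su' st'] : [/\ s != 0, s != u & s != t].
    by split; apply/eqP => h; apply: sN; rewrite h; [left; left|left; right|right].
  have s0t : 0 < s < t by rewrite !lt_neqAle eq_sym s0' s0 st' st.
  have [_ ds] := ramp_is_derive e s0t su'.
  rewrite derive1E ds /H /k patchE /=; congr EFin.
  have -> : (s \in `[0, u[%classic) = (s < u) by apply/idP/idP; rewrite inE/= in_itv/= s0.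
  case: (s < u) => /=; first by ring.
  (* Off [[0, u[] the restricted function takes the default value [point], which is 0 in [R]. *)
  by rewrite (_ : point = 0) //; ring.
have muN : mu N = 0%E.
  apply: countable_lebesgue_measure0; apply: finite_set_countable.
  by rewrite /N !finite_setU; do !split; exact: finite_set1.
have mD : measurable (`[0, t] : set R) by exact: measurable_itv.
(* The derivative agrees with [H] off the finite set [N], and on a finite set every function is
   measurable. *)
have mf : measurable_fun `[0, t] (fun s => ((ramp u e)^`() s ^+ 2)%:E).
  have -> : `[0, t]%classic = (`[0, t] `\` N) `|` (`[0, t] `&` N).
    by rewrite setUC setUIDK.
  apply/measurable_funU; [exact: measurableD|exact: measurableI|split].
    apply: (eq_measurable_fun (fun s => (H s)%:E)).
      by move=> s sDN; rewrite eqH.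
    by apply: measurable_funS (measurable_int _ iH).
  apply: (@measurable_funS _ _ _ _ N) => //.
  apply/measurable_funU => //; first exact: measurableU.
  split; last exact: measurable_fun_set1.
  by apply/measurable_funU => //; split; exact: measurable_fun_set1.
rewrite (@ge0_negligible_integral _ _ _ mu `[0, t] N (fun s => ((ramp u e)^`() s ^+ 2)%:E))//; last first.
  by move=> s _; rewrite lee_fin sqr_ge0.
rewrite [RHS](@negligible_integral _ _ _ mu `[0, t] N (EFin \o H))//.
exact: eq_integral.
Qed.

End euler_lagrange.

Section euler_lagrange_equation.
Context (R : realType) (V : R -> R) (t q : R) (ht : 0 < t).
Notation cpath f := {within `[0, t], continuous f}.
Notation mu := (@lebesgue_measure R).
Hypothesis hVderivable : forall k : nat, (k < 4)%N -> forall x, derivable V^`(k) x 1.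
Hypothesis hVcontinuous : continuous V^`(4).
Variable phi : R -> R.
Hypothesis hphiC1 : C01 t phi.
Hypothesis hphi : reaches_sup_uniquely V t q phi.

Lemma C01_cpath : cpath phi. Proof. by case: hphiC1 => -[]. Qed.

Lemma C01_0 : phi 0 = 0. Proof. by case: hphiC1 => -[]. Qed.

(** This is phi'' = V'(phi + q) with phi(0) = 0 and phi'(t) = - (phi(t) + q), written with the Green
    function min(s, u). It follows from comparing [phi] with its perturbations by ramps: the action
    is exactly quadratic in [e], and [V] is expanded to second order. *)
Lemma euler_lagrange u : 0 <= u <= t ->
  phi u = - ((phi t + q) * u)
    - \int[mu]_(s in `[0, t]) (V^`(1) (phi s + q) * Num.min s u).
Proof.
have cphi := C01_cpath; have phi0 := C01_0.
move=> /andP[u0 ut]; move: u0; rewrite le_eqVlt => /predU1P[<-|u0].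
  rewrite phi0 mulr0 oppr0 sub0r; apply/eqP; rewrite eq_sym oppr_eq0; apply/eqP.
  rewrite -[RHS](mul0r t) -(int_cst ht); apply: cpath_int_eq => s /andP[s0 _].
  by rewrite min_r// mulr0.
have [_ [g [cg dg]]] := hphiC1.
have dphi := C01_is_derive dg.
have [M M0 phiM] := cpath_bounded ht cphi.
pose a s := phi s + q.
have ca : cpath a by apply: cpathD => //; exact: cpath_cst.
have Mq : 0 < M + `|q| + t by rewrite addr_gt0// ltr_pwDl.
have [C Cp HC] := potential_bounded hVderivable hVcontinuous Mq.
have cV k : (k <= 4)%N -> continuous V^`(k) := potential_continuous hVderivable hVcontinuous (k := k).
have cr : cpath (fun s => Num.min s u) := cpath_min (t := t) (u := u).
have cvr : cpath (fun s => V^`(1) (a s) * Num.min s u).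
  by apply: cpathM => //; apply: cpath_comp => //; exact: cV.
have u0t : 0 < u <= t by rewrite u0.
set I := \int[mu]_(s in _) _.
suff : (phi t + q) * u + I + phi u = 0 by move=> h; lra.
(* The three terms bound the coefficients of e^2 coming from the Taylor remainder of [V], from the
   square at time [t] and from the action. *)
apply: (@linear_ge_quadratic _ _ (C * t ^+ 2 * t + u ^+ 2 / 2 + u / 2)).
  by rewrite !addr_ge0// ?divr_ge0 ?sqr_ge0 ?(ltW u0)// !mulr_ge0 ?sqr_ge0 ?ltW.
move=> e e1.
pose f s := phi s + e * Num.min s u.
have cf : cpath f by apply: cpathD => //; apply: cpathM => //; exact: cpath_cst.
have C0f : C0 t f.
  by split => //; rewrite /f phi0 min_l ?ltW// mulr0 addr0.
have af := action_ramp ht cphi phi0 cg dphi e u0t.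
(* At [e = 0] the ramp is [phi] itself. *)
have ap := action_ramp ht cphi phi0 cg dphi 0 u0t.
rewrite (_ : (fun s => phi s + 0 * Num.min s u) = phi) in ap; last first.
  by apply/funext => s; rewrite mul0r addr0.
have [_ Jphi _] := hphi.
have : ((F V t q f)%:E - action t f <= (F V t q phi)%:E - action t phi)%E.
  by rewrite Jphi; apply: ereal_sup_ubound; exists f.
rewrite -/f in af; rewrite af ap -!EFinB lee_fin.
set I2 := \int[mu]_(s in _) _.
have cVa : cpath (fun s => V (a s)) by apply: cpath_comp => //; exact: (cV 0%N).
have cVf : cpath (fun s => V (f s + q)).
  apply: (@cpath_comp _ _ V (fun s => f s + q)); first exact: (cV 0%N).
  by apply: cpathD => //; exact: cpath_cst.
have Vf : \int[mu]_(s in `[0, t]) V (f s + q) <=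
    \int[mu]_(s in `[0, t]) V (a s) + e * I + C * t ^+ 2 * e ^+ 2 * t.
  rewrite -cpath_intZ// -(int_cst ht) -!cpath_intD//; last 3 first.
  - apply: cpathD => //; apply: cpathM => //; exact: cpath_cst.
  - exact: cpath_cst.
  - apply: cpathM => //; exact: cpath_cst.
  apply: cpath_int_le => //.
    apply: cpathD; last exact: cpath_cst.
    by apply: cpathD => //; apply: cpathM => //; exact: cpath_cst.
  move=> s st; have /andP[s0 s_t] := st.
  have m1 : `|Num.min s u| <= t.
    by rewrite ger0_norm ?le_min ?s0 ?(ltW u0)// ge_min s_t.
  have em : `|e * Num.min s u| <= t by rewrite normrM -[leRHS]mul1r ler_pM.
  have := @taylor_rem2 R (fun k => V^`(k)) 4 C t (potential_is_derive hVderivable) 0 (a s) isT _ _ em.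
  have aM : `|a s| <= M + `|q| by rewrite (le_trans (ler_normD _ _))// lerD2r phiM.
  have H y : `|y| <= t -> `|V^`(2) (a s + y)| <= C.
    by move=> yt; apply: HC => //; rewrite (le_trans (ler_normD _ _))// lerD.
  move=> /(_ H); rewrite ler_norml => /andP[_ h].
  have -> : f s + q = a s + e * Num.min s u by rewrite /f /a; ring.
  move: h; rewrite derive1n0 => h.
  have h2 : C * `|e * Num.min s u| ^+ 2 <= C * t ^+ 2 * e ^+ 2.
    have m2 : Num.min s u ^+ 2 <= t ^+ 2.
      by rewrite -(real_normK (num_real (Num.min s u))) lerXn2r// ?nnegrE// ltW.
    rewrite real_normK ?num_real// -mulrA ler_pM2l// exprMn mulrC.
    by rewrite ler_wpM2r ?sqr_ge0.
  lra.
have ft : f t + q = phi t + q + e * u by rewrite /f min_r//; ring.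
rewrite /F !real_normK ?num_real// ft.
move: Vf; rewrite /a.
set A := \int[mu]_(s in _) _; set B := \int[mu]_(s in _) _.
move: A B (phi t) (phi u) I I2 => A B b p I I2; nra.
Qed.

End euler_lagrange_equation.

(** * Expansion of the shifted expectation *)

Section path_expansion.
Context (R : realType) (V : R -> R) (t : R) (ht : 0 < t).
Notation cpath f := {within `[0, t], continuous f}.
Notation mu := (@lebesgue_measure R).
Hypothesis hVderivable : forall k : nat, (k < 4)%N -> forall x, derivable V^`(k) x 1.
Hypothesis hVcontinuous : continuous V^`(4).
Variables (a : R -> R) (rad : R).
Hypothesis ca : cpath a.
Hypothesis rad0 : 0 < rad.

Definition Vrem (y : R -> R) : R :=
  \int[mu]_(s in `[0, t]) (V (a s + y s) - V (a s) - V^`(1) (a s) * y s).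

(** The derivative of [Vrem] at [y] in the direction of the constant path 1, i.e. with respect to
    the starting point. *)
Definition V1rem (y : R -> R) : R :=
  \int[mu]_(s in `[0, t]) (V^`(1) (a s + y s) - V^`(1) (a s)).

Let cV k : (k <= 4)%N -> continuous V^`(k) := potential_continuous hVderivable hVcontinuous (k := k).
Let dV := potential_is_derive hVderivable.

Let cVa k : (k <= 4)%N -> cpath (fun s => V^`(k) (a s)).
Proof. by move=> k4; apply: cpath_comp => //; exact: cV. Qed.

Let cVay k (y : R -> R) : (k <= 4)%N -> cpath y -> cpath (fun s => V^`(k) (a s + y s)).
Proof. by move=> k4 cy; apply: cpath_comp; [exact: cV|exact: cpathD]. Qed.

Let cZ (c : R) (y : R -> R) : cpath y -> cpath (fun s => c * y s).
Proof. by move=> cy; apply: cpathM => //; exact: cpath_cst. Qed.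

Let cB (f g : R -> R) : cpath f -> cpath g -> cpath (fun s => f s - g s).
Proof. by move=> cf cg; apply: cpathD => //; exact: cpathN. Qed.

Lemma Vrem_cpath y : cpath y ->
  cpath (fun s => V (a s + y s) - V (a s) - V^`(1) (a s) * y s).
Proof.
move=> cy; apply: cB; last by apply: cpathM => //; exact: cVa.
by apply: cB; [exact: (@cVay 0%N)|exact: (@cVa 0%N)].
Qed.

(** For [r * m <= rad] and [|dl| <= 1] all arguments of [V] and of its derivatives stay in a fixed
    compact set; [C] depends on that set, hence on [rad], but neither on the path nor on [r]. *)
Lemma path_expansion : exists2 C : R, 0 < C & forall (w : R -> R) (m r : R), cpath w ->
  (forall s, 0 <= s <= t -> `|w s| <= m) -> 0 < r -> r * m <= rad ->
  [/\ `|Vrem (fun s => r * w s) - (r ^+ 2 / 2 * \int[mu]_(s in `[0, t]) (V^`(2) (a s) * w s ^+ 2)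
        + r ^+ 3 / 6 * \int[mu]_(s in `[0, t]) (V^`(3) (a s) * w s ^+ 3))| <= C * (r * m) ^+ 4,
      `|V1rem (fun s => r * w s) - (r * \int[mu]_(s in `[0, t]) (V^`(2) (a s) * w s)
        + r ^+ 2 / 2 * \int[mu]_(s in `[0, t]) (V^`(3) (a s) * w s ^+ 2))| <= C * (r * m) ^+ 3,
      `|V1rem (fun s => r * w s)| <= C &
      forall dl, `|dl| <= 1 -> `|Vrem (fun s => dl + r * w s) - Vrem (fun s => r * w s)
          - dl * V1rem (fun s => r * w s)| <= C * dl ^+ 2].
Proof.
have [M M0 aM] := cpath_bounded ht ca.
have Mr : 0 < M + rad + 1 by rewrite !addr_gt0.
have [C C_gt0 HC] := potential_bounded hVderivable hVcontinuous Mr.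
have HCa k s y : (k <= 4)%N -> 0 <= s <= t -> `|y| <= rad + 1 -> `|V^`(k) (a s + y)| <= C.
  move=> k4 st yr; apply: HC => //.
  by rewrite (le_trans (ler_normD _ _))// -addrA lerD// aM.
exists (C * t + C * t + C * t).
  by rewrite !addr_gt0// mulr_gt0.
move=> w m r cw wm r0 rm.
have m0 : 0 <= m by rewrite (le_trans _ (wm 0 _))// lexx ltW.
have Ct : 0 < C * t by rewrite mulr_gt0.
have bump x : 0 <= x -> C * x * t <= (C * t + C * t + C * t) * x.
  by move=> x0; have := mulr_ge0 (ltW Ct) x0; nra.
have rw s : 0 <= s <= t -> `|r * w s| <= r * m.
  by move=> st; rewrite normrM gtr0_norm// ler_pM2l// wm.
have rwrad s : 0 <= s <= t -> `|r * w s| <= rad by move=> st; rewrite (le_trans (rw s st)).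
have crw : cpath (fun s => r * w s) by exact: cZ.
have rm0 : 0 <= r * m by rewrite mulr_ge0// ltW.
split.
- rewrite -!cpath_intZ//; last 2 first.
  + by apply: cpathM; [exact: cVa|exact: cpathX].
  + by apply: cpathM; [exact: cVa|exact: cpathX].
  have c2 : cpath (fun s => r ^+ 2 / 2 * (V^`(2) (a s) * w s ^+ 2)).
    by apply: cZ; apply: cpathM; [exact: cVa|exact: cpathX].
  have c3 : cpath (fun s => r ^+ 3 / 6 * (V^`(3) (a s) * w s ^+ 3)).
    by apply: cZ; apply: cpathM; [exact: cVa|exact: cpathX].
  rewrite -cpath_intD// -cpath_intB//; [|exact: Vrem_cpath|exact: cpathD].
  apply: le_trans (bump _ (exprn_ge0 4 rm0)); apply: cpath_int_bound => //.
    by apply: cB; [exact: Vrem_cpath|exact: cpathD].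
  move=> s st.
  have := @taylor_rem4 R (fun k => V^`(k)) 4 C rad dV 0 (a s) isT _ (r * w s) (rwrad s st).
  rewrite derive1n0 => /(_ (fun y yr => HCa 4%N s y isT st (le_trans yr _))) h.
  have e (x k2 k3 z : R) : x - (r ^+ 2 / 2 * (k2 * z ^+ 2) + r ^+ 3 / 6 * (k3 * z ^+ 3)) =
      x - k2 / 2 * (r * z) ^+ 2 - k3 / 6 * (r * z) ^+ 3 by field.
  rewrite (e _ (V^`(2) (a s)) (V^`(3) (a s)) (w s)).
  apply: le_trans (h _) _; first by rewrite lerDl.
  by rewrite ler_pM2l// lerXn2r ?nnegrE// rw.
- rewrite -!cpath_intZ//; last 2 first.
  + by apply: cpathM; [exact: cVa|exact: cpathX].
  + by apply: cpathM; [exact: cVa|].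
  have c1 : cpath (fun s => r * (V^`(2) (a s) * w s)).
    by apply: cZ; apply: cpathM; [exact: cVa|].
  have c2 : cpath (fun s => r ^+ 2 / 2 * (V^`(3) (a s) * w s ^+ 2)).
    by apply: cZ; apply: cpathM; [exact: cVa|exact: cpathX].
  have cd : cpath (fun s => V^`(1) (a s + r * w s) - V^`(1) (a s)).
    by apply: cB; [exact: cVay|exact: cVa].
  rewrite -cpath_intD// -cpath_intB//; last exact: cpathD.
  apply: le_trans (bump _ (exprn_ge0 3 rm0)); apply: cpath_int_bound => //.
    by apply: cB => //; exact: cpathD.
  move=> s st.
  have := @taylor_rem3 R (fun k => V^`(k)) 4 C rad dV 1 (a s) isT _ (r * w s) (rwrad s st).
  move=> /(_ (fun y yr => HCa 4%N s y isT st (le_trans yr _))) h.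
  have e (x k2 k3 z : R) : x - (r * (k2 * z) + r ^+ 2 / 2 * (k3 * z ^+ 2)) =
      x - k2 * (r * z) - k3 / 2 * (r * z) ^+ 2 by field.
  rewrite (e _ (V^`(2) (a s)) (V^`(3) (a s)) (w s)).
  apply: le_trans (h _) _; first by rewrite lerDl.
  by rewrite ler_pM2l// lerXn2r ?nnegrE// rw.
- apply: (@le_trans _ _ ((C + C) * t)); last by lra.
  apply: (cpath_int_bound ht); first by apply: cB; [exact: cVay|exact: cVa].
  move=> s st; rewrite (le_trans (ler_normB _ _))// lerD// ?HCa//.
    by rewrite (le_trans (rwrad s st))// lerDl.
  by rewrite -[a s]addr0 HCa// normr0 addr_ge0// ltW.
- move=> dl dl1.
  have cdl : cpath (fun s => dl + r * w s) by apply: cpathD => //; exact: cpath_cst.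
  have cV1 : cpath (fun s => V^`(1) (a s + r * w s) - V^`(1) (a s)).
    by apply: cB; [exact: cVay|exact: cVa].
  pose F1 s := V (a s + (dl + r * w s)) - V (a s) - V^`(1) (a s) * (dl + r * w s).
  pose F2 s := V (a s + r * w s) - V (a s) - V^`(1) (a s) * (r * w s).
  have c1 : cpath F1 by exact: Vrem_cpath.
  have c2 : cpath F2 by exact: Vrem_cpath.
  have c12 : cpath (fun s => F1 s - F2 s) by exact: cB.
  have c3 : cpath (fun s => dl * (V^`(1) (a s + r * w s) - V^`(1) (a s))) by exact: cZ.
  rewrite -cpath_intZ// -[Vrem _ - _](@cpath_intB _ t F1 F2 c1 c2).
  rewrite -(cpath_intB c12 c3).
  apply: le_trans (bump _ (sqr_ge0 dl)); apply: cpath_int_bound => //; first exact: cB.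
  move=> s st.
  have := @taylor_rem2 R (fun k => V^`(k)) 4 C 1 dV 0 (a s + r * w s) isT _ dl dl1.
  have H y : `|y| <= 1 -> `|V^`(2) (a s + r * w s + y)| <= C.
    move=> y1; rewrite -addrA HCa// (le_trans (ler_normD _ _))// lerD//.
    exact: rwrad.
  rewrite derive1n0 => /(_ H); rewrite real_normK ?num_real// => h.
  have -> : V (a s + (dl + r * w s)) - V (a s) - V^`(1) (a s) * (dl + r * w s) -
     (V (a s + r * w s) - V (a s) - V^`(1) (a s) * (r * w s)) -
     dl * (V^`(1) (a s + r * w s) - V^`(1) (a s)) =
     V (a s + r * w s + dl) - V (a s + r * w s) - V^`(1) (a s + r * w s) * dl.
    by rewrite (_ : a s + (dl + r * w s) = a s + r * w s + dl); ring.
  exact: h.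
Qed.

End path_expansion.

(** * Pointwise estimates for the difference quotient *)

Section exponential_estimates.
Context (R : realType).
Implicit Types x y : R.

Lemma expRN_lip x y : 0 <= x -> 0 <= y -> `|expR (- x) - expR (- y)| <= `|x - y|.
Proof.
wlog xy : x y / x <= y.
  move=> wl x0 y0; have [xy|xy] := leP x y; first exact: wl.
  by rewrite distrC [leRHS]distrC wl// ltW.
move=> x0 y0.
rewrite ger0_norm ?subr_ge0 ?ler_expR ?lerN2// ler0_norm ?subr_le0// opprB.
have -> : expR (- y) = expR (- x) * expR (- (y - x)) by rewrite -expRD; congr expR; ring.
have h1 : expR (- x) <= 1 by rewrite -[leRHS]expR0 ler_expR oppr_le0.
have h2 := expR_ge1Dx (- (y - x)).
have h3 := expR_gt0 (- x).
have h4 : 0 <= y - x by rewrite subr_ge0.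
nra.
Qed.

(** Convexity used twice: the tangent at [y] makes the left side nonnegative, and the tangent at [x]
    bounds it by (x - y)(exp(-y) - exp(-x)), to which the Lipschitz bound applies. *)
Lemma expRN_rem x y : 0 <= x -> 0 <= y ->
  `|expR (- x) - expR (- y) + (x - y) * expR (- y)| <= (x - y) ^+ 2.
Proof.
move=> x0 y0; have lip := expRN_lip x0 y0.
have e1 : expR (- x) = expR (- y) * expR (- (x - y)) by rewrite -expRD; congr expR; ring.
have e2 : expR (- y) = expR (- x) * expR (- (y - x)) by rewrite -expRD; congr expR; ring.
have h1 := expR_ge1Dx (- (x - y)); have h2 := expR_ge1Dx (- (y - x)).
have p1 := expR_gt0 (- x); have p2 := expR_gt0 (- y).
have lo : expR (- y) * (1 - (x - y)) <= expR (- x) by rewrite e1 ler_pM2l.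
have hi : expR (- x) * (1 - (y - x)) <= expR (- y) by rewrite e2 ler_pM2l.
rewrite ger0_norm; last by lra.
have h5 : (x - y) * (expR (- y) - expR (- x)) <= `|x - y| * `|x - y|.
  apply: le_trans (ler_norm _) _; rewrite normrM ler_wpM2l// distrC//.
have h6 : `|x - y| * `|x - y| = (x - y) ^+ 2 by rewrite -expr2 real_normK ?num_real.
lra.
Qed.

Lemma expRN_le1 x : 0 <= x -> `|expR (- x)| <= 1.
Proof. by move=> x0; rewrite ger0_norm ?expR_ge0// -[leRHS]expR0 ler_expR oppr_le0. Qed.

Lemma norm_le_mul (A a B b : R) : `|A| <= a -> `|B| <= b -> `|A * B| <= a * b.
Proof. by move=> Aa Bb; rewrite normrM ler_pM. Qed.

(* [X], [Xd]: rescaled potentials at [r w] and [dl + r w]; [E2], [K3], [G1], [G2]: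
   the Taylor coefficients of [X] and of the shift derivative [B]. *)
Lemma quotient_estimate (C n r dl G1 G2 K3 E2 X Xd B : R) :
  1 <= C -> 1 <= n -> 0 < r -> r <= 1 -> dl != 0 -> `|dl| <= 1 ->
  0 <= E2 -> 0 <= X -> 0 <= Xd ->
  `|G1| <= C * n -> `|G2| <= C * n ^+ 2 -> `|K3| <= C * n ^+ 3 ->
  `|X - (E2 + r / 6 * K3)| <= C * r ^+ 2 * n ^+ 4 ->
  `|r ^- 2 * B - (r^-1 * G1 + 2^-1 * G2)| <= C * r * n ^+ 3 ->
  `|B| <= C -> `|Xd - X - dl * (r ^- 2 * B)| <= C * dl ^+ 2 * r ^- 2 ->
  `|expR (- X) - expR (- E2)| <= 2 * C * r * n ^+ 9 /\
  `|(expR (- Xd) - expR (- X)) / dl + r^-1 * (G1 * expR (- E2))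
    - (6^-1 * G1 * K3 - 2^-1 * G2) * expR (- E2)|
    <= 7 * C ^+ 3 * (`|dl| * r ^- 4) + 7 * C ^+ 3 * (r * n ^+ 9).
Proof.
move=> C1 n1 r0 r1 dl0 dl1 E0 X0 Xd0 HG1 HG2 HK3 HX HB B_le HXd.
have C0 : 0 <= C by lra.
have n0 : 0 <= n by lra.
have np k : 0 <= n ^+ k by rewrite exprn_ge0.
have nmon k : (k <= 9)%N -> n ^+ k <= n ^+ 9 by move=> k9; rewrite ler_weXn2l.
have rV : 1 <= r^-1 by rewrite invf_ge1.
have r0' : r != 0 by rewrite gt_eqF.
have XE : `|X - E2| <= 2 * C * r * n ^+ 4.
  have -> : X - E2 = (X - (E2 + r / 6 * K3)) + r / 6 * K3 by ring.
  rewrite (le_trans (ler_normD _ _))//.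
  have h1 : `|r / 6 * K3| <= r * (C * n ^+ 3).
    rewrite normrM gtr0_norm ?divr_gt0//; apply: ler_pM => //; first by rewrite divr_ge0// ltW.
    by rewrite ler_pdivrMr//; lra.
  have h2 : n ^+ 3 <= n ^+ 4 by rewrite ler_weXn2l.
  have h3 : C * r ^+ 2 * n ^+ 4 <= C * r * n ^+ 4.
    by rewrite ler_wpM2r// ler_wpM2l// expr2 ler_piMr// ltW.
  have h4 : r * (C * n ^+ 3) <= C * r * n ^+ 4.
    by rewrite mulrA [r * C]mulrC ler_wpM2l// mulr_ge0// ltW.
  lra.
have lipXE : `|expR (- X) - expR (- E2)| <= 2 * C * r * n ^+ 4.
  by apply: le_trans XE; exact: expRN_lip.
split.
  apply: le_trans lipXE _; rewrite ler_wpM2l ?nmon// !mulr_ge0//; lra.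
have eX := expRN_le1 X0; have eE := expRN_le1 E0.
(* The first-order error in [dl]. It is quadratic in [Xd - X], which is of order [|dl| * r ^- 2];
   division by [dl] leaves [|dl| * r ^- 4]. *)
pose D := (expR (- Xd) - expR (- X)) / dl + r ^- 2 * B * expR (- X).
have HD : `|D| <= 5 * C ^+ 2 * (`|dl| * r ^- 4).
  have -> : D = ((expR (- Xd) - expR (- X) + (Xd - X) * expR (- X))
      - (Xd - X - dl * (r ^- 2 * B)) * expR (- X)) / dl.
    by rewrite /D; field; rewrite dl0 r0'.
  have dl_gt0 : 0 < `|dl| by rewrite normr_gt0.
  rewrite normrM normfV ler_pdivrMr//.
  have r2V : 1 <= r ^- 2 by rewrite invf_ge1 ?exprn_gt0// exprn_ile1// ltW.
  have r4 : r ^- 4 = r ^- 2 * r ^- 2 by rewrite -invfM -exprD.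
  have dl2 : `|dl| * `|dl| = dl ^+ 2 by rewrite -expr2 real_normK ?num_real.
  have XdX : `|Xd - X| <= 2 * C * `|dl| * r ^- 2.
    have -> : Xd - X = (Xd - X - dl * (r ^- 2 * B)) + dl * (r ^- 2 * B) by ring.
    rewrite (le_trans (ler_normD _ _))//.
    have h1 : `|dl * (r ^- 2 * B)| <= `|dl| * (r ^- 2 * C).
      apply: norm_le_mul => //; apply: norm_le_mul => //.
      by rewrite ger0_norm// invr_ge0 exprn_ge0// ltW.
    have h2 : C * dl ^+ 2 * r ^- 2 <= C * `|dl| * r ^- 2.
      rewrite ler_wpM2r ?invr_ge0 ?exprn_ge0 ?(ltW r0)// ler_wpM2l// -dl2.
      by rewrite ler_piMr.
    lra.
  have sq : (Xd - X) ^+ 2 <= (2 * C * `|dl| * r ^- 2) ^+ 2.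
    by rewrite -real_normK ?num_real// lerXn2r ?nnegrE// (le_trans _ XdX).
  rewrite (le_trans (ler_normB _ _))//.
  have h3 := le_trans (expRN_rem Xd0 X0) sq.
  have h4 := norm_le_mul HXd eX.
  rewrite mulr1 in h4.
  have h5 : (2 * C * `|dl| * r ^- 2) ^+ 2 = 4 * C ^+ 2 * (dl ^+ 2 * r ^- 4).
    by rewrite -dl2 r4; ring.
  have h6 : C * dl ^+ 2 * r ^- 2 <= C ^+ 2 * (dl ^+ 2 * r ^- 4).
    rewrite -mulrA ler_pM//.
    - by rewrite mulr_ge0 ?sqr_ge0// ?invr_ge0 exprn_ge0// ltW.
    - by rewrite expr2 ler_peMr.
    - by rewrite ler_wpM2l ?sqr_ge0// r4 ler_peMr// (le_trans ler01).
  have -> : 5 * C ^+ 2 * (`|dl| * r ^- 4) * `|dl| = 5 * C ^+ 2 * (dl ^+ 2 * r ^- 4).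
    by rewrite -dl2; ring.
  lra.
(* Since [G1] carries the factor [r^-1], exp(-X) must be expanded around [E2] to first order there:
   [r / 6 * K3] then yields the product of [G1] and [K3] in the limit. The third term, with [G1]
   times the square of an error in n^4, is the origin of the power 9. *)
have -> : (expR (- Xd) - expR (- X)) / dl + r^-1 * (G1 * expR (- E2))
    - (6^-1 * G1 * K3 - 2^-1 * G2) * expR (- E2) =
  D - (r ^- 2 * B - (r^-1 * G1 + 2^-1 * G2)) * expR (- X)
  - r^-1 * (G1 * (expR (- X) - expR (- E2) + (X - E2) * expR (- E2)))
  + r^-1 * (G1 * ((X - (E2 + r / 6 * K3)) * expR (- E2)))
  - 2^-1 * (G2 * (expR (- X) - expR (- E2))).
  by rewrite /D; field; rewrite dl0 r0'.
have rVn : `|r^-1| <= r^-1 by rewrite ger0_norm// invr_ge0 ltW.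
have b1 := norm_le_mul HB eX.
have sqXE : (X - E2) ^+ 2 <= (2 * C * r * n ^+ 4) ^+ 2.
  by rewrite -real_normK ?num_real// lerXn2r ?nnegrE// (le_trans _ XE).
have b2 := norm_le_mul rVn (norm_le_mul HG1 (le_trans (expRN_rem X0 E0) sqXE)).
have b3 := norm_le_mul rVn (norm_le_mul HG1 (norm_le_mul HX eE)).
have half : `|2^-1 : R| <= 2^-1 by rewrite ger0_norm// invr_ge0.
have b4 := norm_le_mul half (norm_le_mul HG2 lipXE).
apply: le_trans (ler_normB _ _) _.
apply: (@le_trans _ _ (5 * C ^+ 2 * (`|dl| * r ^- 4) + C * r * n ^+ 3 * 1
  + r^-1 * (C * n * (2 * C * r * n ^+ 4) ^+ 2)
  + r^-1 * (C * n * (C * r ^+ 2 * n ^+ 4 * 1))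
  + 2^-1 * (C * n ^+ 2 * (2 * C * r * n ^+ 4)))).
  apply: lerD => //; apply: le_trans (ler_normD _ _) _.
  apply: lerD => //; apply: le_trans (ler_normB _ _) _.
  apply: lerD => //; apply: le_trans (ler_normB _ _) _.
  exact: lerD.
have e2 : r^-1 * (C * n * (2 * C * r * n ^+ 4) ^+ 2) = 4 * C ^+ 3 * (r * n ^+ 9).
  by field.
have e3 : r^-1 * (C * n * (C * r ^+ 2 * n ^+ 4 * 1)) = C ^+ 2 * (r * n ^+ 5).
  by field.
have e4 : 2^-1 * (C * n ^+ 2 * (2 * C * r * n ^+ 4)) = C ^+ 2 * (r * n ^+ 6).
  by field.
rewrite e2 e3 e4 mulr1.
have C2 : C ^+ 2 <= C ^+ 3 by rewrite ler_weXn2l.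
have C13 : C <= C ^+ 3 by rewrite -[leLHS]expr1 ler_weXn2l.
have f k : (k <= 9)%N -> r * n ^+ k <= r * n ^+ 9 by move=> k9; rewrite ler_pM2l// nmon.
have f3 := f 3%N isT; have f5 := f 5%N isT; have f6 := f 6%N isT.
have rn9 : 0 <= r * n ^+ 9 by rewrite mulr_ge0// ltW.
have rn3 : 0 <= r * n ^+ 3 by rewrite mulr_ge0// ltW.
have rn5 : 0 <= r * n ^+ 5 by rewrite mulr_ge0// ltW.
have rn6 : 0 <= r * n ^+ 6 by rewrite mulr_ge0// ltW.
have dr : 0 <= `|dl| * r ^- 4 by rewrite mulr_ge0// invr_ge0 exprn_ge0// ltW.
have C3 : 0 <= C ^+ 3 by rewrite exprn_ge0.
have C20 : 0 <= C ^+ 2 by rewrite exprn_ge0.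
have g1 : C * r * n ^+ 3 <= C ^+ 3 * (r * n ^+ 9) by rewrite -mulrA ler_pM.
have g2 : C ^+ 2 * (r * n ^+ 5) <= C ^+ 3 * (r * n ^+ 9) by rewrite ler_pM.
have g3 : C ^+ 2 * (r * n ^+ 6) <= C ^+ 3 * (r * n ^+ 9) by rewrite ler_pM.
have g4 : 5 * C ^+ 2 * (`|dl| * r ^- 4) <= 7 * C ^+ 3 * (`|dl| * r ^- 4).
  by rewrite ler_wpM2r//; lra.
lra.
Qed.

End exponential_estimates.

Section path_integral_measurability.
Context (R : realType) d (T : measurableType d) (t : R) (ht : 0 < t).
Notation cpath f := {within `[0, t], continuous f}.
Notation mu := (@lebesgue_measure R).

Lemma measurable_path_integral (f : R -> T -> R) :
  (forall w, cpath (fun s => f s w)) ->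
  (forall s, measurable_fun [set: T] (f s)) ->
  measurable_fun [set: T] (fun w => \int[mu]_(s in `[0, t]) f s w).
Proof.
move=> cf mf.
apply: (@measurable_fun_cvg _ _ _ setT (fun n w => rsum t n (fun k => f (grid t n k) w))) => //.
- move=> n; apply: measurable_funM => //; exact: measurable_sum.
- move=> w _; apply: (@rsum_cvg _ t ht (fun n k => f (grid t n k) w) (fun s => f s w)) => //.
  exact: (@grid_cvg_refl _ t (fun s => f s w)).
Qed.

End path_integral_measurability.

Lemma Rintegral_prob_cst (R : realType) d (T : measurableType d) (P : probability T R) (c : R) :
  \int[P]_(_ in setT) c = c.
Proof. by rewrite Rintegral_cst//= (@probability_setT _ _ _ P) mulr1. Qed.

Section real_integrability.
Context d (T : measurableType d) (R : realType) (mu : {measure set T -> \bar R}).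
Variables (D : set T) (mD : measurable D).
Implicit Types f g : T -> R.

Lemma integrable_addr f g : mu.-integrable D (EFin \o f) -> mu.-integrable D (EFin \o g) ->
  mu.-integrable D (EFin \o (fun w => f w + g w)).
Proof. by move=> fi gi; exact: (integrableD mD fi gi). Qed.

Lemma integrable_subr f g : mu.-integrable D (EFin \o f) -> mu.-integrable D (EFin \o g) ->
  mu.-integrable D (EFin \o (fun w => f w - g w)).
Proof. by move=> fi gi; exact: (integrableB mD fi gi). Qed.

Lemma integrable_mulrl (c : R) f : mu.-integrable D (EFin \o f) ->
  mu.-integrable D (EFin \o (fun w => c * f w)).
Proof. by move=> fi; exact: (integrableZl mD c fi). Qed.

End real_integrability.

Lemma expRN_dist_le1 (R : realType) (x y : R) : 0 <= x -> 0 <= y ->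
  `|expR (- x) - expR (- y)| <= 1.
Proof.
move=> x0 y0; have := expRN_le1 x0; have := expRN_le1 y0.
rewrite (ger0_norm (expR_ge0 (- x))) (ger0_norm (expR_ge0 (- y))) ler_norml.
have := expR_ge0 (- x); have := expR_ge0 (- y) => *; apply/andP; split; lra.
Qed.

(** * The expectation of the shifted functional and its difference quotients *)

Section core.
Context (R : realType) d (T : measurableType d) (P : probability T R)
  (W : R -> {RV P >-> R}) (hW : standard_wiener W) (t : R) (ht : 0 < t).
Notation cpath f := {within `[0, t], continuous f}.
Notation mu := (@lebesgue_measure R).
Variable V : R -> R.
Hypothesis hVderivable : forall k : nat, (k < 4)%N -> forall x, derivable V^`(k) x 1.
Hypothesis hVcontinuous : continuous V^`(4).
Hypothesis hVconvex : forall x, 0 <= V^`(2) x.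
Variables (a : R -> R) (rad : R).
Hypothesis ca : cpath a.
Hypothesis rad0 : 0 < rad.

Let wcpath w : cpath (fun s => W s w). Proof. exact: wiener_cpath. Qed.
Let cV k : (k <= 4)%N -> continuous V^`(k) := potential_continuous hVderivable hVcontinuous (k := k).
Let cVa k : (k <= 4)%N -> cpath (fun s => V^`(k) (a s)).
Proof. by move=> k4; apply: cpath_comp => //; exact: cV. Qed.

(** With [a] the path [phi] moved by [q]: [energy2] is - F''(W, W)/2, [linear1] is G'(W), [vint 3 2]
    is G''(W, W) and [vint 3 3] is - F'''(W, W, W). For r = sqrt h, [rescaled r dl] is the
    nonnegative remainder at [dl + r * W] divided by h. *)
Definition vint k j w := \int[mu]_(s in `[0, t]) (V^`(k) (a s) * W s w ^+ j).
Definition energy2 w := (vint 2 2 w + W t w ^+ 2) / 2.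
Definition linear1 w := \int[mu]_(s in `[0, t]) (V^`(2) (a s) * W s w) + W t w.
Definition rescaled r dl w :=
  r ^- 2 * (Vrem V t a (fun s => dl + r * W s w) + (dl + r * W t w) ^+ 2 / 2).

Let cvint k j w : (k <= 4)%N -> cpath (fun s => V^`(k) (a s) * W s w ^+ j).
Proof. by move=> k4; apply: cpathM; [exact: cVa|exact: cpathX]. Qed.

Let mvint k j : (k <= 4)%N -> measurable_fun [set: T] (vint k j).
Proof.
move=> k4; apply: (@measurable_path_integral _ _ _ t ht (fun s w => V^`(k) (a s) * W s w ^+ j)).
  by move=> w; exact: cvint.
by move=> s; apply: measurable_funM => //; exact: measurable_funX.
Qed.

Let menergy2 : measurable_fun [set: T] energy2.
Proof.
apply: measurable_funM => //; apply: measurable_funD; first exact: mvint.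
exact: measurable_funX.
Qed.

Let mlinear1 : measurable_fun [set: T] linear1.
Proof.
apply: measurable_funD => //.
apply: (@measurable_path_integral _ _ _ t ht (fun s w => V^`(2) (a s) * W s w)).
  by move=> w; apply: cpathM; [exact: cVa|exact: wcpath].
by move=> s; exact: measurable_funM.
Qed.

Let crW r dl w : cpath (fun s => dl + r * W s w).
Proof.
apply: cpathD; first exact: cpath_cst.
by apply: cpathM => //; exact: cpath_cst.
Qed.

Let mrescaled r dl : measurable_fun [set: T] (rescaled r dl).
Proof.
apply: measurable_funM => //; apply: measurable_funD; last first.
  apply: measurable_funM => //; apply: measurable_funX; apply: measurable_funD => //.
  exact: measurable_funM.
apply: (@measurable_path_integral _ _ _ t ht (fun s w => V (a s + (dl + r * W s w)) - V (a s)
   - V^`(1) (a s) * (dl + r * W s w))).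
  by move=> w; exact: Vrem_cpath.
have m1 s : measurable_fun [set: T] (fun w => dl + r * W s w).
  by apply: measurable_funD => //; exact: measurable_funM.
move=> s; apply: measurable_funB; last exact: measurable_funM.
apply: measurable_funB => //; apply: measurableT_comp; last exact: measurable_funD.
by apply: continuous_measurable_fun; exact: (cV (k := 0)).
Qed.

Lemma Vrem_ge0 y : cpath y -> 0 <= Vrem V t a y.
Proof.
move=> cy; rewrite -[leLHS](mul0r t) -(int_cst ht); apply: cpath_int_le => //.
- exact: cpath_cst.
- exact: Vrem_cpath.
- move=> s _; have := convex_tangent hVderivable hVconvex (a s) (y s); lra.
Qed.

Lemma rescaled_ge0 r dl w : 0 < r -> 0 <= rescaled r dl w.
Proof.
move=> r0; apply: mulr_ge0; first by rewrite invr_ge0 exprn_ge0// ltW.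
by rewrite addr_ge0 ?divr_ge0 ?sqr_ge0//; exact: Vrem_ge0.
Qed.

Lemma energy2_ge0 w : 0 <= energy2 w.
Proof.
rewrite divr_ge0// addr_ge0 ?sqr_ge0// -[leLHS](mul0r t) -(int_cst ht).
apply: cpath_int_le => //; [exact: cpath_cst|exact: cvint|].
by move=> s _; rewrite mulr_ge0 ?sqr_ge0.
Qed.

(* [K0c] is K_0^*, and [kappa] is minus the part of [K1bar] without the factor G. *)
Definition Ph r dl := \int[P]_w expR (- rescaled r dl w).
Definition K0c := \int[P]_w expR (- energy2 w).
Definition kappa := \int[P]_w
  ((6^-1 * linear1 w * vint 3 3 w - 2^-1 * vint 3 2 w) * expR (- energy2 w)).

Let bounded_integrable (f : T -> R) : measurable_fun [set: T] f ->
  (forall w, `|f w| <= 1) -> P.-integrable setT (EFin \o f).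
Proof.
move=> mf f1.
have i1 : P.-integrable setT (EFin \o (fun=> 1)) by exact: finite_measure_integrable_cst.
apply: (le_integrable measurableT _ _ i1) => //; first exact/measurable_EFinP.
by move=> w _ /=; rewrite lee_fin normr1.
Qed.

Lemma integrable_rescaled r dl : 0 < r ->
  P.-integrable setT (EFin \o (fun w => expR (- rescaled r dl w))).
Proof.
move=> r0; apply: bounded_integrable.
  by apply: measurableT_comp => //; apply: measurableT_comp.
by move=> w; apply: expRN_le1; exact: rescaled_ge0.
Qed.

Lemma integrable_energy2 : P.-integrable setT (EFin \o (fun w => expR (- energy2 w))).
Proof.
apply: bounded_integrable.
  by apply: measurableT_comp => //; apply: measurableT_comp.
by move=> w; apply: expRN_le1; exact: energy2_ge0.
Qed.

Lemma integrable_linear1 :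
  P.-integrable setT (EFin \o (fun w => linear1 w * expR (- energy2 w))) /\
  \int[P]_w (linear1 w * expR (- energy2 w)) = 0.
Proof.
have [] := wiener_odd hW ht (cVa (k := 2) isT) (fun s _ => hVconvex (a s)).
by move=> i e; split; [exact: i|rewrite /Rintegral [X in fine X]e].
Qed.

Section with_sup.
Variable Y : T -> R.
Hypothesis mY : measurable_fun [set: T] Y.
Hypothesis WY : forall w s, 0 <= s <= t -> `|W s w| <= Y w.
Hypothesis expY : forall th, 0 < th ->
  (\int[P]_w (expR (th * Y w))%:E <= (256 * expR (8 * th ^+ 2 * t))%:E)%E.

Let Y0 w : 0 <= Y w.
Proof. by rewrite (le_trans _ (@WY w 0 _))// lexx ltW. Qed.

Let integrable_expY th : 0 < th -> P.-integrable setT (EFin \o (fun w => expR (th * Y w))).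
Proof.
move=> th0; apply/integrableP; split.
  by apply/measurable_EFinP; apply: measurableT_comp => //; exact: measurable_funM.
under eq_integral do rewrite /= ger0_norm ?expR_ge0//.
exact: le_lt_trans (expY th0) (ltry _).
Qed.

Let int_expY th : 0 < th -> \int[P]_w expR (th * Y w) <= 256 * expR (8 * th ^+ 2 * t).
Proof.
move=> th0; rewrite -lee_fin fineK; first exact: expY.
exact: (integrable_fin_num measurableT (integrable_expY th0)).
Qed.

Let pow_expY j w : (1 + Y w) ^+ j <= expR (j%:R * Y w).
Proof.
rewrite mulrC expRM_natr lerXn2r// ?nnegrE ?expR_ge0 ?addr_ge0//.
exact: expR_ge1Dx.
Qed.

Let vint_bound : exists2 C : R, 1 <= C & forall w,
  [/\ `|linear1 w| <= C * (1 + Y w), `|vint 3 2 w| <= C * (1 + Y w) ^+ 2 &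
      `|vint 3 3 w| <= C * (1 + Y w) ^+ 3].
Proof.
have [C2 C20 H2] := cpath_bounded ht (cVa (k := 2) isT).
have [C3 C30 H3] := cpath_bounded ht (cVa (k := 3) isT).
have C2t : 0 < C2 * t by rewrite mulr_gt0.
have C3t : 0 < C3 * t by rewrite mulr_gt0.
exists (1 + C2 * t + C3 * t) => [|w]; first by lra.
have Yw := Y0 w.
have H j s : 0 <= s <= t -> `|W s w ^+ j| <= (1 + Y w) ^+ j.
  move=> st; rewrite normrX lerXn2r ?nnegrE ?addr_ge0//.
  by rewrite (le_trans (WY w st))// lerDr.
have p2 : 0 <= (1 + Y w) ^+ 2 by rewrite exprn_ge0// addr_ge0.
have p3 : 0 <= (1 + Y w) ^+ 3 by rewrite exprn_ge0// addr_ge0.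
have tt : 0 <= t <= t by rewrite lexx ltW.
have h1 : `|\int[mu]_(s in `[0, t]) (V^`(2) (a s) * W s w)| <= C2 * (1 + Y w) * t.
  apply: cpath_int_bound => //; first by apply: cpathM; [exact: cVa|exact: wcpath].
  by move=> s st; have := norm_le_mul (H2 s st) (H 1%N s st); rewrite !expr1.
have h2 : `|vint 3 2 w| <= C3 * (1 + Y w) ^+ 2 * t.
  apply: cpath_int_bound => //; first exact: cvint.
  by move=> s st; exact: norm_le_mul (H3 s st) (H 2%N s st).
have h3 : `|vint 3 3 w| <= C3 * (1 + Y w) ^+ 3 * t.
  apply: cpath_int_bound => //; first exact: cvint.
  by move=> s st; exact: norm_le_mul (H3 s st) (H 3%N s st).
split.
- rewrite (le_trans (ler_normD _ _))//.
  by have := WY w tt; have := mulr_ge0 (ltW C3t) Yw; nra.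
- by have := mulr_ge0 (ltW C2t) p2; nra.
- by have := mulr_ge0 (ltW C2t) p3; nra.
Qed.

(** The singular term in [r^-1] may be added because its expectation is zero by parity; only after
    this addition is the integrand small. *)
Let diffq r dl w := (expR (- rescaled r dl w) - expR (- rescaled r 0 w)) / dl
  + r^-1 * (linear1 w * expR (- energy2 w))
  - (6^-1 * linear1 w * vint 3 3 w - 2^-1 * vint 3 2 w) * expR (- energy2 w).

Let pathwise_small : exists2 K : R, 0 < K & forall r dl w, 0 < r -> r <= 1 -> dl != 0 ->
  `|dl| <= 1 -> r * Y w <= rad ->
  `|expR (- rescaled r 0 w) - expR (- energy2 w)| <= K * (r * expR (9 * Y w)) /\
  `|diffq r dl w| <= K * (`|dl| * r ^- 4) + K * (r * expR (9 * Y w)).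
Proof.
have rad_gt0 := rad0; have t_gt0 := ht.
have [C1 C1_ge1 H1] := vint_bound.
have [C2 C2_gt0 H2] := path_expansion ht hVderivable hVcontinuous ca rad0.
pose C := 1 + C1 + C2 + rad.
have C_ge1 : 1 <= C by rewrite /C; lra.
have CC1 : C1 <= C by rewrite /C; lra.
have CC2 : C2 + 1 <= C by rewrite /C; lra.
have C2C : C2 <= C by lra.
have CC : rad + C2 <= C by rewrite /C; lra.
have C_ge0 : 0 <= C by lra.
exists (7 * C ^+ 3); first by rewrite mulr_gt0// exprn_gt0//; lra.
move=> r dl w r0 r1 dl0 dl1 rY.
have [G1b G2b K3b] := H1 w.
have [h1 h2 h3 h4] := H2 _ (Y w) r (@wcpath w) (WY w) r0 rY.
have Yw := Y0 w.
have n1 : 1 <= 1 + Y w by rewrite lerDl.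
have np j : 0 <= (1 + Y w) ^+ j by rewrite exprn_ge0// addr_ge0.
have Ynj j : Y w ^+ j <= (1 + Y w) ^+ j by rewrite lerXn2r ?nnegrE ?addr_ge0// lerDr.
have r2V : 0 <= r ^- 2 by rewrite invr_ge0 exprn_ge0// ltW.
have r0' : r != 0 by rewrite gt_eqF.
have tt : 0 <= t <= t by rewrite lexx ltW.
have X00 : Vrem V t a (fun s => 0 + r * W s w) = Vrem V t a (fun s => r * W s w).
  by congr (Vrem V t a _); apply/funext => s; rewrite add0r.
have HX : `|rescaled r 0 w - (energy2 w + r / 6 * vint 3 3 w)| <= C * r ^+ 2 * (1 + Y w) ^+ 4.
  have -> : rescaled r 0 w - (energy2 w + r / 6 * vint 3 3 w) = r ^- 2 *
    (Vrem V t a (fun s => r * W s w) - (r ^+ 2 / 2 * vint 2 2 w + r ^+ 3 / 6 * vint 3 3 w)).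
    by rewrite /rescaled /energy2 X00 add0r; field.
  rewrite normrM ger0_norm//; apply: le_trans (ler_wpM2l r2V h1) _.
  have -> : r ^- 2 * (C2 * (r * Y w) ^+ 4) = C2 * r ^+ 2 * Y w ^+ 4 by field.
  by rewrite ler_pM ?exprn_ge0 ?mulr_ge0 ?exprn_ge0 ?(ltW C2_gt0) ?(ltW r0)//
    ler_wpM2r ?exprn_ge0 ?(ltW r0).
pose B := V1rem V t a (fun s => r * W s w) + r * W t w.
have HB : `|r ^- 2 * B - (r^-1 * linear1 w + 2^-1 * vint 3 2 w)| <= C * r * (1 + Y w) ^+ 3.
  have -> : r ^- 2 * B - (r^-1 * linear1 w + 2^-1 * vint 3 2 w) = r ^- 2 *
    (V1rem V t a (fun s => r * W s w)
      - (r * \int[mu]_(s in `[0, t]) (V^`(2) (a s) * W s w) + r ^+ 2 / 2 * vint 3 2 w)).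
    by rewrite /B /linear1; field.
  rewrite normrM ger0_norm//; apply: le_trans (ler_wpM2l r2V h2) _.
  have -> : r ^- 2 * (C2 * (r * Y w) ^+ 3) = C2 * r * Y w ^+ 3 by field.
  by rewrite ler_pM ?exprn_ge0 ?mulr_ge0 ?(ltW C2_gt0) ?(ltW r0)//
    ler_wpM2r ?(ltW r0).
have B_le : `|B| <= C.
  rewrite (le_trans (ler_normD _ _))// addrC; apply: le_trans CC; apply: lerD => //.
  by rewrite normrM gtr0_norm// (le_trans _ rY)// ler_pM2l// WY.
have HXd : `|rescaled r dl w - rescaled r 0 w - dl * (r ^- 2 * B)| <= C * dl ^+ 2 * r ^- 2.
  have -> : rescaled r dl w - rescaled r 0 w - dl * (r ^- 2 * B) = r ^- 2 *
    ((Vrem V t a (fun s => dl + r * W s w) - Vrem V t a (fun s => r * W s w)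
      - dl * V1rem V t a (fun s => r * W s w)) + dl ^+ 2 / 2).
    by rewrite /rescaled /B X00 add0r; field.
  rewrite normrM ger0_norm// [leRHS]mulrC ler_wpM2l// (le_trans (ler_normD _ _))//.
  rewrite [`|dl ^+ 2 / 2|]ger0_norm ?divr_ge0 ?sqr_ge0//.
  apply: le_trans (lerD (h4 dl dl1) (lexx _)) _.
  apply: le_trans (ler_wpM2r (sqr_ge0 dl) CC2); rewrite mulrDl mul1r lerD2l.
  by rewrite ler_piMr ?sqr_ge0// invf_le1 ?ltr0n ?ler1n.
have G1c : `|linear1 w| <= C * (1 + Y w) by rewrite (le_trans G1b)// ler_wpM2r// addr_ge0.
have G2c : `|vint 3 2 w| <= C * (1 + Y w) ^+ 2 by rewrite (le_trans G2b)// ler_wpM2r.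
have K3c : `|vint 3 3 w| <= C * (1 + Y w) ^+ 3 by rewrite (le_trans K3b)// ler_wpM2r.
have [e1 e2] := quotient_estimate C_ge1 n1 r0 r1 dl0 dl1 (energy2_ge0 w)
  (rescaled_ge0 0 w r0) (rescaled_ge0 dl w r0) G1c G2c K3c HX HB B_le HXd.
have pe : r * (1 + Y w) ^+ 9 <= r * expR (9 * Y w) by rewrite ler_pM2l// pow_expY.
have C3 : 0 <= C ^+ 3 by rewrite exprn_ge0.
have CC3 : C <= C ^+ 3 by rewrite -[leLHS]expr1 ler_weXn2l.
have re0 : 0 <= r * expR (9 * Y w) by rewrite mulr_ge0 ?expR_ge0// ltW.
split.
  apply: le_trans e1 _; rewrite -mulrA; apply: ler_pM => //.
  - by rewrite mulr_ge0.
  - by rewrite mulr_ge0// ltW.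
  - by apply: ler_pM => //; rewrite ler_nat.
apply: le_trans e2 _; rewrite lerD2l ler_wpM2l//.
by rewrite mulr_ge0.
Qed.

(** Where [r * Y w > rad] no expansion is available. The difference quotient is then at most 1/|dl|,
    and a factor exp(th (Y - rad / r)) >= 1 is inserted; the remaining terms are brought to order
    [r] by powers of [r * Y w / rad], which exceeds 1. *)
Let pathwise : exists2 K : R, 0 < K & forall r dl th w, 0 < r -> r <= 1 -> dl != 0 ->
  `|dl| <= 1 -> 0 < th ->
  `|expR (- rescaled r 0 w) - expR (- energy2 w)| <= K * (r * expR (9 * Y w)) /\
  `|diffq r dl w| <= K * (`|dl| * r ^- 4) + K * (r * expR (9 * Y w))
     + `|dl|^-1 * expR (- (th * rad / r)) * expR (th * Y w).
Proof.
have [K1 K1_gt0 H1] := pathwise_small.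
have [C C_ge1 HC] := vint_bound.
(* One term for each quantity treated where [r * Y w > rad]: the difference of exponentials, the
   singular linear term, and the limit integrand. *)
pose K2 := rad^-1 + C / rad ^+ 2 + 2 * C ^+ 2 / rad.
have rV : 0 < rad^-1 by rewrite invr_gt0.
have C_gt0 : 0 < C by lra.
have c1 : 0 < C / rad ^+ 2 by rewrite divr_gt0// exprn_gt0.
have c2 : 0 < 2 * C ^+ 2 / rad by rewrite divr_gt0// mulr_gt0// exprn_gt0.
exists (K1 + K2); first by rewrite /K2 !addr_gt0.
move=> r dl th w r0 r1 dl0 dl1 th0.
have Yw := Y0 w.
have re0 : 0 <= r * expR (9 * Y w) by rewrite mulr_ge0 ?expR_ge0// ltW.
have dr : 0 <= `|dl| * r ^- 4 by rewrite mulr_ge0// invr_ge0 exprn_ge0// ltW.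
have last0 : 0 <= `|dl|^-1 * expR (- (th * rad / r)) * expR (th * Y w).
  by rewrite !mulr_ge0 ?expR_ge0// invr_ge0.
have K2_gt0 : 0 < K2 by rewrite /K2 !addr_gt0.
have [rY|rY] := leP (r * Y w) rad.
  have [e1 e2] := H1 r dl w r0 r1 dl0 dl1 rY.
  have m1 := mulr_ge0 (ltW K2_gt0) re0.
  have m2 := mulr_ge0 (ltW K2_gt0) dr.
  by split; lra.
have Yr : 1 <= r * Y w / rad by rewrite ler_pdivlMr// mul1r ltW.
have n0 : 0 <= 1 + Y w by rewrite addr_ge0.
have Yn : Y w <= 1 + Y w by rewrite lerDr.
have nmon j : (j <= 9)%N -> (1 + Y w) ^+ j <= expR (9 * Y w).
  move=> j9; apply: le_trans (pow_expY 9 w).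
  by rewrite ler_weXn2l// lerDl.
have Yrn : r * Y w / rad <= rad^-1 * (r * (1 + Y w)).
  by rewrite mulrC ler_wpM2l ?(ltW rV)// ler_wpM2l// ltW.
have q1 : 1 <= rad^-1 * (r * (1 + Y w)) := le_trans Yr Yrn.
have E1 := expRN_le1 (energy2_ge0 w).
have X1 := expRN_le1 (rescaled_ge0 0 w r0).
have Xd1 := expRN_le1 (rescaled_ge0 dl w r0).
have diff1 dl' : `|expR (- rescaled r dl' w) - expR (- rescaled r 0 w)| <= 1.
  by apply: expRN_dist_le1; exact: rescaled_ge0.
have diffE : `|expR (- rescaled r 0 w) - expR (- energy2 w)| <= 1.
  by apply: expRN_dist_le1; [exact: rescaled_ge0|exact: energy2_ge0].
have s1 : rad^-1 * (r * (1 + Y w)) <= rad^-1 * (r * expR (9 * Y w)).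
  by rewrite ler_pM2l// ler_pM2l// -[leLHS]expr1 nmon.
have k2a : rad^-1 * (r * expR (9 * Y w)) <= (K1 + K2) * (r * expR (9 * Y w)).
  by rewrite ler_wpM2r// /K2; lra.
split; first by lra.
have [G1b G2b K3b] := HC w.
have t1 : `|(expR (- rescaled r dl w) - expR (- rescaled r 0 w)) / dl| <=
    `|dl|^-1 * expR (- (th * rad / r)) * expR (th * Y w).
  rewrite normrM normfV mulrC -mulrA ler_wpM2l ?invr_ge0//.
  apply: le_trans (diff1 dl) _; rewrite -expRD -[leLHS]expR0 ler_expR.
  rewrite addrC subr_ge0 -mulrA ler_pM2l// ler_pdivrMr// mulrC.
  exact: ltW.
have t2 : `|r^-1 * (linear1 w * expR (- energy2 w))| <= C / rad ^+ 2 * (r * expR (9 * Y w)).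
  have rI : `|r^-1| <= r^-1 by rewrite ger0_norm// invr_ge0 ltW.
  apply: le_trans (norm_le_mul rI (norm_le_mul G1b E1)) _.
  (* The square, since one factor [r] has to cancel [r^-1] and another gives the rate. *)
  have q2 : 1 <= (rad^-1 * (r * (1 + Y w))) ^+ 2 by rewrite exprn_ege1.
  have z0 : 0 <= r^-1 * (C * (1 + Y w) * 1).
    by rewrite mulr_ge0 ?invr_ge0 ?(ltW r0)// mulr1 mulr_ge0// ltW.
  apply: le_trans (ler_peMr z0 q2) _.
  have -> : r^-1 * (C * (1 + Y w) * 1) * (rad^-1 * (r * (1 + Y w))) ^+ 2 =
    C / rad ^+ 2 * (r * (1 + Y w) ^+ 3) by field; rewrite !gt_eqF.
  by rewrite ler_pM2l// ler_pM2l// nmon.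
have t3 : `|(6^-1 * linear1 w * vint 3 3 w - 2^-1 * vint 3 2 w) * expR (- energy2 w)|
    <= 2 * C ^+ 2 / rad * (r * expR (9 * Y w)).
  have b1 : `|6^-1 * linear1 w * vint 3 3 w - 2^-1 * vint 3 2 w| <= 2 * C ^+ 2 * (1 + Y w) ^+ 4.
    rewrite (le_trans (ler_normB _ _))//.
    have i6 : `|6^-1 : R| <= 1 by rewrite ger0_norm ?invr_ge0 ?invf_le1 ?ltr0n ?ler1n ?ler0n.
    have i2 : `|2^-1 : R| <= 1 by rewrite ger0_norm ?invr_ge0 ?invf_le1 ?ltr0n ?ler1n ?ler0n.
    have b2 := norm_le_mul (norm_le_mul i6 G1b) K3b.
    have b3 := norm_le_mul i2 G2b.
    rewrite !mul1r in b2 b3.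
    have e4 : C * (1 + Y w) * (C * (1 + Y w) ^+ 3) = C ^+ 2 * (1 + Y w) ^+ 4 by ring.
    have e5 : C * (1 + Y w) ^+ 2 <= C ^+ 2 * (1 + Y w) ^+ 4.
      apply: ler_pM => //; first exact: ltW.
      - by rewrite exprn_ge0.
      - by rewrite -[leLHS]expr1 ler_weXn2l.
      - by rewrite ler_weXn2l// lerDl.
    rewrite e4 in b2; rewrite -[leRHS]mulrA mulr_natl mulr2n.
    by apply: lerD => //; exact: le_trans b3 e5.
  apply: le_trans (norm_le_mul b1 E1) _; rewrite mulr1.
  have z0 : 0 <= 2 * C ^+ 2 * (1 + Y w) ^+ 4.
    by rewrite mulr_ge0 ?exprn_ge0// mulr_ge0// exprn_ge0// ltW.
  apply: le_trans (ler_peMr z0 q1) _.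
  have -> : 2 * C ^+ 2 * (1 + Y w) ^+ 4 * (rad^-1 * (r * (1 + Y w))) =
    2 * C ^+ 2 / rad * (r * (1 + Y w) ^+ 5) by field; rewrite gt_eqF.
  by rewrite ler_pM2l// ler_pM2l// nmon.
have bound : `|diffq r dl w| <= `|dl|^-1 * expR (- (th * rad / r)) * expR (th * Y w)
    + C / rad ^+ 2 * (r * expR (9 * Y w)) + 2 * C ^+ 2 / rad * (r * expR (9 * Y w)).
  rewrite /diffq; apply: le_trans (ler_normB _ _) _; apply: lerD => //.
  by apply: le_trans (ler_normD _ _) _; exact: lerD.
have m3 : 0 <= (K1 + K2) * (`|dl| * r ^- 4) by rewrite mulr_ge0// addr_ge0// ltW.
have m4 := mulr_ge0 (ltW K1_gt0) re0.
have m5 := mulr_ge0 (ltW rV) re0.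
have K2E : K2 * (r * expR (9 * Y w)) = rad^-1 * (r * expR (9 * Y w))
  + C / rad ^+ 2 * (r * expR (9 * Y w)) + 2 * C ^+ 2 / rad * (r * expR (9 * Y w)).
  by rewrite /K2 !mulrDl.
have -> : (K1 + K2) * (r * expR (9 * Y w)) = K1 * (r * expR (9 * Y w)) + K2 * (r * expR (9 * Y w)).
  by rewrite mulrDl.
rewrite K2E; lra.
Qed.

Let kern w := (6^-1 * linear1 w * vint 3 3 w - 2^-1 * vint 3 2 w) * expR (- energy2 w).

Let mdiffq r dl : measurable_fun [set: T] (diffq r dl).
Proof.
have me : measurable_fun [set: T] (fun w => expR (- energy2 w)).
  by apply: measurableT_comp => //; apply: measurableT_comp.
have mr dl' : measurable_fun [set: T] (fun w => expR (- rescaled r dl' w)).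
  by apply: measurableT_comp => //; apply: measurableT_comp.
apply: measurable_funB; last first.
  apply: measurable_funM => //; apply: measurable_funB; last first.
    by apply: measurable_funM => //; exact: mvint.
  by apply: measurable_funM; [exact: measurable_funM|exact: mvint].
apply: measurable_funD; last by apply: measurable_funM => //; exact: measurable_funM.
by apply: measurable_funM => //; exact: measurable_funB.
Qed.

Lemma core_estimates_sup : exists2 K : R, 0 < K & forall r dl, 0 < r -> r <= 1 -> dl != 0 ->
  `|dl| <= 1 ->
  `|Ph r 0 - K0c| <= K * r /\
  `|(Ph r dl - Ph r 0) / dl - kappa| <= K * (`|dl| * r ^- 4) + K * r
     + K * (`|dl|^-1 * expR (- (rad ^+ 2 / (32 * t) * r ^- 2))).
Proof.
have [K K_gt0 HK] := pathwise.
have [L L_gt0 LE] : exists2 L : R, 0 < L & 256 * expR (8 * 9 ^+ 2 * t) = L.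
  by eexists; last reflexivity; rewrite mulr_gt0 ?ltr0n ?expR_gt0.
have i9 : P.-integrable setT (EFin \o (fun w => expR (9 * Y w))) by exact: integrable_expY.
have iK r : P.-integrable setT (EFin \o (fun w => K * (r * expR (9 * Y w)))).
  by do 2 apply: integrable_mulrl => //.
have intK r : 0 < r -> \int[P]_w (K * (r * expR (9 * Y w))) <= K * L * r.
  move=> r0; under eq_Rintegral do rewrite mulrA.
  rewrite RintegralZl// [leRHS]mulrAC ler_pM2l ?mulr_gt0// -LE.
  exact: int_expY.
exists (K * L + K + 256) => [|r dl r0 r1 dl0 dl1].
  by apply: addr_gt0; [apply: addr_gt0 => //; exact: mulr_gt0|rewrite ltr0n].
have rK : 0 <= K * r by rewrite mulr_ge0// ltW.
have rL : 0 <= K * L * r by rewrite !mulr_ge0// ltW.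
have ir dl' := integrable_rescaled dl' r0.
have ie := integrable_energy2.
(* The minimizer of - th rad / r + 8 th^2 t; the minimum is - rad^2 / (32 t r^2). *)
pose th := rad / (16 * t * r).
have th0 : 0 < th by rewrite divr_gt0// !mulr_gt0.
have pw := fun w => HK r dl th w r0 r1 dl0 dl1 th0.
split.
  have iB : P.-integrable setT (EFin \o (fun w => expR (- rescaled r 0 w) - expR (- energy2 w))).
    exact: integrable_subr.
  rewrite /Ph /K0c -RintegralB//; apply: le_trans (le_normr_Rintegral _ _) _ => //.
  apply: (@le_trans _ _ (\int[P]_w (K * (r * expR (9 * Y w))))).
    apply: le_Rintegral => //; first exact: integrable_norm iB.
    by move=> w _; have [] := pw w.
  by apply: le_trans (intK r r0) _; lra.
pose c1 := K * (`|dl| * r ^- 4).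
pose c2 := `|dl|^-1 * expR (- (th * rad / r)).
have c1_ge0 : 0 <= c1 by rewrite !mulr_ge0// ?invr_ge0 ?exprn_ge0// ltW.
have c2_ge0 : 0 <= c2 by rewrite mulr_ge0 ?expR_ge0// invr_ge0.
pose bnd w := c1 + K * (r * expR (9 * Y w)) + c2 * expR (th * Y w).
have ic1 : P.-integrable setT (EFin \o (fun=> c1)) by exact: finite_measure_integrable_cst.
have ith : P.-integrable setT (EFin \o (fun w => c2 * expR (th * Y w))).
  by apply: integrable_mulrl => //; exact: integrable_expY.
have i12 : P.-integrable setT (EFin \o (fun w => c1 + K * (r * expR (9 * Y w)))).
  exact: integrable_addr.
have ibnd : P.-integrable setT (EFin \o bnd) by exact: integrable_addr.
have diffq_le w : `|diffq r dl w| <= bnd w by have [] := pw w.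
have idq : P.-integrable setT (EFin \o diffq r dl).
  apply: (le_integrable measurableT _ _ ibnd); first exact/measurable_EFinP.
  by move=> w _ /=; rewrite lee_fin (le_trans (diffq_le w))// ler_norm.
have divE : (fun w => (expR (- rescaled r dl w) - expR (- rescaled r 0 w)) / dl) =
    (fun w => dl^-1 * (expR (- rescaled r dl w) - expR (- rescaled r 0 w))).
  by apply/funext => w; rewrite mulrC.
have idiff : P.-integrable setT (EFin \o (fun w =>
    expR (- rescaled r dl w) - expR (- rescaled r 0 w))) by exact: integrable_subr.
have idiv : P.-integrable setT (EFin \o (fun w =>
    (expR (- rescaled r dl w) - expR (- rescaled r 0 w)) / dl)).
  by rewrite divE; exact: integrable_mulrl.
have [il il0] := integrable_linear1.
have ilr : P.-integrable setT (EFin \o (fun w => r^-1 * (linear1 w * expR (- energy2 w)))).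
  exact: integrable_mulrl.
have isum : P.-integrable setT (EFin \o (fun w =>
    (expR (- rescaled r dl w) - expR (- rescaled r 0 w)) / dl
    + r^-1 * (linear1 w * expR (- energy2 w)))).
  exact: integrable_addr.
have ikern : P.-integrable setT (EFin \o kern).
  have -> : kern = (fun w => (expR (- rescaled r dl w) - expR (- rescaled r 0 w)) / dl
      + r^-1 * (linear1 w * expR (- energy2 w)) - diffq r dl w).
    by apply/funext => w; rewrite /diffq /kern; ring.
  exact: integrable_subr.
have -> : (Ph r dl - Ph r 0) / dl - kappa = \int[P]_w diffq r dl w.
  rewrite /diffq (RintegralB measurableT isum ikern) (RintegralD measurableT idiv ilr).
  rewrite RintegralZl// il0 mulr0 addr0 -/kappa; congr (_ - _).
  by rewrite divE RintegralZl// mulrC RintegralB.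
apply: le_trans (le_normr_Rintegral _ idq) _ => //.
apply: (@le_trans _ _ (\int[P]_w bnd w)).
  by apply: le_Rintegral => //; exact: integrable_norm idq.
rewrite /bnd (RintegralD measurableT i12 ith) (RintegralD measurableT ic1 (iK r)).
rewrite Rintegral_prob_cst.
have -> : \int[P]_w (c2 * expR (th * Y w)) = c2 * \int[P]_w expR (th * Y w).
  by rewrite RintegralZl//; exact: integrable_expY.
have e2 : c2 * \int[P]_w expR (th * Y w) <=
    256 * (`|dl|^-1 * expR (- (rad ^+ 2 / (32 * t) * r ^- 2))).
  apply: le_trans (ler_wpM2l c2_ge0 (int_expY th0)) _.
  have -> : - (rad ^+ 2 / (32 * t) * r ^- 2) = - (th * rad / r) + 8 * th ^+ 2 * t.
    by rewrite /th; field; rewrite !gt_eqF.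
  by rewrite expRD /c2; lra.
have e3 := intK r r0.
have m1 : 0 <= `|dl| * r ^- 4 by rewrite mulr_ge0// invr_ge0 exprn_ge0// ltW.
have m2 : 0 <= `|dl|^-1 * expR (- (rad ^+ 2 / (32 * t) * r ^- 2)).
  by rewrite mulr_ge0 ?expR_ge0// invr_ge0.
have KL : 0 <= K * L by rewrite mulr_ge0// ltW.
have m3 := mulr_ge0 KL m1; have m4 := mulr_ge0 KL m2; have m5 := mulr_ge0 (ltW K_gt0) m2.
rewrite /c1; lra.
Qed.

End with_sup.

Lemma core_estimates : exists2 K : R, 0 < K & forall r dl, 0 < r -> r <= 1 -> dl != 0 ->
  `|dl| <= 1 ->
  `|Ph r 0 - K0c| <= K * r /\
  `|(Ph r dl - Ph r 0) / dl - kappa| <= K * (`|dl| * r ^- 4) + K * r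
     + K * (`|dl|^-1 * expR (- (rad ^+ 2 / (32 * t) * r ^- 2))).
Proof.
have [Y [mY WY expY]] := wiener_sup hW ht.
exact: core_estimates_sup mY WY expY.
Qed.

End core.

(** * Semiconcavity of the solution *)

Section gaussian_taylor.
Context (R : realType) (c : R) (c0 : 0 < c).

(** A Gaussian and its first two derivatives; indices above 2 only complete the sequence. *)
Let f (k : nat) (y : R) : R :=
  if k is 0%N then expR (- (c * y ^+ 2)) else
  if k is 1%N then - 2 * c * y * expR (- (c * y ^+ 2)) else
  (4 * c ^+ 2 * y ^+ 2 - 2 * c) * expR (- (c * y ^+ 2)).

Let df0 x : is_derive x (1 : R) (f 0) (f 1 x).
Proof.
have h := is_deriveN (is_derive_monomial c 1 x).
have h2 := @is_derive1_comp R expR (- (fun y : R => c * y ^+ 2)) x _ _ (is_derive_expR _) h.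
apply: is_derive_eq h2 _.
by rewrite /f expr1; ring.
Qed.

Let df1 x : is_derive x (1 : R) (f 1) (f 2 x).
Proof.
have h1 := is_derive_monomial (- 2 * c) 0 x.
have h := is_deriveM h1 (df0 x).
have -> : f 1 = (fun y => - 2 * c * y ^+ 1) * f 0.
  by apply/funext => y; rewrite fctE expr1.
apply: is_derive_eq h _.
by rewrite /f /GRing.scale/= expr1 expr0; ring.
Qed.

(** The second derivative is bounded by 6 c, because x exp(-x) <= 1; in the symmetric sum the
    first-order terms cancel. *)
Lemma gauss_second_difference y z :
  expR (- (c * (y + z) ^+ 2)) + expR (- (c * (y - z) ^+ 2))
    <= 2 * expR (- (c * y ^+ 2)) + 12 * c * z ^+ 2.
Proof.
have df k : (k < 2)%N -> forall x, is_derive x (1 : R) (f k) (f k.+1 x).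
  by case: k => [|[|//]] _ x; [exact: df0|exact: df1].
have f2 x : `|f 2 x| <= 6 * c.
  rewrite /f mulrBl (le_trans (ler_normB _ _))//.
  have cy : 0 <= c * x ^+ 2 by rewrite mulr_ge0 ?sqr_ge0// ltW.
  have e1 := expRN_le1 cy; rewrite ger0_norm ?expR_ge0// in e1.
  have e0 := expR_ge0 (- (c * x ^+ 2)).
  have e2 : c * x ^+ 2 * expR (- (c * x ^+ 2)) <= 1.
    rewrite expRN ler_pdivrMr ?expR_gt0// mul1r.
    by apply: le_trans (expR_ge1Dx _); rewrite lerDr.
  have a1 : 4 * c * (c * x ^+ 2 * expR (- (c * x ^+ 2))) <= 4 * c * 1.
    by rewrite ler_wpM2l// mulr_ge0// ltW.
  have a2 : 2 * c * expR (- (c * x ^+ 2)) <= 2 * c * 1 by rewrite ler_wpM2l// mulr_ge0// ltW.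
  rewrite !ger0_norm; first by lra.
  - by rewrite mulr_ge0// mulr_ge0// ltW.
  - by rewrite mulr_ge0 ?expR_ge0// mulr_ge0 ?sqr_ge0// mulr_ge0 ?sqr_ge0.
have H e : `|e| = 1 -> expR (- (c * (y + e * z) ^+ 2)) <=
    expR (- (c * y ^+ 2)) + f 1 y * (e * z) + 6 * c * z ^+ 2.
  move=> e1; have zz : `|e * z| <= `|z| by rewrite normrM e1 mul1r.
  have := @taylor_rem2 R f 2 (6 * c) `|z| df 0 y isT (fun x _ => f2 _) (e * z) zz.
  rewrite normrM e1 mul1r real_normK ?num_real// ler_norml => /andP[_].
  by rewrite {1 2}/f; lra.
have h1 := H 1 (normr1 _); have h2 := H (-1).
rewrite normrN normr1 in h2; have {}h2 := h2 erefl.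
rewrite mul1r in h1; rewrite mulN1r in h2; lra.
Qed.

End gaussian_taylor.

(** Meant for an integrand and its reflection: equal integrals turn a pointwise bound on their sum,
    free of first-order terms, into a bound on one of them. *)
Lemma symmetrized_Rintegral_le (R : realType) d (T : measurableType d) (P : probability T R)
    (f0 f1 f2 g : T -> R) (c : R) :
  P.-integrable setT (EFin \o f0) -> P.-integrable setT (EFin \o f1) ->
  P.-integrable setT (EFin \o f2) -> P.-integrable setT (EFin \o g) ->
  \int[P]_w f1 w = \int[P]_w f2 w ->
  (forall w, f1 w + f2 w <= 2 * f0 w + c * g w) ->
  \int[P]_w f1 w <= \int[P]_w f0 w + c / 2 * \int[P]_w g w.
Proof.
move=> i0 i1 i2 ig e le12.
have j0 := integrable_mulrl measurableT 2 i0; have jg := integrable_mulrl measurableT c ig.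
have := le_Rintegral measurableT (integrable_addr measurableT i1 i2)
  (integrable_addr measurableT j0 jg) (fun w _ => le12 w).
rewrite (RintegralD measurableT i1 i2) (RintegralD measurableT j0 jg).
rewrite (RintegralZl 2 measurableT i0) (RintegralZl c measurableT ig) -e; lra.
Qed.

Section time_increment.
Context (R : realType) d (T : measurableType d) (P : probability T R)
  (W : R -> {RV P >-> R}) (hW : standard_wiener W) (t : R) (ht : 0 < t).
Notation mu := (@lebesgue_measure R).
Variables (V : R -> R) (cV : continuous V) (M : R) (VM : forall x, - M <= V x).
Variables (h : R) (h0 : 0 < h).
Let r := Num.sqrt h.

Definition fk s x := \int[P]_w expR (h^-1 * F V s x (fun u => r * W u w)).

Let rr : r ^+ 2 = h. Proof. by rewrite sqr_sqrtr// ltW. Qed.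
Let hV : 0 <= h^-1. Proof. by rewrite invr_ge0 ltW. Qed.

Let cX s x w : {within `[0, s], continuous (fun u => r * W u w + x)}.
Proof.
case: hW => _ cW _ _.
apply: cpathD; last exact: cpath_cst.
apply: cpathM; first exact: cpath_cst.
apply: continuous_subspaceW (cW w).
by move=> u /=; rewrite !in_itv/= andbT => /andP[].
Qed.

Let cVX s x w : {within `[0, s], continuous (fun u => V (r * W u w + x))}.
Proof. exact: cpath_comp. Qed.

Let expF s x w : expR (h^-1 * F V s x (fun u => r * W u w)) =
  expR (- h^-1 * \int[mu]_(u in `[0, s]) V (r * W u w + x))
  * expR (- ((2 * h)^-1 * (r * W s w + x) ^+ 2)).
Proof.
rewrite /F real_normK ?num_real// -expRD; congr expR.
by set A := \int[mu]_(u in _) _; field; rewrite gt_eqF.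
Qed.

Let mexpF s x : 0 < s -> measurable_fun [set: T] (fun w => expR (h^-1 * F V s x (fun u => r * W u w))).
Proof.
move=> s0; apply: measurableT_comp => //; apply: measurable_funM => //.
apply: measurableT_comp => //; apply: measurable_funD.
  apply: (@measurable_path_integral _ _ _ s s0 (fun u w => V (r * W u w + x))) => // u.
  apply: measurableT_comp; first exact: continuous_measurable_fun.
  by apply: measurable_funD => //; exact: measurable_funM.
apply: measurable_funM => //; apply: measurable_funX; apply: measurableT_comp => //.
by apply: measurable_funD => //; exact: measurable_funM.
Qed.

Let U_le s x w : 0 < s -> expR (- h^-1 * \int[mu]_(u in `[0, s]) V (r * W u w + x))
  <= expR (h^-1 * (M * s)).
Proof.
move=> s0; rewrite ler_expR mulNr -mulrN ler_wpM2l// lerNl -mulNr -(int_cst s0).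
by apply: cpath_int_le => //; exact: cpath_cst.
Qed.

Lemma fk_integrand_bound s x w : 0 < s ->
  `|expR (h^-1 * F V s x (fun u => r * W u w))| <= expR (h^-1 * (M * s)).
Proof.
move=> s0; rewrite ger0_norm ?expR_ge0// expF -[leRHS]mulr1.
apply: ler_pM; [exact: expR_ge0|exact: expR_ge0|exact: U_le|].
rewrite -[leRHS]expR0 ler_expR oppr_le0 mulr_ge0 ?sqr_ge0// invr_ge0 mulr_ge0// ltW//.
Qed.

Lemma integrable_fk s x : 0 < s ->
  P.-integrable setT (EFin \o (fun w => expR (h^-1 * F V s x (fun u => r * W u w)))).
Proof.
move=> s0.
have i1 : P.-integrable setT (EFin \o (fun=> expR (h^-1 * (M * s)))).
  exact: finite_measure_integrable_cst.
apply: (le_integrable measurableT _ _ i1) => //.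
  exact/measurable_EFinP/mexpF.
by move=> w _ /=; rewrite lee_fin (le_trans (fk_integrand_bound x w s0))// ler_norm.
Qed.

Lemma fk_bound s x : 0 < s -> 0 <= fk s x <= expR (h^-1 * (M * s)).
Proof.
move=> s0; apply/andP; split; first by apply: Rintegral_ge0 => w _; exact: expR_ge0.
rewrite -[leRHS](Rintegral_prob_cst P).
apply: le_Rintegral => //; first exact: integrable_fk.
  exact: finite_measure_integrable_cst.
by move=> w _; apply: le_trans (fk_integrand_bound x w s0); exact: ler_norm.
Qed.

(** Derived from the exponential moments through x^2 <= 4 (exp x + exp(-x)) at the increment divided
    by sqrt tau, whose moments at 1 and -1 are exp(1/2). Only the order in [tau] matters. *)
Lemma increment_second_moment tau : 0 < tau ->
  P.-integrable setT (EFin \o (fun w => (W (t + tau) w - W t w) ^+ 2)) /\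
  \int[P]_w (W (t + tau) w - W t w) ^+ 2 <= 8 * expR 2^-1 * tau.
Proof.
move=> tau0; pose sg := Num.sqrt tau.
have sg0 : 0 < sg by rewrite sqrtr_gt0.
have sg2 : sg ^+ 2 = tau by rewrite sqr_sqrtr// ltW.
pose z w := W (t + tau) w - W t w.
pose u i : R := t + tau * i%:R.
have u0 : 0 <= u 0%N by rewrite /u mulr0 addr0 ltW.
have ltu i : u i < u i.+1 by rewrite /u ltrD2l ltr_pM2l// ltr_nat.
have mz (c : R) : measurable_fun [set: T] (fun w => expR (c * z w)).
  by apply: measurableT_comp => //; apply: measurable_funM => //; exact: measurable_funB.
have mgf (c : R) : (\int[P]_w (expR (c * z w))%:E = (expR (c ^+ 2 * tau / 2))%:E)%E.
  have := wiener_increment_mgf hW u0 ltu 0 c.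
  by rewrite /u mulr0 addr0 mulr1 [t + tau - t]addrC addKr.
have ie (c : R) : P.-integrable setT (EFin \o (fun w => expR (c * z w))).
  apply/integrableP; split; first exact/measurable_EFinP.
  under eq_integral do rewrite /= ger0_norm ?expR_ge0//.
  by rewrite mgf ltry.
pose b w := 4 * tau * (expR (sg^-1 * z w) + expR (- sg^-1 * z w)).
have zb w : z w ^+ 2 <= b w.
  have key (x : R) : x ^+ 2 <= 4 * (expR x + expR (- x)).
    have aux (y : R) : 0 <= y -> y ^+ 2 <= 4 * expR y.
      move=> y0; have -> : expR y = expR (y / 2) ^+ 2 by rewrite -expRM_natl; congr expR; field.
      by have := expR_ge1Dx (y / 2); nra.
    have p1 := expR_ge0 x; have p2 := expR_ge0 (- x).
    have [x0|x0] := leP 0 x; first by have := aux x x0; lra.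
    by have := aux (- x); rewrite oppr_ge0 sqrrN ltW// => /(_ isT); lra.
  have := key (sg^-1 * z w); rewrite -mulNr => k.
  have -> : z w ^+ 2 = tau * (sg^-1 * z w) ^+ 2.
    by rewrite -sg2; field; rewrite gt_eqF.
  by rewrite /b -[4 * tau]mulrC -mulrA ler_pM2l.
have ib : P.-integrable setT (EFin \o b).
  by apply: integrable_mulrl => //; exact: integrable_addr.
have iz : P.-integrable setT (EFin \o (fun w => z w ^+ 2)).
  apply: (le_integrable measurableT _ _ ib).
    by apply/measurable_EFinP; apply: measurable_funX; exact: measurable_funB.
  move=> w _ /=; rewrite lee_fin ger0_norm ?sqr_ge0// (le_trans (zb w))// ler_norm//.
split; first exact: iz.
apply: (@le_trans _ _ (\int[P]_w b w)).
  by apply: le_Rintegral => // w _; exact: zb.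
rewrite /b RintegralZl//; last exact: integrable_addr.
rewrite RintegralD// /Rintegral !mgf/= sqrrN.
have -> : sg^-1 ^+ 2 * tau / 2 = 2^-1 by rewrite -sg2; field; rewrite gt_eqF.
by rewrite le_eqVlt; apply/orP; left; apply/eqP; ring.
Qed.

(* Reflecting the increment of W over [t, t + tau] preserves the law, so the terms
   linear in it cancel and the bound is of order tau. *)
Lemma fk_increment x tau : 0 < tau ->
  fk (t + tau) x <= expR (h^-1 * (M * tau)) *
    (fk t x + expR (h^-1 * (M * t)) * (24 * expR 2^-1 * tau)).
Proof.
move=> tau0.
have tt : 0 < t + tau by rewrite addr_gt0.
pose f y := expR (- ((2 * h)^-1 * y ^+ 2)).
have c0 : 0 < (2 * h)^-1 by rewrite invr_gt0 mulr_gt0.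
have cf : continuous f.
  move=> y; apply: continuous_comp; last exact: continuous_expR.
  apply: cvgN; apply: cvgMr.
  exact: exprn_continuous.
have f0 y : 0 <= f y by exact: expR_ge0.
have f1 y : f y <= 1.
  by rewrite -[leRHS]expR0 ler_expR oppr_le0 mulr_ge0 ?sqr_ge0// ltW.
have V_lb : exists m, forall y, m <= V y by exists (- M).
have [ip im e] := wiener_flip_last hW ht r x cV V_lb cf f0 f1 hV tau0.
pose U w := expR (- h^-1 * \int[mu]_(s in `[0, t]) V (r * W s w + x)).
pose z w := W (t + tau) w - W t w.
have U0 w : 0 <= U w by exact: expR_ge0.
have [iz z2] := increment_second_moment tau0.
(* Over ]t, t + tau] the potential is merely bounded below, at the cost of the factor exp(M tau /
   h). *)
have le1 w : expR (h^-1 * F V (t + tau) x (fun u => r * W u w)) <=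
    expR (h^-1 * (M * tau)) * (U w * f (r * W t w + x + r * z w)).
  rewrite expF mulrA; apply: ler_pM; [exact: expR_ge0|exact: expR_ge0| |]; last first.
    by rewrite /f /z; rewrite le_eqVlt; apply/orP; left; apply/eqP; congr (expR (- (_ * _ ^+ 2))); ring.
  rewrite /U -expRD ler_expR.
  have int1 : mu.-integrable `[0, t + tau] (EFin \o (fun s => V (r * W s w + x))).
    exact: cpath_integrable (cVX (s := t + tau) (x := x) (w := w)).
  have t_le : t <= t + tau by rewrite lerDl ltW.
  have := Rintegral_itvB int1 (x := t); rewrite !bnd_simp => /(_ (ltW ht) t_le).
  set A := \int[mu]_(s in `[0, t + tau]) _; set B := \int[mu]_(s in `[0, t]) _ => AB.
  suff /(ler_wpM2l hV) : - (M * tau) <= A - B by lra.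
  rewrite AB -mulNr.
  have -> : - M * tau = \int[mu]_(s in `]t, t + tau]) (- M).
    rewrite Rintegral_cst//= lebesgue_measure_itv/= lte_fin ltrDl tau0.
    by rewrite -EFinB/= addrC addKr.
  apply: le_Rintegral => //.
  - apply: integrableS (cpath_integrable (@cpath_cst R (t + tau) (- M))) => //.
    by apply: subset_itvr; rewrite bnd_simp ltW.
  - apply: integrableS int1 => //.
    by apply: subset_itvr; rewrite bnd_simp ltW.
have iU : P.-integrable setT (EFin \o (fun w => U w * f (r * W t w + x))).
  rewrite (_ : (fun w => U w * f (r * W t w + x)) =
    (fun w => expR (h^-1 * F V t x (fun u => r * W u w)))).
    exact: integrable_fk.
  by apply/funext => w; rewrite expF.
have le2 : \int[P]_w (U w * f (r * W t w + x + r * z w)) <=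
    fk t x + expR (h^-1 * (M * t)) * (24 * expR 2^-1 * tau).
  have eR : \int[P]_w (U w * f (r * W t w + x + r * z w)) =
      \int[P]_w (U w * f (r * W t w + x - r * z w)).
    by rewrite /Rintegral e.
  have pw w : U w * f (r * W t w + x + r * z w) + U w * f (r * W t w + x - r * z w) <=
      2 * (U w * f (r * W t w + x)) + expR (h^-1 * (M * t)) * 6 * z w ^+ 2.
    have := gauss_second_difference c0 (r * W t w + x) (r * z w).
    have -> : 12 * (2 * h)^-1 * (r * z w) ^+ 2 = 6 * z w ^+ 2.
      by rewrite exprMn rr; field; rewrite gt_eqF.
    move/(ler_wpM2l (U0 w)); rewrite -mulrDr => /le_trans; apply.
    rewrite mulrDr mulrCA lerD2l -mulrA ler_wpM2r ?U_le//.
    by rewrite mulr_ge0 ?sqr_ge0.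
  apply: le_trans (symmetrized_Rintegral_le iU ip im iz eR pw) _.
  have -> : \int[P]_w (U w * f (r * W t w + x)) = fk t x.
    by apply: eq_Rintegral => w _; rewrite expF.
  rewrite lerD2l -mulrA -mulrA ler_wpM2l ?expR_ge0//.
  have -> : 24 * expR 2^-1 * tau = 6 / 2 * (8 * expR 2^-1 * tau) by field.
  by rewrite mulrA ler_wpM2l.
apply: (@le_trans _ _ (\int[P]_w (expR (h^-1 * (M * tau)) * (U w * f (r * W t w + x + r * z w))))).
  apply: (le_Rintegral measurableT _ _ (fun w _ => le1 w)); first exact: integrable_fk.
  exact: integrable_mulrl.
rewrite (RintegralZl _ measurableT ip).
by rewrite ler_wpM2l ?expR_ge0.
Qed.

End time_increment.

Section one_variable_calculus.
Context (R : realType).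
Implicit Types f : R -> R.

(** Two mean value steps. As [c * dl] lies between 0 and [dl ^+ 2], an upper bound on the second
    derivative suffices for both signs of [dl]. *)
Lemma second_order_upper_bound f (df : forall x, derivable f x 1)
    (ddf : forall x, derivable f^`() x 1) (B q dl : R) : 0 <= B ->
  (forall x, `|x - q| <= `|dl| -> f^`(2) x <= B) ->
  f (q + dl) <= f q + f^`() q * dl + B * dl ^+ 2.
Proof.
move=> B0 HB.
have [c [/andP[c0 cdl] cn hc]] := derivable_mvt df q dl.
have [c' [_ c'z hc']] := derivable_mvt ddf q c.
have c'n := le_trans c'z cn.
have h2 : f^`()^`() (q + c') <= B.
  by apply: HB; rewrite addrAC subrr add0r.
have : f^`()^`() (q + c') * (c * dl) <= B * dl ^+ 2.
  apply: le_trans (ler_wpM2r c0 h2) _; exact: ler_wpM2l.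
have -> : f (q + dl) = f q + f^`() (q + c) * dl by rewrite -hc; ring.
have -> : f^`() (q + c) = f^`() q + f^`()^`() (q + c') * c by rewrite -hc'; ring.
lra.
Qed.
End one_variable_calculus.

Lemma derive1_le_right (R : realType) (f : R -> R) s B : derivable f s 1 ->
  (forall tau, 0 < tau -> tau <= 1 -> f (s + tau) - f s <= B * tau) -> f^`() s <= B.
Proof.
move=> df H; rewrite derive1E.
have := cvg_dnbhs_at_right df; apply: (@closed_cvg _ _ _ _ _ (fun x => x <= B)).
  exact: closed_le.
near=> tau; have tau0 : 0 < tau by near: tau; exact: nbhs_right_gt.
have tau1 : tau <= 1 by near: tau; exact: nbhs_right_le.
rewrite /= /GRing.scale/= mulr1 mulrC ler_pdivrMr//.
by rewrite [tau + s]addrC; exact: H.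
Unshelve. all: by end_near. Qed.

Section semiconcavity.
Context (R : realType) d (T : measurableType d) (P : probability T R)
  (W : R -> {RV P >-> R}) (hW : standard_wiener W) (t : R) (ht : 0 < t).
Variables (V : R -> R) (cV : continuous V) (M : R) (M0 : 0 <= M) (VM : forall x, - M <= V x).
Variables (q C : R) (C0 : 0 <= C) (VC : forall x, `|x - q| <= 1 -> V x <= C).
Variables (h : R) (h0 : 0 < h) (h1 : h <= 1) (u : R -> R -> R).
Hypothesis u_sol : heat_solution V h u.
Hypothesis u_fk : forall s x, 0 < s -> u s x = feynman_kac W V h s x.

Let c := (Num.sqrt (2 * pi * h))^-1.
Let E := expR (h^-1 * (M * t)).

Lemma feynman_kacE s x : feynman_kac W V h s x = c * fk W V h s x.
Proof. by rewrite /feynman_kac /fk /Rintegral unlock. Qed.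

Let c0 : 0 <= c. Proof. by rewrite invr_ge0. Qed.

(** A bound for the forward increment in time per unit of time: M / h comes from exp(M tau / h) - 1,
    and 24 exp(1/2) from the reflected increment. *)
Let B := expR (h^-1 * M) * E * (h^-1 * M + 24 * expR 2^-1).

(** The time derivative exists by [heat_solution], so it is bounded by forward increments, the only
    ones that [fk_increment] controls. *)
Lemma derive_time_le x : (u ^~ x)^`() t <= c * B.
Proof.
have [_ /(_ t x ht)[du _ _] _ _] := u_sol.
apply: derive1_le_right => // tau tau0 tau1.
rewrite !u_fk ?addr_gt0// !feynman_kacE -mulrBr -mulrA ler_wpM2l//.
have inc := fk_increment hW ht cV VM h0 x tau0.
have /andP[f0 fE] := fk_bound hW cV VM h0 x ht.
set e := expR (h^-1 * (M * tau)) in inc.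
have hV : 0 <= h^-1 by rewrite invr_ge0 ltW.
have hM : 0 <= h^-1 * M by exact: mulr_ge0.
have eE : e <= expR (h^-1 * M) by rewrite ler_expR ler_wpM2l// -[leRHS]mulr1 ler_wpM2l.
have e0 : 0 < e := expR_gt0 _.
have e1 : e - 1 <= h^-1 * (M * tau) * e.
  have := expR_ge1Dx (- (h^-1 * (M * tau))); rewrite expRN -/e -(ler_pM2r e0).
  by rewrite mulVf ?gt_eqF//; clear inc f0 fE hV hM eE e0 du; lra.
have E0 : 0 <= E := expR_ge0 _.
have s0 : 0 <= expR 2^-1 :> R := expR_ge0 _.
have m1 : (e - 1) * fk W V h t x <= h^-1 * M * tau * expR (h^-1 * M) * E.
  apply: (@le_trans _ _ (h^-1 * (M * tau) * e * fk W V h t x)); first by rewrite ler_wpM2r.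
  apply: ler_pM => //; first by rewrite !mulr_ge0// ltW.
  by rewrite mulrA ler_wpM2l// !mulr_ge0// ltW.
have m2 : e * (E * (24 * expR 2^-1 * tau)) <= expR (h^-1 * M) * (E * (24 * expR 2^-1 * tau)).
  by rewrite ler_wpM2r// !mulr_ge0// ltW.
have alg (x1 x0 m s y z : R) : x1 <= e * (x0 + z * (24 * s * tau)) ->
    (e - 1) * x0 <= m * tau * y * z -> e * (z * (24 * s * tau)) <= y * (z * (24 * s * tau)) ->
    x1 - x0 <= y * z * (m + 24 * s) * tau by lra.
exact: alg inc m1 m2.
Qed.

(** The equation is solved for the second space derivative, whence the factor 2 h^(-2); the time
    derivative is bounded above everywhere and the potential term near [q]. With [h <= 1] the powers
    of h combine. *)
Lemma eta_semiconcave dl : `|dl| <= 1 -> u t (q + dl) <= u t q + (u t)^`() q * dl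
  + c * (2 * (M + C + 24 * expR 2^-1) * h ^- 2 * expR (h^-1 * (M * t + M))) * dl ^+ 2.
Proof.
move=> dl1.
have [_ D pde _] := u_sol.
have hV : 0 <= h^-1 by rewrite invr_ge0 ltW.
have E1 : 1 <= expR (h^-1 * M) by rewrite -[leLHS]expR0 ler_expR mulr_ge0.
have E0 : 0 <= E := expR_ge0 _.
have s0 : 0 <= expR 2^-1 :> R := expR_ge0 _.
have EE : expR (h^-1 * (M * t + M)) = E * expR (h^-1 * M) by rewrite -expRD -mulrDr.
have h2 : 0 <= h ^- 2 by rewrite invr_ge0 exprn_ge0// ltW.
apply: second_order_upper_bound => [x|x||x xq].
- by have [] := D t x ht.
- by have [] := D t x ht.
- by rewrite !mulr_ge0 ?expR_ge0// !addr_ge0// mulr_ge0.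
have -> : (u t)^`(2) x = 2 * h ^- 2 * (h * (u ^~ x)^`() t + V x * u t x).
  by rewrite (pde _ _ ht); field; rewrite gt_eqF.
have /andP[f0 fE] := fk_bound hW cV VM h0 x ht.
have v : V x * u t x <= c * (C * E).
  rewrite u_fk// feynman_kacE mulrCA ler_wpM2l//.
  apply: (@le_trans _ _ (C * fk W V h t x)); last exact: ler_wpM2l.
  by rewrite ler_wpM2r// VC// (le_trans xq).
have dt := ler_wpM2l (ltW h0) (derive_time_le x).
have hB : h * (c * B) <= c * (expR (h^-1 * M) * E * (M + 24 * expR 2^-1)).
  rewrite mulrCA ler_wpM2l// /B mulrCA ler_wpM2l// ?mulr_ge0 ?expR_ge0//.
  rewrite mulrDr mulrA mulfV ?gt_eqF// mul1r lerD2l.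
  by rewrite -[leRHS]mul1r ler_wpM2r// mulr_ge0.
have CE : c * (C * E) <= c * (expR (h^-1 * M) * E * C).
  rewrite ler_wpM2l// [C * E]mulrC ler_wpM2r// -[leLHS]mul1r ler_wpM2r//.
rewrite EE.
have := ler_wpM2l h2 (le_trans (lerD dt v) (lerD hB CE)); lra.
Qed.

End semiconcavity.

(** * The logarithmic derivative *)

Section small_noise_limit.
Context (R : realType).

Lemma cvg_dist_le (F : set_system R) {FF : Filter F} (f g : R -> R) (l : R) :
  (\forall h \near F, `|f h - l| <= g h) -> g @ F --> 0 -> f @ F --> l.
Proof.
move=> fg g0; apply: (@squeeze_cvgr _ _ _ _ (fun h => l - g h) (fun h => l + g h)).
- apply: filterS fg => h; rewrite ler_norml => /andP[]; lra.
- by rewrite -[X in _ --> X]subr0; apply: cvgB => //; exact: cvg_cst.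
- by rewrite -[X in _ --> X]addr0; apply: cvgD => //; exact: cvg_cst.
Qed.

Lemma cvg_sqrt0 : Num.sqrt h @[h --> 0^'+] --> (0 : R).
Proof.
rewrite -[X in _ --> X]sqrtr0; apply: cvg_at_right_filter.
exact: sqrt_continuous.
Qed.

(** From (y / 3)^3 <= exp y at y = 1/h. The third power beats the factors h^(-2) met below and still
    leaves h. *)
Lemma expR_cube_le (h : R) : 0 < h -> expR (- h^-1) <= 27 * h ^+ 3.
Proof.
move=> h0.
have e : expR h^-1 = expR (h^-1 / 3) ^+ 3 by rewrite -expRM_natl; congr expR; field; rewrite gt_eqF.
have hV : 0 < h^-1 / 3 by rewrite divr_gt0 ?invr_gt0.
have : (h^-1 / 3) ^+ 3 <= expR h^-1.
  rewrite e lerXn2r ?nnegrE ?expR_ge0 ?(ltW hV)//.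
  by apply: le_trans (expR_ge1Dx _); rewrite lerDr.
have -> : 27 * h ^+ 3 = ((h^-1 / 3) ^+ 3)^-1 by field; rewrite gt_eqF.
by move=> le; rewrite expRN lef_pV2 ?posrE ?expR_gt0 ?exprn_gt0.
Qed.

(** [Q] stands for the expectation [Ph] at r = sqrt h, and [p'] for the space derivative of the
    solution divided by the prefactor that does not depend on [dl]. [Q0] and [Q1] are the expansion,
    [Q2] is semiconcavity. *)
Variables (p' : R -> R) (Q : R -> R -> R) (G K0 kap K A D : R).
Hypotheses (K0_gt0 : 0 < K0) (K_ge0 : 0 <= K) (A_ge0 : 0 <= A) (D_ge1 : 1 <= D).
Hypothesis Q0 : forall (h : R), 0 < h -> h <= 1 -> `|Q h 0 - K0| <= K * Num.sqrt h.
Hypothesis Q1 : forall (h dl : R), 0 < h -> h <= 1 -> dl != 0 -> `|dl| <= 1 ->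
  `|(Q h dl - Q h 0) / dl - kap| <=
    K * (`|dl| * h ^- 2) + K * Num.sqrt h + K * (`|dl|^-1 * expR (- (h^-1 * (D + 1)))).
Hypothesis Q2 : forall (h dl : R), 0 < h -> h <= 1 -> `|dl| <= 1 ->
  expR (- (h^-1 * (dl * G))) * Q h dl <=
    Q h 0 + p' h * dl + A * h ^- 2 * expR (h^-1 * (D - 1)) * dl ^+ 2.

(* This step beats the semiconcavity constant exp((D - 1) / h) and is still large
   compared with the truncation error exp(- (D + 1) / h) of the expansion. *)
Let dl h := expR (- (h^-1 * D)).
Let q s h := (Q h (s * dl h) - Q h 0) / (s * dl h).
Let er h := A * h ^- 2 * expR (h^-1 * (D - 1)) * dl h.

Let dl_gt0 h : 0 < dl h. Proof. exact: expR_gt0. Qed.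

Let dl_le (h : R) : 0 < h -> h <= 1 -> dl h <= 27 * h ^+ 3 /\ dl h <= 1.
Proof.
move=> h0 h1; have hV : 0 < h^-1 by rewrite invr_gt0.
split.
  apply: le_trans (expR_cube_le h0); rewrite ler_expR lerN2.
  by rewrite -[leLHS]mulr1 ler_wpM2l// ltW.
by rewrite -[leRHS]expR0 ler_expR oppr_le0 mulr_ge0 ?(ltW hV)//; exact: le_trans ler01 D_ge1.
Qed.

Let h_le (h : R) : 0 < h -> h <= 1 -> h <= Num.sqrt h.
Proof.
move=> h0 h1; rewrite -{1}(sqr_sqrtr (ltW h0)) expr2 -[leRHS]mul1r ler_wpM2r//.
by rewrite -sqrtr1 ler_wsqrtr.
Qed.

Let hX_le (h : R) n : 0 < h -> h <= 1 -> h ^+ n.+1 <= Num.sqrt h.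
Proof.
move=> h0 h1; apply: le_trans (h_le h0 h1); rewrite exprS -[leRHS]mulr1.
by rewrite ler_wpM2l ?(ltW h0)// exprn_ile1// ltW.
Qed.

Let cvg_le_sqrt (f : R -> R) l C :
  (forall h : R, 0 < h -> h <= 1 -> `|f h - l| <= C * Num.sqrt h) -> f h @[h --> 0^'+] --> l.
Proof.
move=> H; apply: (@cvg_dist_le _ _ _ (fun h => C * Num.sqrt h)); last first.
  by rewrite -[X in _ --> X](mulr0 C); apply: cvgMr; exact: cvg_sqrt0.
near=> h; apply: H; near: h; [exact: nbhs_right_gt|exact: nbhs_right_le].
Unshelve. all: by end_near. Qed.

Let q_cvg (s : R) : `|s| = 1 -> q s h @[h --> 0^'+] --> kap.
Proof.
move=> s1; apply: (@cvg_le_sqrt _ _ (55 * K)) => h h0 h1.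
have [d3 d1] := dl_le h0 h1; have d0 := dl_gt0 h.
have dn : `|s * dl h| = dl h by rewrite normrM s1 mul1r gtr0_norm.
have sd0 : s * dl h != 0 by rewrite -normr_gt0 dn.
apply: le_trans (Q1 h0 h1 sd0 _) _; first by rewrite dn.
rewrite dn.
have e1 : dl h * h ^- 2 <= 27 * Num.sqrt h.
  apply: (@le_trans _ _ (27 * h ^+ 3 * h ^- 2)).
    by rewrite ler_wpM2r// invr_ge0 exprn_ge0// ltW.
  have -> : 27 * h ^+ 3 * h ^- 2 = 27 * h by field; rewrite gt_eqF.
  by rewrite ler_wpM2l// h_le.
have e2 : (dl h)^-1 * expR (- (h^-1 * (D + 1))) <= 27 * Num.sqrt h.
  have -> : (dl h)^-1 * expR (- (h^-1 * (D + 1))) = expR (- h^-1).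
    by rewrite /dl -expRN -expRD; congr expR; ring.
  by apply: le_trans (expR_cube_le h0) _; rewrite ler_wpM2l// hX_le.
have := ler_wpM2l K_ge0 e1; have := ler_wpM2l K_ge0 e2; lra.
Qed.

Let er_cvg : er h @[h --> 0^'+] --> (0 : R).
Proof.
apply: (@cvg_le_sqrt _ _ (27 * A)) => h h0 h1.
rewrite subr0 ger0_norm; last by rewrite !mulr_ge0 ?expR_ge0// invr_ge0 exprn_ge0// ltW.
have -> : er h = A * (h ^- 2 * expR (- h^-1)).
  rewrite /er /dl -[LHS]mulrA -expRD -mulrA; congr (_ * (_ * expR _)); ring.
rewrite [27 * A]mulrC -mulrA ler_wpM2l//.
apply: (@le_trans _ _ (h ^- 2 * (27 * h ^+ 3))).
  by rewrite ler_wpM2l ?expR_cube_le// invr_ge0 exprn_ge0// ltW.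
have -> : h ^- 2 * (27 * h ^+ 3) = 27 * h by field; rewrite gt_eqF.
by rewrite ler_wpM2l// h_le.
Qed.

Let weight_cvg (s : R) : `|s| = 1 -> expR (- (h^-1 * (s * dl h * G))) @[h --> 0^'+] --> (1 : R).
Proof.
move=> s1; rewrite -[X in _ --> X]expR0.
suff c : - (h^-1 * (s * dl h * G)) @[h --> 0^'+] --> (0 : R).
  exact: (cvg_comp _ _ c (@continuous_expR R 0)).
apply: (@cvg_le_sqrt _ _ (27 * `|G|)) => h h0 h1.
have [d3 _] := dl_le h0 h1.
rewrite subr0 normrN !normrM s1 mul1r gtr0_norm ?invr_gt0// gtr0_norm// mulrA.
have -> : 27 * `|G| * Num.sqrt h = 27 * Num.sqrt h * `|G| by ring.
rewrite ler_wpM2r//.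
apply: (@le_trans _ _ (h^-1 * (27 * h ^+ 3))).
  by rewrite ler_wpM2l// invr_ge0 ltW.
have -> : h^-1 * (27 * h ^+ 3) = 27 * h ^+ 2 by field; rewrite gt_eqF.
by rewrite ler_wpM2l// hX_le.
Qed.

Let Q_cvg : Q h 0 @[h --> 0^'+] --> K0. Proof. exact: cvg_le_sqrt Q0. Qed.

Let Q_gt0 : \forall h \near 0^'+, 0 < Q h 0.
Proof. exact: (cvgr_gt K0 Q_cvg). Qed.

(** Semiconcavity at the steps [dl h] and [- dl h] encloses the derivative between the two
    quotients. The weight is compared with its tangent 1 - dl G / h, which is the source of the term
    [G / h * Q h 0]. *)
Lemma derivative_cvg : p' h + G / h * Q h 0 @[h --> 0^'+] --> kap.
Proof.
pose wt s h := expR (- (h^-1 * (s * dl h * G))).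
have s1 : `|1 : R| = 1 by rewrite normr1.
have sN1 : `|- 1 : R| = 1 by rewrite normrN normr1.
apply: (@squeeze_cvgr _ _ _ _ (fun h => wt 1 h * q 1 h - er h) (fun h => wt (- 1) h * q (- 1) h + er h)).
- near=> h.
  have h0 : 0 < h by near: h; exact: nbhs_right_gt.
  have h1 : h <= 1 by near: h; exact: nbhs_right_le.
  have [_ d1] := dl_le h0 h1; have d0 := dl_gt0 h.
  (* Dividing by [s * dl h] reverses the inequality for [s = -1]: [s = 1] gives the lower bound,
     [s = -1] the upper one. *)
  have key s : `|s| = 1 -> 0 <= Q h 0 -> s * dl h * (wt s h * q s h) <=
      s * dl h * (p' h + G / h * Q h 0) + dl h * er h.
    move=> sn Q00.
    have dn : `|s * dl h| = dl h by rewrite normrM sn mul1r gtr0_norm.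
    have sd0 : s * dl h != 0 by rewrite -normr_gt0 dn.
    have := Q2 h0 h1 (dl := s * dl h); rewrite dn => /(_ d1).
    rewrite -(real_normK (num_real (s * dl h))) dn -/(wt s h).
    have -> : Q h (s * dl h) = Q h 0 + s * dl h * q s h.
      by rewrite /q [s * dl h * _]mulrC divfK// addrC subrK.
    have := expR_ge1Dx (- (h^-1 * (s * dl h * G))); rewrite -/(wt s h).
    move/(ler_wpM2r Q00); rewrite /er; lra.
  have Q00 : 0 <= Q h 0.
    by apply: ltW; near: h; exact: Q_gt0.
  apply/andP; split.
    have := key 1 s1 Q00; rewrite mul1r -subr_ge0 => k.
    by rewrite -(ler_pM2l d0); lra.
  have := key (- 1) sN1 Q00; rewrite mulN1r => k.
  by rewrite -(ler_pM2l d0); lra.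
- rewrite -[X in _ --> X]subr0 -[X in _ --> X - _]mul1r; apply: cvgB; last exact: er_cvg.
  by apply: cvgM; [exact: weight_cvg|exact: q_cvg].
- rewrite -[X in _ --> X]addr0 -[X in _ --> X + _]mul1r; apply: cvgD; last exact: er_cvg.
  by apply: cvgM; [exact: weight_cvg|exact: q_cvg].
Unshelve. all: by end_near. Qed.

Lemma log_derivative_cvg : p' h / Q h 0 + G / h @[h --> 0^'+] --> kap / K0.
Proof.
have c : (p' h + G / h * Q h 0) / Q h 0 @[h --> 0^'+] --> kap / K0.
  by apply: cvgM; [exact: derivative_cvg|apply: cvgV => //; rewrite gt_eqF].
apply: cvg_trans c; apply: near_eq_cvg; near=> h.
have : Q h 0 != 0.
  rewrite gt_eqF//; near: h; exact: Q_gt0.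
by move=> Qn0; rewrite mulrDl mulfK.
Unshelve. all: by end_near. Qed.

End small_noise_limit.

Section log_derivative.
Context (R : realType) d (T : measurableType d) (P : probability T R).

(** Negation exchanges the positive and negative parts, and [fine] sends every infinite difference
    to 0, so the identity holds in all cases. *)
Lemma Rintegral_opp (f : T -> R) : \int[P]_w (- f w) = - \int[P]_w f w.
Proof.
rewrite /Rintegral integralE [in RHS]integralE.
rewrite -[fun w => (- f w)%:E]/(\- (fun w => (f w)%:E))%E funeposN funenegN.
by case: (integral P _ _) => [x||]; case: (integral P _ _) => [y||] //=; ring.
Qed.

(** An exponential vanishes nowhere, so a zero integral would make the whole space negligible. *)
Lemma Rintegral_expR_gt0 (f : T -> R) : P.-integrable setT (EFin \o (fun w => expR (f w))) ->
  0 < \int[P]_w expR (f w).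
Proof.
move=> fi; rewrite lt_neqAle; apply/andP; split; last first.
  by apply: Rintegral_ge0 => w _; exact: expR_ge0.
apply/eqP => f0.
have f00 : (\int[P]_w `|(EFin \o (fun w => expR (f w))) w| = 0)%E.
  under eq_integral do rewrite /= ger0_norm ?expR_ge0//.
  by rewrite -[LHS]fineK ?(integrable_fin_num measurableT fi)// -[fine _]f0.
have [N [mN PN0 subN]] := (ae_eq_integral_abs P measurableT (measurable_int _ fi)).1 f00.
have : P setT = 0%E.
  apply/eqP; rewrite -measure_le0 -PN0 le_measure ?inE// => w _; apply: subN => /=.
  by move=> /(_ I) [] /eqP; rewrite gt_eqF// expR_gt0.
by rewrite (@probability_setT _ _ _ P) => /eqP; rewrite onee_eq0.
Qed.

Variables (W : R -> {RV P >-> R}) (hW : standard_wiener W) (t q : R) (ht : 0 < t).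
Notation cpath f := {within `[0, t], continuous f}.
Notation mu := (@lebesgue_measure R).
Variable V : R -> R.
Hypothesis V_lb : exists m : R, forall x, m <= V x.
Hypothesis hVderivable : forall k : nat, (k < 4)%N -> forall x, derivable V^`(k) x 1.
Hypothesis hVcontinuous : continuous V^`(4).
Hypothesis hVconvex : forall x, 0 <= V^`(2) x.
Variable eta : R -> R -> R -> R.
Hypothesis eta_sol : forall h, 0 < h -> heat_solution V h (eta h).
Hypothesis eta_fk : forall h s x, 0 < h -> 0 < s -> eta h s x = feynman_kac W V h s x.
Variable phi : R -> R.
Hypothesis hphiC1 : C01 t phi.
Hypothesis hphi : reaches_sup_uniquely V t q phi.

Let a s := phi s + q.
Let v s := V^`(1) (a s).
Let b := phi t + q.

(** The shift is by [phi] for every starting point [q + dl]. The terms linear in [W] cancel against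
    the Cameron-Martin weight, and those linear in [dl] add up to [dl] times G. *)
Lemma fk_factorization : exists k : R, forall h dl, 0 < h ->
  fk W V h t (q + dl) = expR (- (h^-1 * k)) *
    (expR (- (h^-1 * (dl * G V t q phi))) * Ph W t V a (Num.sqrt h) dl).
Proof.
(* The value of S - F at [phi]: the last term is the action, integrated by parts by means of the
   Euler-Lagrange equation. *)
pose k := \int[mu]_(s in `[0, t]) V (a s) + b ^+ 2 / 2
  - (b * phi t + \int[mu]_(s in `[0, t]) (v s * phi s)) / 2.
exists k => h dl h0; pose r := Num.sqrt h.
have r0 : 0 < r by rewrite sqrtr_gt0.
have rr : r ^+ 2 = h by rewrite sqr_sqrtr// ltW.
have cphi : cpath phi by exact: (@C01_cpath _ _ _ hphiC1).
have ca : cpath a by apply: cpathD; [exact: cphi|exact: cpath_cst].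
have cV0 : continuous V by exact: (@potential_continuous _ _ hVderivable hVcontinuous 0 isT).
have cV1 : continuous V^`(1) by exact: (@potential_continuous _ _ hVderivable hVcontinuous 1 isT).
have cv : cpath v by exact: (@cpath_comp _ _ _ _ cV1 ca).
have cVa : cpath (fun s => V (a s)) by exact: (@cpath_comp _ _ _ _ cV0 ca).
have tangent s y : 0 <= s <= t -> V (a s) + v s * y <= V (a s + y).
  by move=> _; exact: convex_tangent.
have phiE u : 0 <= u <= t -> phi u = - (b * u) - \int[mu]_(s in `[0, t]) (v s * Num.min s u).
  exact: (euler_lagrange ht hVderivable hVcontinuous hphiC1 hphi).
have [_ _] := cameron_martin hW ht cV0 V_lb ca cv cphi tangent phiE (q + dl) h0.
rewrite -/r => CM.
have fkE : fk W V h t (q + dl) = fine (\int[P]_w (expR (- h^-1 *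
   (\int[mu]_(s in `[0, t]) V (r * W s w + (q + dl)) + (r * W t w + (q + dl)) ^+ 2 / 2)))%:E).
  rewrite /fk /Rintegral; congr fine; apply: eq_integral => w _; congr (expR _)%:E.
  by rewrite /F real_normK ?num_real// mulrN mulNr.
rewrite fkE CM.
have -> : forall (x y z : R), x * (y * z) = x * y * z by move=> *; rewrite mulrA.
rewrite -expRD /Ph /Rintegral.
set e := expR _.
have integrandE w : - h^-1 * (\int[mu]_(s in `[0, t]) V (r * W s w + phi s + (q + dl))
      + (r * W t w + phi t + (q + dl)) ^+ 2 / 2)
    + r^-1 * (b * W t w + \int[mu]_(s in `[0, t]) (v s * W s w))
    + (2 * h)^-1 * (b * phi t + \int[mu]_(s in `[0, t]) (v s * phi s)) =
    - (h^-1 * k) + - (h^-1 * (dl * G V t q phi)) + - rescaled W t V a r dl w.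
  have cW : cpath (fun s => W s w) by exact: (@wiener_cpath _ _ _ _ _ hW).
  have cy : cpath (fun s => dl + r * W s w).
    apply: cpathD; first exact: cpath_cst.
    by apply: cpathM; [exact: cpath_cst|exact: cW].
  have cVy : cpath (fun s => V (a s + (dl + r * W s w))).
    by apply: (@cpath_comp _ _ _ _ cV0); apply: cpathD; [exact: ca|exact: cy].
  have e1 : \int[mu]_(s in `[0, t]) V (r * W s w + phi s + (q + dl)) =
      \int[mu]_(s in `[0, t]) V (a s + (dl + r * W s w)).
    by apply: cpath_int_eq => s _; congr V; rewrite /a; ring.
  have cvy : cpath (fun s => v s * (dl + r * W s w)) by exact: (@cpathM _ _ _ _ cv cy).
  have cvW : cpath (fun s => v s * W s w) by exact: (@cpathM _ _ _ _ cv cW).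
  have e2 : \int[mu]_(s in `[0, t]) (v s * (dl + r * W s w)) =
      dl * \int[mu]_(s in `[0, t]) v s + r * \int[mu]_(s in `[0, t]) (v s * W s w).
    rewrite -(cpath_intZ dl cv) -(cpath_intZ r cvW) -cpath_intD; last 2 first.
    - by apply: cpathM; [exact: cpath_cst|exact: cv].
    - by apply: cpathM; [exact: cpath_cst|exact: cvW].
    by apply: cpath_int_eq => s _; ring.
  have e3 : Vrem V t a (fun s => dl + r * W s w) =
      \int[mu]_(s in `[0, t]) V (a s + (dl + r * W s w)) - \int[mu]_(s in `[0, t]) V (a s)
      - \int[mu]_(s in `[0, t]) (v s * (dl + r * W s w)).
    rewrite -(cpath_intB cVy cVa) -cpath_intB//.
    by apply: (@cpathD _ _ _ (fun s => - V (a s))); [exact: cVy|apply: cpathN; exact: cVa].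
  rewrite e1 /rescaled e3 e2 /G -/b -[V^`()]/(V^`(1)) -/a -rr /k.
  rewrite -[\int[mu]_(s in `[0, t]) V^`(1) (phi s + q)]/(\int[mu]_(s in `[0, t]) v s).
  set I1 := \int[mu]_(s in _) V (a s + _).
  set I2 := \int[mu]_(s in _) V (a s). set I3 := \int[mu]_(s in _) (v s * W s w).
  set I4 := \int[mu]_(s in _) (v s * phi s). set I5 := \int[mu]_(s in _) v s.
  have -> : r * W t w + phi t + (q + dl) = b + (dl + r * W t w) by rewrite /b; ring.
  by field; rewrite gt_eqF.
transitivity (fine (\int[P]_w (e%:E * (expR (- rescaled W t V a r dl w))%:E))%E).
  by congr fine; apply: eq_integral => w _; rewrite integrandE expRD EFinM.
rewrite integralZl//; last exact: (integrable_rescaled hW ht hVderivable hVcontinuous hVconvex ca dl r0).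
rewrite fineM//.
exact: (integrable_fin_num measurableT (integrable_rescaled hW ht hVderivable hVcontinuous hVconvex ca dl r0)).
Qed.

Lemma log_derivative_expansion : exists2 rho : R -> R,
  rho h @[h --> 0^'+] --> kappa W t V a / K0c W t V a &
  forall h, 0 < h -> h * ((eta h t)^`() q / eta h t q) = h * rho h - G V t q phi.
Proof.
have cV : continuous V by exact: (@potential_continuous _ _ hVderivable hVcontinuous 0 isT).
have cphi : cpath phi by exact: (@C01_cpath _ _ _ hphiC1).
have ca : cpath a by apply: cpathD; [exact: cphi|exact: cpath_cst].
have [M M0 VM] : exists2 M : R, 0 <= M & forall x, - M <= V x.
  have [m Vm] := V_lb; exists `|m| => // x.
  by apply: le_trans (Vm x); rewrite lerNl (le_trans (ler_norm _))// normrN.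
have [C C_gt0 VC] : exists2 C : R, 0 < C & forall x, `|x - q| <= 1 -> V x <= C.
  have q1 : 0 < `|q| + 1 by rewrite ltr_wpDl.
  have [C C_gt0 HC] := potential_bounded hVderivable hVcontinuous q1.
  exists C => // x xq; apply: le_trans (ler_norm _) (HC 0%N isT x _).
  by rewrite -[x](subrK q) (le_trans (ler_normD _ _))// addrC lerD2l.
have C_ge0 := ltW C_gt0.
have [k fkE] := fk_factorization.
(* [M * t + M] is the exponent of the semiconcavity constant; [|k|] pays for dividing by exp(- k /
   h), and the 1 makes the available exponent [D - 1]. *)
pose D := `|k| + M * t + M + 1.
have Mt : 0 <= M * t by rewrite mulr_ge0// ltW.
have k0 : 0 <= `|k| := normr_ge0 k.
have D1 : 1 <= D by rewrite /D; lra.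
pose A := 2 * (M + C + 24 * expR 2^-1).
have A0 : 0 <= A by rewrite mulr_ge0// !addr_ge0// mulr_ge0// expR_ge0.
(* Chosen so that rad^2 / (32 t) = D + 1; this is possible since [D] does not involve [rad]. *)
pose rad := Num.sqrt (32 * t * (D + 1)).
have D32 : 0 < 32 * t * (D + 1) by rewrite !mulr_gt0//; lra.
have rad0 : 0 < rad by rewrite sqrtr_gt0.
have [K K_gt0 HK] := core_estimates hW ht hVderivable hVcontinuous hVconvex ca rad0.
pose c (h : R) := (Num.sqrt (2 * pi * h))^-1.
have c0 (h : R) : 0 < h -> 0 < c h by move=> h0; rewrite invr_gt0 sqrtr_gt0 !mulr_gt0// pi_gt0.
pose N (h : R) := c h * expR (- (h^-1 * k)).
have N0 (h : R) : 0 < h -> 0 < N h by move=> h0; rewrite mulr_gt0 ?c0 ?expR_gt0.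
pose p' (h : R) := (eta h t)^`() q / N h.
pose Q (h dl : R) := Ph W t V a (Num.sqrt h) dl.
have etaE (h dl : R) : 0 < h ->
    eta h t (q + dl) = N h * (expR (- (h^-1 * (dl * G V t q phi))) * Q h dl).
  by move=> h0; rewrite eta_fk// feynman_kacE (fkE _ _ h0); exact: mulrA.
have eta0 (h : R) : 0 < h -> eta h t q = N h * Q h 0.
  by move=> h0; have := etaE h 0 h0; rewrite addr0 mul0r mulr0 oppr0 expR0 mul1r.
have K0_gt0 : 0 < K0c W t V a.
  apply: Rintegral_expR_gt0.
  exact: (integrable_energy2 hW ht hVderivable hVcontinuous hVconvex ca).
have sq (h : R) : 0 < h -> [/\ 0 < Num.sqrt h, Num.sqrt h ^+ 2 = h & Num.sqrt h ^+ 4 = h ^+ 2].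
  move=> h0; have s2 : Num.sqrt h ^+ 2 = h by rewrite sqr_sqrtr// ltW.
  by split; [rewrite sqrtr_gt0|exact: s2|rewrite -[in RHS]s2 -exprM].
have sq1 (h : R) : h <= 1 -> Num.sqrt h <= 1 by move=> h1; rewrite -[leRHS]sqrtr1 ler_wsqrtr.
exists (fun h => p' h / Q h 0 + G V t q phi / h); last first.
  move=> h h0; rewrite eta0// /p' mulrDr [_ * (G _ _ _ _ / h)]mulrCA mulfV ?gt_eqF// mulr1 addrK.
  by rewrite invfM -mulrA.
apply: (@log_derivative_cvg _ p' Q _ _ _ K A D) => //.
- exact: ltW.
- move=> h h0 h1; have [s0 _ _] := sq h h0.
  (* The first estimate does not contain the step; the value 1 is just an admissible one. *)
  by have [] := HK _ 1 s0 (sq1 _ h1) (oner_neq0 _); rewrite ?normr1.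
- move=> h dl h0 h1 dl0 dl1; have [s0 s2 s4] := sq h h0.
  have [_] := HK _ _ s0 (sq1 _ h1) dl0 dl1; rewrite s2 s4.
  have -> // : rad ^+ 2 / (32 * t) / h = h^-1 * (D + 1).
  rewrite /rad sqr_sqrtr ?(ltW D32)//; field.
  by rewrite !gt_eqF.
- move=> h dl h0 h1 dl1.
  have cave := eta_semiconcave hW ht cV M0 VM C_ge0 VC h0 h1 (eta_sol h0) (fun s x => @eta_fk h s x h0) dl1.
  rewrite -(ler_pM2l (N0 h h0)) -etaE//; apply: le_trans cave _.
  rewrite eta0// [leRHS]mulrDr lerD//.
    by rewrite mulrDr lerD2l /p' mulrA [N h * _]mulrC divfK// gt_eqF// N0.
  rewrite [leRHS]mulrA ler_wpM2r ?sqr_ge0//.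
  have -> : N h * (A * h ^- 2 * expR (h^-1 * (D - 1))) =
      c h * (A * h ^- 2 * expR (- (h^-1 * k) + h^-1 * (D - 1))) by rewrite expRD /N; ring.
  rewrite ler_wpM2l ?(ltW (c0 _ _))// ler_wpM2l//.
    by rewrite mulr_ge0// invr_ge0 exprn_ge0// ltW.
  rewrite ler_expR -mulrN -mulrDr ler_wpM2l ?invr_ge0 ?(ltW h0)//.
  by have := ler_norm k; rewrite /D; lra.
Qed.

End log_derivative.

(** * From the logarithmic derivative to the asymptotic equivalence *)

Theorem proposition3p1 (R : realType) (d : measure_display)
  (T : measurableType d) (P : probability T R) (W : R -> {RV P >-> R})
  (hW : standard_wiener W)
  (t q : R) (ht : 0 < t)
  (V : R -> R)
  (hVbounded : exists m : R, forall x, m <= V x)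
  (hVderivable : forall k : nat, (k < 4)%N -> forall x, derivable V^`(k) x 1)
  (hVcontinuous : continuous V^`(4))
  (hVconvex : forall x, 0 <= V^`(2) x)
  (eta : R -> R -> R -> R)
  (heta_sol : forall h, 0 < h -> heat_solution V h (eta h))
  (heta_FK : forall h s x, 0 < h -> 0 < s ->
     eta h s x = feynman_kac W V h s x)
  (phi : R -> R)
  (hphiC1 : C01 t phi)
  (hphi : reaches_sup_uniquely V t q phi) :
  exists2 r : R -> R, r h / h @[h --> 0^'+] --> 0 &
    asymp_equiv
      (fun h => h * ((eta h t)^`() q / eta h t q))
      (fun h => - (G V t q phi
                   + K1bar W V t q phi / K0 W V t q phi * h + r h)).
Proof.
have [rho rho_cvg fE] := log_derivative_expansion hW ht hVbounded hVderivable hVcontinuous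
  hVconvex heta_sol heta_FK hphiC1 hphi.
pose a s := phi s + q; rewrite -/a in rho_cvg.
set f := fun h => h * _ in fE *; set g := G V t q phi in fE *.
set L := K1bar W V t q phi / K0 W V t q phi.
have id_cvg : h @[h --> 0^'+] --> (0 : R) by apply: cvg_at_right_filter; exact: cvg_id.
have [g0|g0] := eqVneq g 0; last first.
  (* Both sides tend to [- g], which is not 0: their ratio tends to 1, and the relative error
     absorbs all terms of order h, so the remainder can be 0. *)
  exists (fun=> 0).
    rewrite (_ : (fun _ => _) = fun=> 0); first exact: cvg_cst.
    by apply/funext => h; rewrite mul0r.
  pose s (h : R) := - (g + L * h + 0).
  have s_cvg : s h @[h --> 0^'+] --> - g.
    rewrite -[X in _ --> - X]addr0 -[X in _ --> - (X + _)]addr0 -[X in _ --> - (_ + X + _)](mulr0 L).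
    apply: cvgN; apply: cvgD; last exact: cvg_cst.
    by apply: cvgD; [exact: cvg_cst|apply: cvgMr].
  have f_cvg : f h @[h --> 0^'+] --> - g.
    have c : h * rho h - g @[h --> 0^'+] --> - g.
      rewrite -[X in _ --> X]add0r -[X in _ --> X + _](mul0r (kappa W t V a / K0c W t V a)).
      by apply: cvgB; [exact: cvgM|exact: cvg_cst].
    apply: cvg_trans c; apply: near_eq_cvg; near=> h; apply/esym/fE.
    by near: h; exact: nbhs_right_gt.
  have Ng0 : - g != 0 by rewrite oppr_eq0.
  exists (fun h => f h / s h - 1).
    rewrite -[X in _ --> X](subrr 1) -[X in _ --> X - _](mulfV Ng0).
    by apply: cvgB; [apply: cvgM => //; exact: cvgV|exact: cvg_cst].
  near=> h; rewrite -/(s h) addrC subrK mulrC divfK//.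
  by near: h; exact: (cvgr_neq0 _ s_cvg Ng0).
have K0E : K0 W V t q phi = K0c W t V a.
  rewrite /K0 /K0c /Rintegral unlock; congr fine; apply: eq_integral => w _; congr (expR _)%:E.
  by rewrite /F2 /energy2 /vint mulrN mulrC.
have K1E : K1bar W V t q phi = - kappa W t V a.
  rewrite /K1bar /kappa -Rintegral_opp /Rintegral unlock; congr fine.
  apply: eq_integral => w _; congr EFin; rewrite -/g g0.
  have -> : 2^-1 * F2 V t q phi (W^~ w) = - energy2 W t V a w.
    by rewrite /F2 /energy2 /vint mulrN mulrC.
  have -> : F3 V t q phi (W^~ w) = - vint W t V a 3 3 w by [].
  have -> : G2 V t q phi (W^~ w) = vint W t V a 3 2 w by [].
  have -> : G1 V t q phi (W^~ w) = linear1 W t V a w by [].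
  by ring.
(* Here the remainder is the exact difference of the two sides, the relative error is 0, and the
   content is that this difference is o(h). *)
exists (fun h => - f h - L * h).
  have c : - rho h - L @[h --> 0^'+] --> (0 : R).
    rewrite -[X in _ --> X](subrr L) [X in _ --> X - _](_ : L = - (kappa W t V a / K0c W t V a)).
      by apply: cvgB; [exact: cvgN|exact: cvg_cst].
    by rewrite /L K0E K1E mulNr.
  apply: cvg_trans c; apply: near_eq_cvg; near=> h.
  have h0 : 0 < h by near: h; exact: nbhs_right_gt.
  have -> : f h = h * rho h - g by exact: fE.
  by rewrite g0; field; rewrite gt_eqF.
exists (fun=> 0); first exact: cvg_cst.
by near=> h; rewrite g0; ring.
Unshelve. all: by end_near. Qed.
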